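(* Let $n\geq 2$ and let $D\subset\mathbb{C}^n$ be a non-degenerate convex domain. Then for every $z\in D$, $$\frac{\pi^n}{(2n)!\,(2n)^n}\leq \frac{v_D(z)}{K_D(z)} \leq \left(\frac{4\pi (4^n-1)}{3}\right)^n$$ both for $v_D=c_D$ (the Carathéodory-Eisenman volume element) and for $v_D=k_D$ (the Kobayashi-Eisenman volume element), where $K_D$ is the Bergman kernel of $D$ restricted to the diagonal.
   Context: A domain is a nonempty connected open set. A domain $D\subset\mathbb{C}^n$ is non-degenerate if it contains no complex lines (complex affine lines). $\mathbb{B}^n$ is the open unit ball of $\mathbb{C}^n$, $\mathcal{O}(X,Y)$ is the set of holomorphic maps from $X$ to $Y$, and $\det\psi'$ is the complex Jacobian determinant of a holomorphic map $\psi$. The Carathéodory and Kobayashi-Eisenman volume elements of a domain $D\subset \mathbb{C}^n$ at $z^0\in D$ are $$c_D(z^0)=\sup\{|\det\psi'(z^0)|^2:\psi\in\mathcal{O}(D,\mathbb{B}^n),\ \psi(z^0)=0\},$$ $$k_D(z^0)=\inf\{|\det\psi'(0)|^{-2}:\psi\in\mathcal{O}(\mathbb{B}^n,D),\ \psi(0)=z^0\}$$ (with $|\det\psi'(0)|^{-2}=+\infty$ if $\det\psi'(0)=0$). The Bergman space $A^2(D)$ is the Hilbert space of holomorphic $f:D\to\mathbb{C}$ with $\|f\|_D^2:=\int_D|f|^2\,dV<\infty$, where $dV$ is Lebesgue measure on $\mathbb{C}^n$. The Bergman kernel $K_D(z,w)$ is its reproducing kernel, and $K_D(z):=K_D(z,z)=\sup\{|f(z)|^2: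 f\in A^2(D),\ \|f\|_D\leq 1\}$. For non-degenerate convex $D$ one has $K_D>0$ on $D$, so the quotient is meaningful. *)

(* Defs.v *)
From HB Require Import structures.
From mathcomp Require Import all_boot all_order all_algebra.
From mathcomp Require Import all_classical all_reals all_analysis.
From mathcomp Require Import complex.

Set Implicit Arguments.
Unset Strict Implicit.
Unset Printing Implicit Defensive.

Import Order.TTheory GRing.Theory Num.Theory.
Import numFieldNormedType.Exports.

Local Open Scope classical_set_scope.
Local Open Scope ring_scope.

(* [R[i]] packaged as a [numClosedFieldType], so that it gets its topology and
   normed-module structure from the generic MathComp-Analysis instances. Over
   this field [differentiable] means Frechet differentiable with a
   [Cplx R]-linear differential, i.e. complex differentiable. *)
Definition Cplx (R : realType) : numClosedFieldType := R[i].

(* The library norm [`|z|] takes its values in the complex field itself. *)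
Definition cmod (R : realType) (z : Cplx R) : R := ComplexField.Normc.normc z.

(* [mu \x nu] with its sigma-finite structure: the canonical instance that the
   library infers for [\x] only covers subprobabilities. *)
Section SigmaFiniteProduct.
Context d1 d2 (T1 : measurableType d1) (T2 : measurableType d2) (R : realType).
Variables (mu : {sigma_finite_measure set T1 -> \bar R})
          (nu : {sigma_finite_measure set T2 -> \bar R}).

Definition prod_measure : set (T1 * T2) -> \bar R := (mu \x nu)%E.

HB.instance Definition _ := Measure.on prod_measure.

Let prod_measure_sigma_finite : sigma_finite setT prod_measure.
Proof.
have /sigma_finiteP[F [TF ndF Foo]] := sigma_finiteT mu.
have /sigma_finiteP[G [TG ndG Goo]] := sigma_finiteT nu.
exists (fun n => F n `*` G n).
  rewrite -setXTT TF TG; apply/seteqP; split=> -[x y] /=.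
    move=> [[i _ Fx] [j _ Gy]]; exists (maxn i j) => //; split.
      by move: x Fx; exact/subsetPset/ndF/leq_maxl.
    by move: y Gy; exact/subsetPset/ndG/leq_maxr.
  by move=> [i _ [/= ? ?]]; split; exists i.
move=> k; have [? ?] := Foo k; have [? ?] := Goo k.
split; first exact: measurableX.
by rewrite /prod_measure product_measure1E// lte_mul_pinfty// ge0_fin_numE.
Qed.

HB.instance Definition _ := Measure_isSigmaFinite.Build _ _ _ prod_measure
  prod_measure_sigma_finite.

End SigmaFiniteProduct.

Section PowerMeasure.
Local Open Scope ereal_scope.
Context d (T : measurableType d) (R : realType).

Definition tcons n (p : T * n.-tuple T) : n.+1.-tuple T :=
  [the n.+1.-tuple T of p.1 :: p.2].

Lemma measurable_tcons n : measurable_fun setT (@tcons n).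
Proof. exact: measurable_cons. Qed.

Section Step.
Variables (mu : {sigma_finite_measure set T -> \bar R}) (n : nat).
Variable nu : {sigma_finite_measure set (n.-tuple T) -> \bar R}.

Definition cons_measure : set (n.+1.-tuple T) -> \bar R :=
  pushforward (prod_measure mu nu) (@tcons n).

Let M := measure_function_pushforward__canonical__measure_function_Measure
  (prod_measure mu nu) (@measurable_tcons n).

Let cons_measure0 : cons_measure set0 = 0. Proof. exact: (measure0 M). Qed.

Let cons_measure_ge0 A : 0 <= cons_measure A.
Proof. exact: (measure_ge0 M). Qed.

Let cons_measure_sigma_additive : semi_sigma_additive cons_measure.
Proof. exact: (@measure_semi_sigma_additive _ _ _ M). Qed.

HB.instance Definition _ := isMeasure.Build _ _ _ cons_measure
  cons_measure0 cons_measure_ge0 cons_measure_sigma_additive.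

Let cons_measure_sigma_finite : sigma_finite setT cons_measure.
Proof.
have [F UF mF] := sigma_finiteT (prod_measure mu nu).
pose un (t : n.+1.-tuple T) := (thead t, [tuple of behead t]).
have tK : cancel (@tcons n) un.
  by case=> x t; congr pair; apply/val_inj.
have mun : measurable_fun setT un.
  apply/measurable_fun_pairP; split; last exact: measurable_behead.
  exact: measurable_tnth.
exists (fun i => un @^-1` F i).
  by rewrite -preimage_bigcup -UF preimage_setT.
move=> i; have [mFi Fioo] := mF i; split.
  by rewrite -[X in measurable X]setTI; exact: mun.
rewrite /cons_measure /pushforward -comp_preimage (_ : un \o _ = id)//.
by apply/funext => p; exact: tK.
Qed.

HB.instance Definition _ :=
  Measure_isSigmaFinite.Build _ _ _ cons_measure cons_measure_sigma_finite.

End Step.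

(* The [n]-fold product measure [mu \x ... \x mu] on [n.-tuple T]. *)
Fixpoint power_measure (mu : {sigma_finite_measure set T -> \bar R}) (n : nat) :
    {sigma_finite_measure set (n.-tuple T) -> \bar R} :=
  if n is m.+1 then cons_measure mu (power_measure mu m)
  else dirac ([tuple] : 0.-tuple T).

Lemma power_measure_box (mu : {sigma_finite_measure set T -> \bar R}) n
    (A : 'I_n -> set T) : (forall i, measurable (A i)) ->
  power_measure mu n [set t | forall i, A i (tnth t i)] = \prod_(i < n) mu (A i).
Proof.
elim: n A => [|n IHn] A mA.
  by rewrite big_ord0/= diracE mem_set// => -[].
rewrite big_ord_recl /= /cons_measure /pushforward.
rewrite [X in prod_measure _ _ X](_ : _ =
    A ord0 `*` [set t | forall i, A (lift ord0 i) (tnth t i)]); last first.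
  apply/seteqP; split=> [[x t] /= h|[x t] /= [h0 h] i].
    by split; [exact: (h ord0)|move=> i; have := h (lift ord0 i); rewrite tnthS].
  by case: (unliftP ord0 i) => [j|] ->; rewrite ?tnthS.
rewrite /prod_measure product_measure1E//; last first.
  rewrite (_ : mkset _ = \bigcap_(i in setT)
      ((@tnth n T)^~ i @^-1` A (lift ord0 i))).
    apply: fin_bigcap_measurable => // i _.
    by rewrite -[X in measurable X]setTI; exact: measurable_tnth.
  by apply/seteqP; split=> t /= h i; [move=> _; exact: h|exact: h].
by congr (_ * _); exact: (IHn (fun i => A (lift ord0 i))) => i; exact: mA.
Qed.

End PowerMeasure.

Section LebesgueCn.
Context {R : realType}.

Local Notation R2 := (measurableTypeR R * measurableTypeR R)%type.

Definition lebesgue2 : {sigma_finite_measure set R2 -> \bar R} :=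
  prod_measure (@lebesgue_measure R) (@lebesgue_measure R).

(* Lebesgue measure on C^n is [lebesgue2n n] on [(R^2)^n], the two spaces being
   identified through [of_coords]. *)
Definition lebesgue2n (n : nat) :
    {sigma_finite_measure set (n.-tuple R2) -> \bar R} :=
  power_measure lebesgue2 n.

Definition of_coords (n : nat) (t : n.-tuple R2) : 'rV[Cplx R]_n :=
  \row_i (Complex (tnth t i).1 (tnth t i).2 : Cplx R).

Definition integral_Cn (n : nat) (D : set 'rV[Cplx R]_n)
    (g : 'rV[Cplx R]_n -> \bar R) : \bar R :=
  (\int[lebesgue2n n]_(t in @of_coords n @^-1` D) g (of_coords t))%E.

End LebesgueCn.

Section SeveralComplexVariables.
Context {R : realType} {n : nat}.
Local Notation Cn := 'rV[Cplx R]_n.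
Implicit Types (D : set Cn) (z : Cn).

Definition domain D := [/\ D !=set0, open D & connected D].

(* The scalars of [Cn] are complex, but the coefficients allowed in the library
   predicate [convex_set] lie between 0 and 1 in the order of [R[i]], hence are
   real: for [D : set Cn] it is the usual notion. *)
Definition convex_domain D := domain D /\ convex_set D.

Definition no_complex_line D :=
  ~ exists a v : Cn, v != 0 /\ forall t : Cplx R, D (a + t *: v).

Definition unit_ball : set Cn := [set z | \sum_i cmod (z ord0 i) ^+ 2 < 1].

(* Maps are total functions; only their values on the open set [D] matter. *)
Definition holomorphic_on (W : normedModType (Cplx R)) D (f : Cn -> W) :=
  forall z, D z -> differentiable f z.

Definition holomorphic_maps D E : set (Cn -> Cn) :=
  [set psi | holomorphic_on D psi /\ forall z, D z -> E (psi z)].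

Definition caratheodory_volume D z : \bar R :=
  ereal_sup [set ((cmod (\det ('J psi z))) ^+ 2)%:E | psi in
    [set psi | holomorphic_maps D unit_ball psi /\ psi z = 0]].

(* In [\bar R] the inverse of 0 is [+oo]. *)
Definition kobayashi_volume D z : \bar R :=
  ereal_inf [set (((cmod (\det ('J psi 0))) ^+ 2)%:E^-1)%E | psi in
    [set psi | holomorphic_maps unit_ball D psi /\ psi 0 = z]].

Definition bergman_normsq D (f : Cn -> Cplx R) : \bar R :=
  integral_Cn D (fun z => (cmod (f z) ^+ 2)%:E).

Definition bergman_space D : set (Cn -> Cplx R) :=
  [set f | holomorphic_on D f /\ (bergman_normsq D f < +oo)%E].

(* The diagonal [K_D(z, z)] of the Bergman kernel, as the supremum of [|f z|^2]
   over the unit ball of the Bergman space. *)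
Definition bergman_diag D z : \bar R :=
  ereal_sup [set ((cmod (f z)) ^+ 2)%:E | f in
    [set f | bergman_space D f /\ (bergman_normsq D f <= 1)%E]].

End SeveralComplexVariables.

(* Main.v *)
(* Let q be the Minkowski gauge of D - z. As D contains no complex line, q is
   positive somewhere on every complex line through 0. Pick greedily vectors
   p_0, p_1, ... such that p_i lies in the kernels of the previously chosen forms
   l_0, ..., l_(i-1), q(w p_i) <= |w|, and Hahn-Banach gives a complex linear
   form l_i with Re l_i <= q and l_i(p_i) = 1. With P the matrix of rows p_i and
   L the matrix of columns l_j, the product P L is unipotent triangular, so
   det P * det L = 1, and
     { z + x P : |x_1| + ... + |x_n| < 1 }  <=  D  <=
     { w : Re ((w - z) L)_j <= 1 for all j }.
   All the invariants at z are comparable to |det L|^2 = |det P|^-2.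
   - Bergman, from above: |f|^2 has the sub-mean value property on circled sets,
     and the cross-polytope has volume (2 pi)^n / (2 n)!. From below: the function
     prod_j (2 - ((w - z) L)_j)^-2 is square integrable on a product of
     half-planes. This gives
     |det L|^2 / (4 pi)^n <= K <= |det L|^2 (2 n)! / (2 pi)^n.
   - Volume elements: the Schwarz lemma in the unit disc and in the half-plane
     bounds the Jacobian entries of the competitors, while dilations of the
     cross-polytope and products of Cayley transforms are competitors. This gives
     |det L|^2 / (4 n)^n <= c, k <= |det L|^2 n^(2 n).
   The quotient bounds follow, the upper one because 3 n^2 <= 4^n - 1. *)
Require Import Defs.
From mathcomp Require Import all_boot all_order all_algebra.
From mathcomp Require Import all_classical all_reals all_analysis measurable_realfun complex.
From mathcomp Require Import ring lra.
Set Implicit Arguments.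
Unset Strict Implicit.
Unset Printing Implicit Defensive.
Import Order.TTheory GRing.Theory Num.Theory.
Import numFieldNormedType.Exports.
Local Open Scope classical_set_scope.
Local Open Scope ring_scope.

(** * Real form of Goursat's theorem *)

Section SegmentIntegral.
Variable R : realType.
Implicit Types (f g : R -> R) (a b c : R).

(** Holomorphy is assumed only as pointwise complex differentiability, so nothing is known about the
    derivative at the start; hence a Goursat argument is unavoidable. It is needed only for one real
    closed form, the imaginary part of [g dz / z] in logarithmic coordinates, which yields the mean
    value property. Both Schwarz lemmas and the sub-mean value inequality come out of it by
    multiplying with a constant, without Cauchy's formula or power series.

    The vectors [p_i] are controlled by the gauge alone and not by a Euclidean norm, so [P] and [L]
    have no orthogonality and no bound of their own. This is harmless: each invariant is tested only
    through [P] from inside and through [L] from outside, a linear change of coordinates enters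
    through its determinant, and [det P * det L = 1] matches the two sides. *)

Definition segint f a b := \int[@lebesgue_measure R]_(x in `[a, b]) f x.

(** Continuity is two-sided even at the endpoints: every integrand here is defined and continuous in
    a neighbourhood of the segment. *)
Definition cts_on f a b := forall x, a <= x <= b -> {for x, continuous f}.

Lemma cts_on_integrable f a b : cts_on f a b ->
  (@lebesgue_measure R).-integrable `[a, b] (EFin \o f).
Proof.
move=> h; apply: continuous_compact_integrable; first exact: segment_compact.
by apply: continuous_in_subspaceT => x; rewrite inE/= in_itv/= => /h.
Qed.

Lemma segint_split f a b c : a <= b <= c -> cts_on f a c ->
  segint f a c = segint f a b + segint f b c.
Proof.
move=> /andP[ab bc] h.
have iac := cts_on_integrable h.
rewrite /segint; apply/eqP; rewrite addrC -subr_eq; apply/eqP.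
have -> := Rintegral_itvB (x := b) iac; rewrite ?bnd_simp//.
rewrite Rintegral_itv_obnd_cbnd//.
apply: (integrableS _ _ _ iac) => //.
by apply: subset_itv; rewrite ?bnd_simp.
Qed.

Lemma segint_cst a b k : a <= b -> segint (fun=> k) a b = k * (b - a).
Proof.
move=> ab; rewrite /segint Rintegral_cst//; congr (_ * _).
have := @lebesgue_measure_itv R `[a, b] => /= ->; rewrite lte_fin.
by case: ltgtP ab => // -> _; rewrite subrr.
Qed.

Lemma segint_id a b : a <= b -> segint id a b = (b ^+ 2 - a ^+ 2) / 2.
Proof.
rewrite le_eqVlt => /predU1P[<-|ab].
  by rewrite /segint set_itv1 Rintegral_set1; ring.
have -> : (b ^+ 2 - a ^+ 2) / 2 = b ^+ 2 / 2 - a ^+ 2 / 2 by ring.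
have d x : is_derive x (1 : R) (fun y : R => y ^+ 2 / 2) x.
  apply: is_derive_eq; rewrite /GRing.scale/=; by field.
rewrite /segint /Rintegral.
rewrite (@continuous_FTC2 _ id (fun x => x ^+ 2 / 2))//.
- by apply: continuous_subspaceT => x; exact: cvg_id.
- have ct : continuous (fun y : R => y ^+ 2 / 2).
    by move=> x; apply/differentiable_continuous/derivable1_diffP; case: (d x).
  split.
  + by move=> x _; case: (d x).
  + by apply: cvg_at_right_filter; exact: ct.
  + by apply: cvg_at_left_filter; exact: ct.
- by move=> x _; rewrite derive1E; case: (d x).
Qed.

Lemma cts_on_cst k a b : cts_on (fun=> k) a b.
Proof. by move=> x _; exact: cvg_cst. Qed.

Lemma cts_onD f g a b : cts_on f a b -> cts_on g a b -> cts_on (f \+ g) a b.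
Proof. by move=> hf hg x xab; apply: cvgD; [exact: hf|exact: hg]. Qed.

Lemma cts_onZ k f a b : cts_on f a b -> cts_on (fun x => k * f x) a b.
Proof. by move=> hf x xab; apply: cvgM; [exact: cvg_cst|exact: hf]. Qed.

Lemma segintD f g a b : cts_on f a b -> cts_on g a b ->
  segint (fun x => f x + g x) a b = segint f a b + segint g a b.
Proof. by move=> hf hg; rewrite /segint RintegralD//; exact: cts_on_integrable. Qed.

Lemma segintZ k f a b : cts_on f a b ->
  segint (fun x => k * f x) a b = k * segint f a b.
Proof. by move=> hf; rewrite /segint RintegralZl//; exact: cts_on_integrable. Qed.

Lemma segint_le f g a b : cts_on f a b -> cts_on g a b ->
  (forall x, a <= x <= b -> f x <= g x) -> segint f a b <= segint g a b.
Proof.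
move=> hf hg fg; apply: le_Rintegral => //; try exact: cts_on_integrable.
Qed.

(** Squeeze between the affine functions [k - e + l x] and [k + e + l x], whose integrals are
    explicit. With [l = 0] it also serves for means over small circles. *)
Lemma segint_affine_approx f k l e a b : a <= b -> cts_on f a b ->
  (forall x, a <= x <= b -> `|f x - (k + l * x)| <= e) ->
  `|segint f a b - (k * (b - a) + l * ((b ^+ 2 - a ^+ 2) / 2))| <= e * (b - a).
Proof.
move=> ab hf fe.
have cid : cts_on id a b by move=> x _; exact: cvg_id.
have ca c : cts_on (fun x => c + l * x) a b.
  by apply: cts_onD; [exact: cts_on_cst|exact: cts_onZ].
have Ia c : segint (fun x => c + l * x) a b =
    c * (b - a) + l * ((b ^+ 2 - a ^+ 2) / 2).
  rewrite segintD; [|exact: cts_on_cst|exact: cts_onZ].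
  by rewrite segint_cst// segintZ// segint_id.
have h1 : segint f a b <= segint (fun x => (k + e) + l * x) a b.
  apply: segint_le => // x /fe; rewrite ler_norml; lra.
have h2 : segint (fun x => (k - e) + l * x) a b <= segint f a b.
  apply: segint_le => // x /fe; rewrite ler_norml; lra.
move: h1 h2; rewrite !Ia ler_norml; lra.
Qed.

End SegmentIntegral.

(** * Closed differential forms on rectangles *)

Section Goursat.
Variable R : realType.
Implicit Types (p q F : R -> R -> R) (a b c d : R).

(** Total differentiability at one point, with the error measured in the l1 norm: partial
    derivatives alone would not give the approximation on a whole small rectangle. *)
Definition is_diff2 F x0 y0 a b := forall e, 0 < e -> exists2 dl, 0 < dl &
  forall x y, `|x - x0| <= dl -> `|y - y0| <= dl ->
  `|F x y - (F x0 y0 + a * (x - x0) + b * (y - y0))| <=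
  e * (`|x - x0| + `|y - y0|).

Lemma near_dist_le (x0 e : R) : 0 < e -> \forall x \near x0, `|x - x0| <= e.
Proof.
by move=> e0; apply/nbhs_ballP; exists e => //= x; rewrite /ball/= distrC => /ltW.
Qed.

(** Continuity in each variable separately is enough, since the sides of a rectangle are parallel to
    the axes. *)
Lemma is_diff2_cts F x0 y0 a b : is_diff2 F x0 y0 a b ->
  {for x0, continuous (F^~ y0)} /\ {for y0, continuous (F x0)}.
Proof.
move=> /(_ 1 ltr01)[dl dl0 h]; split.
  apply/cvgrPdist_le => e e0.
  have M0 : 0 < `|a| + 1 by rewrite ltr_wpDl.
  near=> x.
  have xd : `|x - x0| <= dl.
    by near: x; exact: near_dist_le.
  have xe : `|x - x0| <= e / (`|a| + 1).
    near: x; apply: near_dist_le.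
    by rewrite divr_gt0.
  have := h x y0 xd; rewrite subrr normr0 mulr0 !addr0 mul1r => /(_ (ltW dl0)) hx.
  rewrite distrC.
  rewrite (_ : F x y0 - F x0 y0 =
    (F x y0 - (F x0 y0 + a * (x - x0))) + a * (x - x0)); last by ring.
  rewrite (le_trans (ler_normD _ _))// normrM.
  apply: (le_trans (lerD hx (lexx _))).
  by rewrite -{1}(mul1r `|x - x0|) -mulrDl addrC mulrC -ler_pdivlMr.
apply/cvgrPdist_le => e e0.
have M0 : 0 < `|b| + 1 by rewrite ltr_wpDl.
near=> y.
have yd : `|y - y0| <= dl.
  by near: y; exact: near_dist_le.
have ye : `|y - y0| <= e / (`|b| + 1).
  near: y; apply: near_dist_le.
  by rewrite divr_gt0.
have := h x0 y; rewrite subrr normr0 mulr0 !addr0 add0r mul1r.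
move=> /(_ (ltW dl0) yd) hx.
rewrite distrC.
rewrite (_ : F x0 y - F x0 y0 =
  (F x0 y - (F x0 y0 + b * (y - y0))) + b * (y - y0)); last by ring.
rewrite (le_trans (ler_normD _ _))// normrM.
apply: (le_trans (lerD hx (lexx _))).
by rewrite -{1}(mul1r `|y - y0|) -mulrDl addrC mulrC -ler_pdivlMr.
Unshelve. all: by end_near. Qed.

(** The integral of [p dx + q dy] along the boundary of [[a, b] x [c, d]], counterclockwise. *)
Definition circulation p q a b c d :=
  segint (p^~ c) a b + segint (q b) c d - segint (p^~ d) a b - segint (q a) c d.

Definition rect_cts p q a b c d := forall x y, a <= x <= b -> c <= y <= d ->
  {for x, continuous (p^~ y)} /\ {for y, continuous (q x)}.

Lemma rect_cts_sub p q a b c d a' b' c' d' :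
  a <= a' -> b' <= b -> c <= c' -> d' <= d ->
  rect_cts p q a b c d -> rect_cts p q a' b' c' d'.
Proof.
move=> aa bb cc dd h x y /andP[ax xb] /andP[cy yd]; apply: h.
  by rewrite (le_trans aa)//= (le_trans xb).
by rewrite (le_trans cc)//= (le_trans yd).
Qed.

Lemma circulation_splitx m p q a b c d : a <= m <= b -> c <= d ->
  rect_cts p q a b c d ->
  circulation p q a b c d = circulation p q a m c d + circulation p q m b c d.
Proof.
move=> amb cd h; rewrite /circulation.
rewrite (@segint_split _ (p^~ c) a m b)//; last first.
  by move=> x xab; have [] := h x c xab; rewrite ?lexx.
rewrite (@segint_split _ (p^~ d) a m b)//; last first.
  by move=> x xab; have [] := h x d xab; rewrite ?lexx ?cd.
ring.
Qed.

Lemma circulation_splity m p q a b c d : a <= b -> c <= m <= d ->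
  rect_cts p q a b c d ->
  circulation p q a b c d = circulation p q a b c m + circulation p q a b m d.
Proof.
move=> ab cmd h; rewrite /circulation.
rewrite (@segint_split _ (q a) c m d)//; last first.
  by move=> y ycd; have [] := h a y _ ycd; rewrite ?lexx.
rewrite (@segint_split _ (q b) c m d)//; last first.
  by move=> y ycd; have [] := h b y _ ycd; rewrite ?lexx ?ab.
ring.
Qed.

(** The coefficient [t] of [y] in [p] is also that of [x] in [q], so the affine part is a closed
    form and contributes 0; what remains is the error times the perimeter. *)
Lemma circulation_affine_approx p q a b c d (p0 p1 q0 q1 t e : R) :
  a <= b -> c <= d -> rect_cts p q a b c d ->
  (forall x y, a <= x <= b -> c <= y <= d ->
    `|p x y - (p0 + p1 * x + t * y)| <= e /\
    `|q x y - (q0 + t * x + q1 * y)| <= e) ->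
  `|circulation p q a b c d| <= 2 * e * ((b - a) + (d - c)).
Proof.
move=> ab cd ct h.
have aab : a <= a <= b by rewrite lexx.
have bab : a <= b <= b by rewrite lexx ab.
have ccd : c <= c <= d by rewrite lexx.
have dcd : c <= d <= d by rewrite lexx cd.
have P y : c <= y <= d -> `|segint (p^~ y) a b - ((p0 + t * y) * (b - a)
    + p1 * ((b ^+ 2 - a ^+ 2) / 2))| <= e * (b - a).
  move=> ycd; apply: segint_affine_approx => // [x xab|x xab].
    by have [] := ct x y xab ycd.
  have [+ _] := h x y xab ycd.
  by rewrite (_ : p0 + t * y + p1 * x = p0 + p1 * x + t * y)//; ring.
have Q x : a <= x <= b -> `|segint (q x) c d - ((q0 + t * x) * (d - c)
    + q1 * ((d ^+ 2 - c ^+ 2) / 2))| <= e * (d - c).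
  move=> xab; apply: segint_affine_approx => // [y ycd|y ycd].
    by have [] := ct x y xab ycd.
  by have [] := h x y xab ycd.
have := P c ccd; have := P d dcd; have := Q a aab; have := Q b bab.
rewrite /circulation !ler_norml; lra.
Qed.

(** Inner sides cancel, so the four quarters sum to the whole and one of them carries at least a
    fourth of it. *)
Lemma circulation_quarter p q a b c d : a <= b -> c <= d ->
  rect_cts p q a b c d ->
  exists a' b' c' d', [/\ a <= a' /\ b' <= b, c <= c' /\ d' <= d,
    b' - a' = (b - a) / 2, d' - c' = (d - c) / 2 &
    `|circulation p q a b c d| <= 4 * `|circulation p q a' b' c' d'|].
Proof.
move=> ab cd ct.
pose m := (a + b) / 2; pose k := (c + d) / 2.
have amb : a <= m <= b by rewrite /m; apply/andP; split; lra.
have ckd : c <= k <= d by rewrite /k; apply/andP; split; lra.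
have [am mb] := andP amb; have [ck kd] := andP ckd.
have e : circulation p q a b c d =
    circulation p q a m c k + circulation p q a m k d +
    (circulation p q m b c k + circulation p q m b k d).
  rewrite (@circulation_splitx m)// (@circulation_splity k _ _ a m)//; last first.
    by move: ct; apply: rect_cts_sub.
  rewrite (@circulation_splity k _ _ m b)//.
  by move: ct; apply: rect_cts_sub.
have {e} : `|circulation p q a b c d| <=
    `|circulation p q a m c k| + `|circulation p q a m k d| +
    (`|circulation p q m b c k| + `|circulation p q m b k d|).
  rewrite e (le_trans (ler_normD _ _))// lerD// ?(le_trans (ler_normD _ _))//.
set C := `|_|; set C1 := `|_|; set C2 := `|_|; set C3 := `|_|; set C4 := `|_|.
move=> h.
have hb : m - a = (b - a) / 2 by rewrite /m; lra.
have hb' : b - m = (b - a) / 2 by rewrite /m; lra.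
have hk : k - c = (d - c) / 2 by rewrite /k; lra.
have hk' : d - k = (d - c) / 2 by rewrite /k; lra.
have [h1|h1] := leP C (4 * C1); first by exists a, m, c, k.
have [h2|h2] := leP C (4 * C2); first by exists a, m, k, d.
have [h3|h3] := leP C (4 * C3); first by exists m, b, c, k.
have gen (x x1 x2 x3 x4 : R) : x <= x1 + x2 + (x3 + x4) -> 4 * x1 < x ->
    4 * x2 < x -> 4 * x3 < x -> x <= 4 * x4 by lra.
exists m, b, k, d; split => //; exact: (gen _ _ _ _ _ h h1 h2 h3).
Qed.

Lemma nested_point (u v : nat -> R) : (forall n, u n <= u n.+1) ->
  (forall n, v n.+1 <= v n) -> (forall n, u n <= v n) ->
  exists x, forall n, u n <= x <= v n.
Proof.
move=> hu hv huv.
have mu m n : (m <= n)%N -> u m <= u n.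
  by move=> mn; have /nondecreasing_seqP := hu; exact.
have mv m n : (m <= n)%N -> v n <= v m.
  by move=> mn; have /nonincreasing_seqP := hv; exact.
have uv m n : u m <= v n.
  rewrite (le_trans (mu _ _ (leq_maxl m n)))// (le_trans (huv _))//.
  exact/mv/leq_maxr.
exists (sup (range u)) => n; apply/andP; split.
  apply: ub_le_sup; last by exists n.
  by exists (v 0) => _ [k _ <-].
by apply: ge_sup; [exists (u 0); exists 0|move=> _ [k _ <-]].
Qed.

Lemma half_expr_small (e : R) : 0 < e -> exists n, 2^-1 ^+ n <= e.
Proof.
move=> e0; have : @GRing.exp R 2^-1 @ \oo --> (0 : R).
  by apply: cvg_expr; rewrite ger0_norm; lra.
move=> /cvgrPdist_le /(_ e e0)[n _ /(_ n (leqnn n))] h; exists n.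
by move: h; rewrite sub0r normrN ger0_norm// exprn_ge0//; lra.
Qed.

(* Bisection of rectangles, for the closed form [p dx + q dy]; no continuity of
   the partial derivatives is assumed. *)
Lemma goursat p q a b c d : a <= b -> c <= d ->
  (forall x y, a <= x <= b -> c <= y <= d -> exists p1 t q1 : R,
    is_diff2 p x y p1 t /\ is_diff2 q x y t q1) ->
  circulation p q a b c d = 0.
Proof.
move=> ab cd hd.
have ct : rect_cts p q a b c d.
  move=> x y xab ycd; have [p1 [t [q1 [h1 h2]]]] := hd x y xab ycd.
  by split; [have [] := is_diff2_cts h1|
             have [] := is_diff2_cts h2].
pose good (Q : R * R * R * R) := let: (a', b', c', d') := Q in
  [/\ a <= a', a' <= b', b' <= b, c <= c' & c' <= d' /\ d' <= d].
pose next (Q Q' : R * R * R * R) :=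
  let: (a0, b0, c0, d0) := Q in let: (a', b', c', d') := Q' in
  [/\ a0 <= a' /\ b' <= b0, c0 <= c' /\ d' <= d0,
    b' - a' = (b0 - a0) / 2, d' - c' = (d0 - c0) / 2 &
    `|circulation p q a0 b0 c0 d0| <= 4 * `|circulation p q a' b' c' d'|].
have ex Q : exists Q', good Q -> good Q' /\ next Q Q'.
  have [gQ|nQ] := pselect (good Q); last by exists Q.
  case: Q gQ => [[[a0 b0] c0] d0] [aa a0b0 bb cc [c0d0 dd]].
  have [a' [b' [c' [d' [[h1 h1'] [h2 h2'] h3 h4 h5]]]]] :=
    @circulation_quarter p q a0 b0 c0 d0 a0b0 c0d0 (rect_cts_sub aa bb cc dd ct).
  exists (a', b', c', d') => _; split; last by [].
  split; [lra|lra|lra|lra|split; lra].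
have [step hstep] := choice ex.
pose Q n := iter n step (a, b, c, d).
have gQ n : good (Q n).
  elim: n => [|n IH]; first by rewrite /=; split.
  by have [] := hstep _ IH.
have nQ n : next (Q n) (Q n.+1) by have [] := hstep _ (gQ n).
have hab n : (Q n).1.1.2 - (Q n).1.1.1 = (b - a) * 2^-1 ^+ n.
  elim: n => [|n IH]; first by rewrite expr0 mulr1.
  move: (nQ n) IH; case: (Q n) => [[[? ?] ?] ?]; case: (Q n.+1) => [[[? ?] ?] ?].
  by move=> [_ _ -> _ _] /= ->; rewrite exprSr mulrA.
have hcd n : (Q n).2 - (Q n).1.2 = (d - c) * 2^-1 ^+ n.
  elim: n => [|n IH]; first by rewrite expr0 mulr1.
  move: (nQ n) IH; case: (Q n) => [[[? ?] ?] ?]; case: (Q n.+1) => [[[? ?] ?] ?].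
  by move=> [_ _ _ -> _] /= ->; rewrite exprSr mulrA.
pose C n := circulation p q (Q n).1.1.1 (Q n).1.1.2 (Q n).1.2 (Q n).2.
have hC n : `|C 0| <= 4 ^+ n * `|C n|.
  elim: n => [|n IH]; first by rewrite expr0 mul1r.
  rewrite (le_trans IH)// exprSr -mulrA ler_wpM2l ?exprn_ge0//.
  move: (nQ n); rewrite /C; case: (Q n) => [[[? ?] ?] ?].
  by case: (Q n.+1) => [[[? ?] ?] ?] [].
have [x hx] : exists x, forall n, (Q n).1.1.1 <= x <= (Q n).1.1.2.
  apply: nested_point => n.
  + by move: (nQ n); case: (Q n) => [[[? ?] ?] ?]; case: (Q n.+1) => [[[? ?] ?] ?] [[]].
  + by move: (nQ n); case: (Q n) => [[[? ?] ?] ?]; case: (Q n.+1) => [[[? ?] ?] ?] [[]].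
  + by move: (gQ n); case: (Q n) => [[[? ?] ?] ?] [].
have [y hy] : exists y, forall n, (Q n).1.2 <= y <= (Q n).2.
  apply: nested_point => n.
  + by move: (nQ n); case: (Q n) => [[[? ?] ?] ?]; case: (Q n.+1) => [[[? ?] ?] ?] [_ []].
  + by move: (nQ n); case: (Q n) => [[[? ?] ?] ?]; case: (Q n.+1) => [[[? ?] ?] ?] [_ []].
  + by move: (gQ n); case: (Q n) => [[[? ?] ?] ?] [? ? ? ? []].
have [p1 [t [q1 [hp hq]]]] := hd x y (hx 0) (hy 0).
pose S := (b - a) + (d - c).
have S0 : 0 <= S by rewrite /S; lra.
(* On the [n]-th rectangle the approximation error and the perimeter each carry a factor [2^-n];
   together they cancel the [4^n] lost by the bisection, leaving an arbitrary factor [e]. *)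
have key e : 0 < e -> `|C 0| <= e * (2 * S ^+ 2).
  move=> e0; have [d1 d10 h1] := hp e e0; have [d2 d20 h2] := hq e e0.
  pose dl := Num.min d1 d2.
  have dl0 : 0 < dl by rewrite lt_min d10.
  have S1 : 0 < S + 1 by lra.
  (* Dividing by [S + 1] instead of [S] covers the degenerate rectangle. *)
  have [n hn] := @half_expr_small (dl / (S + 1)) (divr_gt0 dl0 S1).
  have r0 : 0 <= (2^-1 : R) ^+ n by rewrite exprn_ge0//; lra.
  have Sn : S * 2^-1 ^+ n <= dl.
    move: hn; rewrite ler_pdivlMr// mulrDr mulr1 mulrC => hn.
    by apply: le_trans hn; rewrite lerDl.
  have W : (b - a) * 2^-1 ^+ n + (d - c) * 2^-1 ^+ n = S * 2^-1 ^+ n.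
    by rewrite -mulrDl.
  have W1 : 0 <= (b - a) * 2^-1 ^+ n by rewrite mulr_ge0//; lra.
  have W2 : 0 <= (d - c) * 2^-1 ^+ n by rewrite mulr_ge0//; lra.
  have [dl1 dl2] : dl <= d1 /\ dl <= d2 by rewrite !ge_min !lexx orbT.
  apply: (le_trans (hC n)).
  have : `|C n| <= 2 * (e * (S * 2^-1 ^+ n)) * (S * 2^-1 ^+ n).
    rewrite -[X in _ <= _ * X]W -hab -hcd /C.
    move: (hx n) (hy n) (gQ n) (hab n) (hcd n).
    case: (Q n) => [[[a' b'] c'] d'] /= hx' hy' [aa ab' bb cc [cd' dd]] hab' hcd'.
    apply: (@circulation_affine_approx _ _ _ _ _ _ (p x y - p1 * x - t * y) p1
       (q x y - t * x - q1 * y) q1 t) => //.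
      exact: rect_cts_sub ct.
    move=> x1 y1 hx1 hy1.
    have dx : `|x1 - x| <= (b - a) * 2^-1 ^+ n.
      by rewrite -hab' ler_norml; lra.
    have dy : `|y1 - y| <= (d - c) * 2^-1 ^+ n.
      by rewrite -hcd' ler_norml; lra.
    split.
      rewrite (_ : p x y - p1 * x - t * y + p1 * x1 + t * y1 =
         p x y + p1 * (x1 - x) + t * (y1 - y)); last by ring.
      rewrite (le_trans (h1 x1 y1 _ _)) ?ler_pM2l//; lra.
    rewrite (_ : q x y - t * x - q1 * y + t * x1 + q1 * y1 =
       q x y + t * (x1 - x) + q1 * (y1 - y)); last by ring.
    rewrite (le_trans (h2 x1 y1 _ _)) ?ler_pM2l//; lra.
  move=> h; rewrite (le_trans (ler_wpM2l _ h)) ?exprn_ge0//.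
  rewrite (_ : 4 ^+ n * _ = (4 * 2^-1 * 2^-1) ^+ n * (e * (2 * S ^+ 2))); last first.
    by rewrite !exprMn; ring.
  by rewrite (_ : 4 * 2^-1 * 2^-1 = 1) ?expr1n ?mul1r//; field.
apply/eqP; rewrite -normr_eq0 -[circulation _ _ _ _ _ _]/(C 0%N).
apply/negPn/negP => C0.
have {}C0 : 0 < `|C 0%N| by rewrite lt0r C0/=.
have T0 : 0 < 2 * S ^+ 2 + 1 by have := sqr_ge0 S; lra.
have := key (`|C 0%N| / (2 * S ^+ 2 + 1)) (divr_gt0 C0 T0).
rewrite mulrAC ler_pdivlMr// mulrDr mulr1; lra.
Qed.

End Goursat.

(** * Complex numbers and the mean value property *)

Section CmodTheory.
Variable R : realType.
Implicit Types z w : Cplx R.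

Definition cRe (z : Cplx R) : R := complex.Re z.
Definition cIm (z : Cplx R) : R := complex.Im z.
Definition toC (x : R) : Cplx R := Complex x 0.

Lemma cnormE z : `|z| = toC (cmod z). Proof. by []. Qed.

Lemma cmodE z : cmod z = Num.sqrt (cRe z ^+ 2 + cIm z ^+ 2).
Proof. by case: z. Qed.

Lemma cmod_ge0 z : 0 <= cmod z. Proof. by rewrite cmodE sqrtr_ge0. Qed.

Lemma cmod_sqr z : cmod z ^+ 2 = cRe z ^+ 2 + cIm z ^+ 2.
Proof. by rewrite cmodE sqr_sqrtr// addr_ge0// sqr_ge0. Qed.

Lemma cmod0 : cmod (0 : Cplx R) = 0. Proof. exact: ComplexField.Normc.normc0. Qed.
Lemma cmod1 : cmod (1 : Cplx R) = 1. Proof. exact: ComplexField.Normc.normc1. Qed.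

Lemma cmodM z w : cmod (z * w) = cmod z * cmod w.
Proof. exact: ComplexField.Normc.normcM. Qed.

Lemma cmodV z : cmod z^-1 = (cmod z)^-1.
Proof. exact: ComplexField.Normc.normcV. Qed.

Lemma cmodX z k : cmod (z ^+ k) = cmod z ^+ k.
Proof. by elim: k => [|k IH]; rewrite ?expr0 ?cmod1// !exprS cmodM IH. Qed.

Lemma cmodD z w : cmod (z + w) <= cmod z + cmod w.
Proof. exact: le_normcD. Qed.

Lemma cmodN z : cmod (- z) = cmod z. Proof. exact: normcN. Qed.

Lemma cmodB z w : cmod (z - w) = cmod (w - z).
Proof. by rewrite -cmodN opprB. Qed.

Lemma cmod_eq0 z : (cmod z == 0) = (z == 0).
Proof.
by apply/eqP/eqP => [/ComplexField.Normc.eq0_normc//|->]; exact: cmod0.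
Qed.

Lemma cmod_gt0 z : (0 < cmod z) = (z != 0).
Proof. by rewrite lt0r cmod_ge0 andbT cmod_eq0. Qed.

Lemma cReD z w : cRe (z + w) = cRe z + cRe w. Proof. by case: z; case: w. Qed.
Lemma cImD z w : cIm (z + w) = cIm z + cIm w. Proof. by case: z; case: w. Qed.
Lemma cReN z : cRe (- z) = - cRe z. Proof. by case: z. Qed.
Lemma cImN z : cIm (- z) = - cIm z. Proof. by case: z. Qed.
Lemma cReM z w : cRe (z * w) = cRe z * cRe w - cIm z * cIm w.
Proof. by case: z; case: w. Qed.
Lemma cImM z w : cIm (z * w) = cRe z * cIm w + cIm z * cRe w.
Proof. by case: z => a b; case: w => c d /=. Qed.
Lemma cRe_toC x : cRe (toC x) = x. Proof. by []. Qed.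
Lemma cIm_toC x : cIm (toC x) = 0. Proof. by []. Qed.
Lemma cRe0 : cRe 0 = 0. Proof. by []. Qed.
Definition cReImE := (cReD, cImD, cReN, cImN, cReM, cImM, cRe_toC, cIm_toC).

Lemma cplx_eqP z w : cRe z = cRe w -> cIm z = cIm w -> z = w.
Proof. by case: z => a b; case: w => c d /= -> ->. Qed.

Lemma toCD x y : toC (x + y) = toC x + toC y.
Proof. by apply: cplx_eqP; rewrite !cReImE ?addr0. Qed.
Lemma toCM x y : toC (x * y) = toC x * toC y.
Proof. by apply: cplx_eqP; rewrite !cReImE; ring. Qed.
Lemma toCN x : toC (- x) = - toC x.
Proof. by apply: cplx_eqP; rewrite !cReImE ?oppr0. Qed.
Lemma toCB x y : toC (x - y) = toC x - toC y.
Proof. by rewrite toCD toCN. Qed.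
Lemma toC0 : toC 0 = 0. Proof. by []. Qed.
Lemma toC1 : toC 1 = 1. Proof. by []. Qed.
Lemma toC_nat k : toC k%:R = k%:R.
Proof. by elim: k => // k IH; rewrite -addn1 !natrD toCD IH. Qed.

Lemma cmod_toC x : cmod (toC x) = `|x|.
Proof. by rewrite cmodE /= expr0n addr0 sqrtr_sqr. Qed.

Lemma abs_cRe z : `|cRe z| <= cmod z.
Proof.
by rewrite cmodE -[X in X <= _]sqrtr_sqr ler_sqrt ?lerDl ?sqr_ge0// addr_ge0 ?sqr_ge0.
Qed.

Lemma abs_cIm z : `|cIm z| <= cmod z.
Proof.
by rewrite cmodE -[X in X <= _]sqrtr_sqr ler_sqrt ?lerDr ?sqr_ge0// addr_ge0 ?sqr_ge0.
Qed.

Lemma cmod_le_ReIm z : cmod z <= `|cRe z| + `|cIm z|.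
Proof.
rewrite -(@ler_pXn2r _ 2) ?nnegrE ?cmod_ge0 ?addr_ge0//.
rewrite cmod_sqr sqrrD !real_normK ?num_real// lerD2r lerDl.
by rewrite mulrn_wge0// mulr_ge0.
Qed.

Lemma le_toC x y : (toC x <= toC y) = (x <= y). Proof. exact: lecR. Qed.
Lemma lt_toC x y : (toC x < toC y) = (x < y). Proof. exact: ltcR. Qed.

Lemma cplx_gt0 (e : Cplx R) : 0 < e -> exists2 x : R, 0 < x & e = toC x.
Proof.
rewrite ltcE => /andP[/eqP i0 r0]; exists (cRe e) => //.
by apply: cplx_eqP => //; rewrite cIm_toC -[LHS]i0.
Qed.

(** Radii of balls are positive elements of [R[i]], hence real; this translates neighbourhoods into
    estimates over [R]. *)
Lemma near_cmod z (P : Cplx R -> Prop) : (\forall w \near z, P w) <->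
  exists2 dl : R, 0 < dl & forall w, cmod (w - z) <= dl -> P w.
Proof.
split.
  move=> /nbhs_ballP[e /= /cplx_gt0[d d0 ->]] h.
  exists (d / 2); first by rewrite divr_gt0.
  move=> w wz; apply: h; rewrite /ball/= cnormE lt_toC cmodB.
  by rewrite (le_lt_trans wz)//; lra.
move=> [dl dl0 h]; apply/nbhs_ballP; exists (toC dl); first by rewrite /= lt_toC.
by move=> w; rewrite /ball/= cnormE lt_toC cmodB => /ltW/h.
Qed.

(** The derivative without a difference quotient: the point [w = z] needs no exception and all
    quantities are real. *)
Definition is_cderiv (g : Cplx R -> Cplx R) z l :=
  forall e, 0 < e -> exists2 dl, 0 < dl & forall w, cmod (w - z) <= dl ->
    cmod (g w - (g z + l * (w - z))) <= e * cmod (w - z).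

Lemma is_derive_cderiv (g : Cplx R -> Cplx R) z l :
  is_derive z 1 g l -> is_cderiv g z l.
Proof.
case=> /cvgrPdist_le dg <- e e0.
have := dg (toC e); rewrite lt_toC => /(_ e0).
rewrite /dnbhs /within/= => /near_cmod[dl dl0 h].
exists dl => // w wz; have [->|wneq] := eqVneq w z.
  by rewrite !subrr mulr0 addr0 subrr cmod0 mulr0.
have wz0 : w - z != 0 by rewrite subr_eq0.
have := h (w - z); rewrite subr0 => /(_ wz wz0).
rewrite cnormE le_toC /GRing.scale/= mulr1 subrK => H.
rewrite -(ler_pdivrMr _ _ (z := cmod (w - z))) ?cmod_gt0//.
rewrite -cmodV -cmodM; apply: le_trans H.
rewrite -cmodN le_eqVlt; apply/orP; left; apply/eqP; congr cmod.
rewrite -/('D_1 g z); move: ('D_1 g z) => l'.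
by field.
Qed.

End CmodTheory.

(** * Holomorphic functions in logarithmic polar coordinates *)

Section LogPolar.
Variable R : realType.
Local Notation C := (Cplx R).

Lemma is_derive_approx (f : R -> R) (x0 l e : R) : is_derive x0 (1 : R) f l -> 0 < e ->
  exists2 dl, 0 < dl & forall x, `|x - x0| <= dl ->
    `|f x - (f x0 + l * (x - x0))| <= e * `|x - x0|.
Proof.
case=> /cvgrPdist_le dg <- e0.
have := dg e e0; rewrite /dnbhs /within/= => /nbhs_ballP[dl /= dl0 h].
exists (dl / 2); first by rewrite divr_gt0.
move=> w wz; have [->|wneq] := eqVneq w x0.
  by rewrite !subrr mulr0 addr0 subrr normr0 mulr0.
have wz0 : w - x0 != 0 by rewrite subr_eq0.
have := h (w - x0); rewrite /ball/= sub0r normrN.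
move=> /(_ (le_lt_trans wz _) wz0).
have -> : dl / 2 < dl by lra.
rewrite /GRing.scale/= mulr1 subrK => /(_ isT) H.
rewrite -ler_pdivrMr ?normr_gt0// -normfV -normrM; apply: le_trans H.
rewrite -normrN le_eqVlt; apply/orP; left; apply/eqP; congr (`|_|).
rewrite -/('D_1 f x0); move: ('D_1 f x0) => l'.
by field.
Qed.

(** Made for the real and imaginary parts [e^s cos t] and [e^s sin t] of the exponential. Of the
    three error terms only [a (x - x0) (g y - g y0)] is not a multiple of a one-variable error; it
    is small by the continuity of [g]. *)
Lemma is_diff2_prod (f g : R -> R) (x0 y0 a b : R) :
  is_derive x0 (1 : R) f a -> is_derive y0 (1 : R) g b ->
  is_diff2 (fun x y => f x * g y) x0 y0 (a * g y0) (f x0 * b).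
Proof.
move=> df dg e e0.
pose M := `|g y0| + 1 + `|a| + `|f x0| + `|b|.
have M0 : 0 < M by rewrite /M; have := normr_ge0 (g y0); have := normr_ge0 a;
  have := normr_ge0 (f x0); have := normr_ge0 b; lra.
pose e1 := Num.min 1 (e / M).
have e10 : 0 < e1 by rewrite lt_min ltr01 divr_gt0.
have e11 : e1 <= 1 by rewrite ge_min lexx.
have e1M : e1 * M <= e by rewrite -ler_pdivlMr// ge_min lexx orbT.
have [d1 d10 h1] := is_derive_approx df e10.
have [d2 d20 h2] := is_derive_approx dg e10.
pose d3 := e1 / M.
have d30 : 0 < d3 by rewrite divr_gt0.
exists (Num.min d1 (Num.min d2 d3)); first by rewrite !lt_min d10 d20.
move=> x y; rewrite !le_min => /andP[xd1 _] /and3P[_ yd2 yd3].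
have {xd1}h1 := h1 x xd1; have {yd2}h2 := h2 y yd2.
have A : `|g y - g y0| <= e1.
  rewrite (_ : g y - g y0 = (g y - (g y0 + b * (y - y0))) + b * (y - y0)); last by ring.
  rewrite (le_trans (ler_normD _ _))// normrM (le_trans (lerD h2 (lexx _)))//.
  rewrite -mulrDl; have : `|y - y0| * M <= e1 by rewrite -ler_pdivlMr.
  apply: le_trans; rewrite mulrC ler_wpM2l// /M.
  by have := normr_ge0 (g y0); have := normr_ge0 a; have := normr_ge0 (f x0); lra.
have B : `|g y| <= `|g y0| + 1.
  rewrite (_ : g y = g y0 + (g y - g y0)); last by ring.
  by rewrite (le_trans (ler_normD _ _))// lerD2l; lra.
rewrite (_ : f x * g y - (f x0 * g y0 + a * g y0 * (x - x0) + f x0 * b * (y - y0)) =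
  (f x - (f x0 + a * (x - x0))) * g y + a * (x - x0) * (g y - g y0) +
  f x0 * (g y - (g y0 + b * (y - y0)))); last by ring.
have N1 : `|(f x - (f x0 + a * (x - x0))) * g y| <= e1 * `|x - x0| * (`|g y0| + 1).
  by rewrite normrM ler_pM.
have N2 : `|a * (x - x0) * (g y - g y0)| <= e1 * `|x - x0| * `|a|.
  rewrite !normrM (_ : e1 * _ * _ = `|a| * `|x - x0| * e1); last by ring.
  by rewrite ler_wpM2l ?mulr_ge0.
have N3 : `|f x0 * (g y - (g y0 + b * (y - y0)))| <= e1 * `|y - y0| * `|f x0|.
  by rewrite normrM mulrC ler_wpM2r.
apply: (le_trans (ler_normD _ _)); apply: (le_trans (lerD (ler_normD _ _) (lexx _))).
apply: (le_trans (lerD (lerD N1 N2) N3)).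
have X0 := normr_ge0 (x - x0); have Y0 := normr_ge0 (y - y0).
apply: (@le_trans _ _ (e1 * M * (`|x - x0| + `|y - y0|))); last first.
  by apply: ler_wpM2r => //; rewrite addr_ge0.
rewrite -!mulrA -!mulrDr ler_wpM2l ?(ltW e10)//.
have := mulr_ge0 X0 (normr_ge0 (f x0)); have := mulr_ge0 X0 (normr_ge0 b).
have := mulr_ge0 Y0 (normr_ge0 (g y0)); have := mulr_ge0 Y0 (normr_ge0 a).
have := mulr_ge0 Y0 (normr_ge0 b).
rewrite /M; move: `|x - x0| `|y - y0| `|a| `|b| X0 Y0 => X Y A' B'; lra.
Qed.

(** The exponential of [s + i t]; [cexp 0] parametrizes the unit circle. *)
Definition cexp (s t : R) : C := Complex (expR s * cos t) (expR s * sin t).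

Lemma cmod_cexp s t : cmod (cexp s t) = expR s.
Proof.
by rewrite cmodE /= !exprMn -mulrDr cos2Dsin2 mulr1 sqrtr_sqr ger0_norm.
Qed.

Lemma cexp_2pi s : cexp s (2 * pi) = cexp s 0.
Proof.
by rewrite /cexp mulr_natl -[pi *+ 2]add0r cosD2pi sinD2pi.
Qed.

(** Chain rule: with [z = e^(s + i t)] the partial derivatives of [g z] are [l z] in [s] and
    [l (i z)] in [t]. The factor [i] between them is the Cauchy-Riemann relation used for the mean
    value property. *)
Lemma is_diff2_comp_cexp (g : C -> C) s t l : is_cderiv g (cexp s t) l ->
  is_diff2 (fun s t => cRe (g (cexp s t))) s t
    (cRe (l * cexp s t)) (cRe (l * (Complex 0 1 * cexp s t))) /\
  is_diff2 (fun s t => cIm (g (cexp s t))) s t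
    (cIm (l * cexp s t)) (cIm (l * (Complex 0 1 * cexp s t))).
Proof.
move=> dg.
have dX := is_diff2_prod (is_derive_expR s) (is_derive_cos t).
have dY := is_diff2_prod (is_derive_expR s) (is_derive_sin t).
set z := cexp s t; set B := Complex 0 1 * z.
have key e : 0 < e -> exists2 dl, 0 < dl & forall s' t', `|s' - s| <= dl ->
    `|t' - t| <= dl -> cmod (g (cexp s' t') -
     (g z + toC (s' - s) * (l * z) + toC (t' - t) * (l * B))) <=
     e * (`|s' - s| + `|t' - t|).
  move=> e0.
  pose M := cmod z + cmod B + 2 + cmod l + cmod l.
  have [l0 z0 B0] : [/\ 0 <= cmod l, 0 <= cmod z & 0 <= cmod B] by rewrite !cmod_ge0.
  have M0 : 0 < M by rewrite /M; lra.
  pose e1 := Num.min 1 (e / M).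
  have e10 : 0 < e1 by rewrite lt_min ltr01 divr_gt0.
  have e11 : e1 <= 1 by rewrite ge_min lexx.
  have e1M : e1 * M <= e by rewrite -ler_pdivlMr// ge_min lexx orbT.
  have [d1 d10 h1] := dX _ e10; have [d2 d20 h2] := dY _ e10.
  have [d3 d30 h3] := dg _ e10.
  pose d4 := d3 / (2 * M).
  have d40 : 0 < d4 by rewrite divr_gt0// mulr_gt0.
  exists (Num.min d1 (Num.min d2 d4)); first by rewrite !lt_min d10 d20.
  move=> s' t'; rewrite !le_min => /and3P[sd1 sd2 sd4] /and3P[td1 td2 td4].
  have {}h1 := h1 _ _ sd1 td1; have {}h2 := h2 _ _ sd2 td2.
  set S := `|s' - s| in h1 h2 sd1 sd2 sd4 *.
  set T := `|t' - t| in h1 h2 td1 td2 td4 *.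
  have S0 : 0 <= S by exact: normr_ge0.
  have T0 : 0 <= T by exact: normr_ge0.
  set w := cexp s' t'.
  have E : cmod (w - (z + toC (s' - s) * z + toC (t' - t) * B)) <= 2 * e1 * (S + T).
    apply: (le_trans (cmod_le_ReIm _)).
    rewrite (_ : 2 * e1 * (S + T) = e1 * (S + T) + e1 * (S + T)); last by ring.
    apply: lerD.
      apply: le_trans h1; rewrite le_eqVlt; apply/orP; left; apply/eqP; congr (`|_|).
      by rewrite !cReImE/=; ring.
    apply: le_trans h2; rewrite le_eqVlt; apply/orP; left; apply/eqP; congr (`|_|).
    by rewrite !cReImE/=; ring.
  have F : cmod (w - z) <= (cmod z + cmod B + 2) * (S + T).
    rewrite (_ : w - z = (w - (z + toC (s' - s) * z + toC (t' - t) * B)) +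
      (toC (s' - s) * z + toC (t' - t) * B)); last by ring.
    apply: (le_trans (cmodD _ _)).
    apply: (@le_trans _ _ (2 * (S + T) + (S * cmod z + T * cmod B))); last first.
      have := mulr_ge0 S0 B0; have := mulr_ge0 T0 z0; lra.
    apply: lerD.
      by apply: (le_trans E); rewrite -mulrA ler_pM2l// ler_piMl// addr_ge0.
    by apply: (le_trans (cmodD _ _)); rewrite !cmodM !cmod_toC.
  have F3 : cmod (w - z) <= d3.
    apply: (le_trans F).
    have ST : S + T <= d3 / M.
      rewrite (_ : d3 / M = d4 + d4) ?lerD//.
      by rewrite /d4; field; rewrite gt_eqF.
    apply: (@le_trans _ _ (M * (S + T))); last by rewrite mulrC -ler_pdivlMr.
    by rewrite ler_wpM2r ?addr_ge0// /M; lra.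
  have {}h3 := h3 _ F3.
  rewrite (_ : g w - _ = (g w - (g z + l * (w - z))) +
     l * (w - (z + toC (s' - s) * z + toC (t' - t) * B))); last by ring.
  apply: (le_trans (cmodD _ _)); rewrite cmodM.
  apply: (@le_trans _ _ (e1 * ((cmod z + cmod B + 2) * (S + T)) +
      cmod l * (2 * e1 * (S + T)))).
    by apply: lerD; [apply: (le_trans h3); rewrite ler_pM2l|rewrite ler_wpM2l].
  apply: (@le_trans _ _ (e1 * M * (S + T))); last by rewrite ler_wpM2r// addr_ge0.
  rewrite /M; lra.
split=> e e0; have [dl dl0 h] := key e e0; exists dl => // s' t' hs ht;
  apply: le_trans (h s' t' hs ht).
  apply: le_trans (abs_cRe _); rewrite le_eqVlt; apply/orP; left; apply/eqP.
  by congr (`|_|); rewrite !cReImE/=; ring.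
apply: le_trans (abs_cIm _); rewrite le_eqVlt; apply/orP; left; apply/eqP.
by congr (`|_|); rewrite !cReImE/=; ring.
Qed.

End LogPolar.

(** * Means over circles *)

Section MeanValue.
Variable R : realType.
Local Notation C := (Cplx R).
Implicit Types g : C -> C.

(** Not divided by [2 * pi], and for the real part only: statements about the modulus are obtained
    by first multiplying [g] by a suitable constant. *)
Definition circle_mean g (r : R) :=
  segint (fun t => cRe (g (toC r * cexp 0 t))) 0 (2 * pi).

Lemma toC_cexp (s t : R) : toC (expR s) * cexp 0 t = cexp s t.
Proof. by apply: cplx_eqP; rewrite !cReImE/= expR0; ring. Qed.

Lemma pi2_ge0 : (0 : R) <= 2 * pi.
Proof. by rewrite mulr_ge0// pi_ge0. Qed.

(* In the coordinates [s + i t] of the logarithm, the circles of radii [r1] and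
   [r2] are two sides of a rectangle, and the contributions of the other two
   sides cancel by periodicity. *)
Lemma circle_mean_const g (r0 r1 r2 : R) : 0 < r1 -> r1 <= r2 -> r2 < r0 ->
  (forall z, 0 < cmod z < r0 -> exists l, is_cderiv g z l) ->
  circle_mean g r1 = circle_mean g r2.
Proof.
move=> r10 r12 r20 dg.
have r2p : 0 < r2 by apply: lt_le_trans r12.
pose s1 := ln r1; pose s2 := ln r2.
have E1 : expR s1 = r1 by rewrite /s1 lnK// posrE.
have E2 : expR s2 = r2 by rewrite /s2 lnK// posrE.
have s12 : s1 <= s2 by rewrite /s1 /s2 ler_ln ?posrE.
(* The form is [Im (g dz / z)], that is [Im g ds + Re g dt] for [z = e^(s + i t)]; it is closed
   since [Im (i l z) = Re (l z)]. *)
have G : circulation (fun s t => cIm (g (cexp s t))) (fun s t => cRe (g (cexp s t)))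
    s1 s2 0 (2 * pi) = 0.
  apply: goursat => // [|s t /andP[s1s ss2] _]; first exact: pi2_ge0.
  have [l dl] : exists l, is_cderiv g (cexp s t) l.
    apply: dg; rewrite cmod_cexp expR_gt0/= (le_lt_trans _ r20)// -E2.
    by rewrite ler_expR.
  have [h1 h2] := is_diff2_comp_cexp dl.
  exists (cIm (l * cexp s t)), (cIm (l * (Complex 0 1 * cexp s t))),
    (cRe (l * (Complex 0 1 * cexp s t))); split => //.
  rewrite (_ : cIm (l * (_ * _)) = cRe (l * cexp s t))//.
  by rewrite !cReImE/=; ring.
have M r : 0 < r -> circle_mean g r =
    segint (fun t => cRe (g (cexp (ln r) t))) 0 (2 * pi).
  move=> r_gt0; congr segint; apply/funext => t.
  by rewrite -(toC_cexp (ln r)) lnK ?posrE.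
have Z : segint (fun s => cIm (g (cexp s (2 * pi)))) s1 s2 =
    segint (fun s => cIm (g (cexp s 0))) s1 s2.
  by congr segint; apply/funext => s; rewrite cexp_2pi.
rewrite (M r1 r10) (M r2 r2p); move: G; rewrite /circulation Z -/s1 -/s2.
set a := segint _ s1 s2; set b := segint _ _ _; set c := segint _ _ _.
by move: a b c => a b c; lra.
Qed.

Lemma circle_cts g (r : R) : 0 < r ->
  (forall z, cmod z = r -> exists l, is_cderiv g z l) ->
  cts_on (fun t => cRe (g (toC r * cexp 0 t))) 0 (2 * pi).
Proof.
move=> r0 dg t _.
have [l dl] : exists l, is_cderiv g (cexp (ln r) t) l.
  by apply: dg; rewrite cmod_cexp lnK ?posrE.
have [h1 _] := is_diff2_comp_cexp dl.
have [_] := is_diff2_cts h1.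
rewrite (_ : (fun t => cRe (g (cexp (ln r) t))) =
             (fun t => cRe (g (toC r * cexp 0 t))))//.
by apply/funext => t'; rewrite -(toC_cexp (ln r)) lnK ?posrE.
Qed.

(** The mean does not depend on the radius, and continuity at 0 identifies its limit for small
    radii. Differentiability is required off 0 only, so that the quotient [g z / z] of the Schwarz
    lemma is admissible. *)
Lemma mean_value g (r0 r : R) : 0 < r -> r < r0 ->
  (forall z, 0 < cmod z < r0 -> exists l, is_cderiv g z l) ->
  (forall e, 0 < e -> exists2 dl, 0 < dl & forall w, cmod w <= dl ->
    cmod (g w - g 0) <= e) ->
  circle_mean g r = 2 * pi * cRe (g 0).
Proof.
move=> r_gt0 rr0 dg cg; apply/eqP; rewrite -subr_eq0 -normr_eq0.
apply/negPn/negP => N0.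
have {}N0 : 0 < `|circle_mean g r - 2 * pi * cRe (g 0)| by rewrite lt0r N0 normr_ge0.
set N := `|_| in N0.
have p0 : (0 : R) < 2 * pi + 1 by have := pi2_ge0; lra.
have [dl dl0 h] := cg (N / (2 * pi + 1)) (divr_gt0 N0 p0).
pose r1 := Num.min r dl.
have r10 : 0 < r1 by rewrite lt_min r_gt0.
have [r1r r1d] : r1 <= r /\ r1 <= dl by rewrite !ge_min !lexx orbT.
suff : N <= N / (2 * pi + 1) * (2 * pi - 0).
  rewrite subr0 mulrAC ler_pdivlMr// mulrDr mulr1; lra.
rewrite {1}/N -(circle_mean_const r10 r1r rr0 dg).
rewrite (_ : 2 * pi * cRe (g 0) = cRe (g 0) * (2 * pi - 0) +
  0 * (((2 * pi) ^+ 2 - 0 ^+ 2) / 2)); last by ring.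
apply: segint_affine_approx; first exact: pi2_ge0.
  apply: circle_cts => // z zr; apply: dg; rewrite zr r10/=.
  exact: le_lt_trans rr0.
move=> t _; rewrite mul0r addr0.
rewrite (le_trans _ (h (toC r1 * cexp 0 t) _))//.
  by rewrite -cReN -cReD abs_cRe.
by rewrite cmodM cmod_cexp expR0 mulr1 cmod_toC gtr0_norm.
Qed.

End MeanValue.

(** * Schwarz lemmas and subharmonicity *)

Section Schwarz.
Variable R : realType.
Local Notation C := (Cplx R).
Implicit Types g h : C -> C.

Definition ccj (z : C) : C := Complex (cRe z) (- cIm z).

Lemma cmod_ccj z : cmod (ccj z) = cmod z.
Proof. by rewrite !cmodE /= sqrrN. Qed.

Lemma ccjM z : ccj z * z = toC (cmod z ^+ 2).
Proof. by apply: cplx_eqP; rewrite !cReImE ?cmod_sqr/=; ring. Qed.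

Lemma is_cderiv_cont g z l : is_cderiv g z l -> forall e, 0 < e ->
  exists2 dl, 0 < dl & forall w, cmod (w - z) <= dl -> cmod (g w - g z) <= e.
Proof.
move=> /(_ 1 ltr01)[dl dl0 h] e e0.
have M0 : 0 < 1 + cmod l by have := cmod_ge0 l; lra.
exists (Num.min dl (e / (1 + cmod l))); first by rewrite lt_min dl0 divr_gt0.
move=> w; rewrite le_min => /andP[/h + we]; rewrite mul1r => h'.
rewrite (_ : g w - g z = g w - (g z + l * (w - z)) + l * (w - z)); last by ring.
rewrite (le_trans (cmodD _ _))// cmodM (le_trans (lerD h' (lexx _)))//.
by move: we; rewrite ler_pdivlMr// mulrDr mulr1 [_ * cmod l]mulrC.
Qed.

Lemma is_cderivZ (c : C) g z l : is_cderiv g z l ->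
  is_cderiv (fun w => c * g w) z (c * l).
Proof.
move=> dg e e0; have M0 : 0 < cmod c + 1 by have := cmod_ge0 c; lra.
have [dl dl0 h] := dg (e / (cmod c + 1)) (divr_gt0 e0 M0); exists dl => // w wz.
rewrite -mulrA -mulrDr -mulrBr cmodM.
apply: (@le_trans _ _ ((cmod c + 1) * (e / (cmod c + 1) * cmod (w - z)))).
  by apply: ler_pM; rewrite ?cmod_ge0 ?lerDl//; exact: h.
by rewrite !mulrA [_ * e]mulrC mulfK// gt_eqF.
Qed.

Lemma is_cderiv_sqr g z l : is_cderiv g z l ->
  is_cderiv (fun w => g w ^+ 2) z (2 * g z * l).
Proof.
move=> dg e e0.
have [l0 g0] := (cmod_ge0 l, cmod_ge0 (g z)).
pose M := 2 * cmod (g z) + (1 + cmod l) ^+ 2.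
have M0 : 0 < M.
  by rewrite /M ltr_wpDl ?mulr_ge0// exprn_gt0//; lra.
pose e1 := Num.min 1 (e / M).
have e10 : 0 < e1 by rewrite lt_min ltr01 divr_gt0.
have e11 : e1 <= 1 by rewrite ge_min lexx.
have e1M : e1 * M <= e by rewrite -ler_pdivlMr// ge_min lexx orbT.
have [dl dl0 h] := dg e1 e10.
exists (Num.min dl e1); first by rewrite lt_min dl0.
move=> w; rewrite le_min => /andP[/h h' wd].
set d := cmod (w - z) in h' wd *.
have d0 : 0 <= d by exact: cmod_ge0.
set E := g w - (g z + l * (w - z)) in h'.
have F : cmod (g w - g z) <= (1 + cmod l) * d.
  rewrite (_ : g w - g z = E + l * (w - z)); last by rewrite /E; ring.
  rewrite (le_trans (cmodD _ _))// cmodM -/d mulrDl lerD2r.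
  by apply: (le_trans h'); rewrite mul1r ler_piMl.
rewrite (_ : g w ^+ 2 - (g z ^+ 2 + 2 * g z * l * (w - z)) =
   2 * g z * E + (g w - g z) ^+ 2); last by rewrite /E; ring.
apply: (le_trans (cmodD _ _)); rewrite cmodX !cmodM.
have -> : cmod (2 : C) = 2 by rewrite -toC_nat cmod_toC ger0_norm.
apply: (@le_trans _ _ (2 * cmod (g z) * (e1 * d) + (1 + cmod l) ^+ 2 * d ^+ 2)).
  apply: lerD; first by rewrite ler_wpM2l// mulr_ge0.
  by rewrite -exprMn lerXn2r ?nnegrE ?mulr_ge0 ?cmod_ge0//; lra.
apply: (@le_trans _ _ (e1 * M * d)); last by rewrite ler_wpM2r.
rewrite (_ : e1 * M * d = 2 * cmod (g z) * (e1 * d) + (1 + cmod l) ^+ 2 * (e1 * d)).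
  by rewrite lerD2l ler_wpM2l ?sqr_ge0// expr2 ler_wpM2r.
by rewrite /M; ring.
Qed.

(** Apply the mean value property to [conj (h 0) * h]: its value at 0 is [|h 0|^2], and its real
    part on the circle is at most [|h 0| M]. *)
Lemma mean_value_le h (r0 r M : R) : 0 < r -> r < r0 ->
  (forall z, 0 < cmod z < r0 -> exists l, is_cderiv h z l) ->
  (forall e, 0 < e -> exists2 dl, 0 < dl & forall w, cmod w <= dl ->
    cmod (h w - h 0) <= e) ->
  (forall z, cmod z = r -> cmod (h z) <= M) -> cmod (h 0) <= M.
Proof.
move=> r_gt0 rr0 dh ch hM.
have M0 : 0 <= M.
  by rewrite (le_trans (cmod_ge0 _) (hM (toC r) _))// cmod_toC gtr0_norm.
have [->//|] := eqVneq (cmod (h 0)) 0; rewrite cmod_eq0 -cmod_gt0 => h0.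
set c := ccj (h 0).
have dch z : 0 < cmod z < r0 -> exists l, is_cderiv (fun w => c * h w) z l.
  by move=> /dh[l dl]; exists (c * l); exact: is_cderivZ.
have cch e : 0 < e -> exists2 dl, 0 < dl & forall w, cmod w <= dl ->
    cmod (c * h w - c * h 0) <= e.
  move=> e0; have ec : 0 < e / cmod c by rewrite divr_gt0// cmod_ccj.
  have [dl dl0 H] := ch _ ec.
  exists dl => // w /H; rewrite -mulrBr cmodM ler_pdivlMr ?cmod_ccj//.
  by rewrite mulrC.
have := mean_value r_gt0 rr0 dch cch.
rewrite ccjM cRe_toC => E.
have : circle_mean (fun w => c * h w) r <= segint (fun=> cmod (h 0) * M) 0 (2 * pi).
  apply: segint_le; [|exact: cts_on_cst|].
    apply: (circle_cts (g := fun w => c * h w)) => // z zr; apply: dch.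
    by rewrite zr r_gt0.
  move=> t _; rewrite (le_trans (ler_norm _))// (le_trans (abs_cRe _))//.
  rewrite cmodM cmod_ccj ler_pM2l// hM// cmodM cmod_cexp expR0 mulr1 cmod_toC.
  by rewrite gtr0_norm.
rewrite E segint_cst ?pi2_ge0// subr0 mulrC ler_pM2r.
  by rewrite expr2 ler_pM2l.
by rewrite mulr_gt0// pi_gt0.
Qed.

(** The quotient [g z / z], completed by the value [l] at 0, is continuous there and bounded by
    [1 + e] on the circle of radius [1 / (1 + e)]; then [e] tends to 0. *)
Lemma schwarz g l : (forall z, cmod z < 1 -> exists l', is_cderiv g z l') ->
  is_cderiv g 0 l -> g 0 = 0 -> (forall z, cmod z < 1 -> cmod (g z) <= 1) ->
  cmod l <= 1.
Proof.
move=> dg dl g0 g1.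
pose h z := if z == 0 then l else g z / z.
have h0 : h 0 = l by rewrite /h eqxx.
apply/ler_addgt0Pr => e e0.
pose r := (1 + e)^-1.
have e1 : 0 < 1 + e by lra.
have r0 : 0 < r by rewrite invr_gt0.
have r1 : r < 1 by rewrite invf_lt1//; lra.
rewrite -h0; apply: (@mean_value_le h 1 r) => //; last first.
- move=> z zr; rewrite /h; case: eqP => [z0|_].
    by move: r0; rewrite -zr z0 cmod0 ltxx.
  by rewrite cmodM cmodV zr /r invrK ler_piMl ?(ltW e1)// g1// zr.
- move=> e' e'0; have [d d0 H] := dl e' e'0; exists d => // w wd.
  rewrite h0 /h; case: eqP => [_|/eqP w0]; first by rewrite subrr cmod0 ltW.
  have := H w; rewrite subr0 g0 add0r => /(_ wd).
  rewrite (_ : g w - l * w = (g w / w - l) * w); last by field.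
  by rewrite cmodM ler_pM2r// cmod_gt0.
- move=> z /andP[z0 z1]; have [l' dl'] := dg z z1.
  have zn0 : z != 0 by rewrite -cmod_gt0.
  exists ((l' - g z / z) / z) => e' e'0.
  (* With [b = g'(z) - g z / z] and [E] the error of [g] at [w], the error of the quotient is
     [(E - (b / z) (w - z)^2) / w]. Since [|w| >= |z| / 2], this [k] brings it below
     [e' |w - z|]. *)
  pose k := e' * cmod z / 2 / (1 + cmod (l' - g z / z) / cmod z).
  have k1 : 0 < 1 + cmod (l' - g z / z) / cmod z.
    by rewrite ltr_pwDl// divr_ge0 ?cmod_ge0.
  have k0 : 0 < k by rewrite /k divr_gt0// divr_gt0// mulr_gt0.
  have [d d0 H] := dl' k k0.
  exists (Num.min (Num.min d k) (cmod z / 2)).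
    by rewrite !lt_min d0 k0 divr_gt0.
  move=> w; rewrite !le_min => /andP[/andP[wd wk] wz].
  have wz2 : cmod z / 2 <= cmod w.
    have := cmodD w (z - w); rewrite addrCA subrr addr0 cmodB; lra.
  have w0 : w != 0 by rewrite -cmod_gt0; lra.
  have {}H := H w wd.
  rewrite /h (negbTE zn0) (negbTE w0).
  set E := g w - _ in H.
  set b := (l' - g z / z) in k k1 k0 H wk *.
  rewrite (_ : _ - _ = (E - b / z * (w - z) ^+ 2) / w); last first.
    by rewrite /E /b; field; rewrite zn0 w0.
  rewrite cmodM cmodV ler_pdivrMr ?cmod_gt0//.
  rewrite (le_trans (cmodD _ _))// cmodN !cmodM cmodV.
  apply: (@le_trans _ _ (k * cmod (w - z) + cmod b / cmod z * (k * cmod (w - z)))).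
    apply: lerD => //; apply: ler_wpM2l; first by rewrite divr_ge0 ?cmod_ge0.
    by rewrite ler_wpM2r ?cmod_ge0.
  rewrite (_ : _ + _ = (1 + cmod b / cmod z) * k * cmod (w - z)); last by ring.
  rewrite /k [_ * (_ / _)]mulrC divfK ?gt_eqF//.
  rewrite -!mulrA ler_pM2l// !mulrA [X in _ <= X]mulrC ler_wpM2r ?cmod_ge0//.
Qed.

(* Mean value property of [conj (g 0 ^ 2) * g ^ 2], whose value at 0 is
   [|g 0| ^ 4]. *)
Lemma sub_mean_value g (r0 : R) : 1 < r0 ->
  (forall z, cmod z < r0 -> exists l, is_cderiv g z l) ->
  cts_on (fun t => cmod (g (cexp 0 t)) ^+ 2) 0 (2 * pi) /\
  2 * pi * cmod (g 0) ^+ 2 <= segint (fun t => cmod (g (cexp 0 t)) ^+ 2) 0 (2 * pi).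
Proof.
move=> r0_gt1 dg.
have dgi c z : cmod z = 1 -> exists l, is_cderiv (fun w => c * g w) z l.
  by move=> z1; have [|l dl] := dg z; [by rewrite z1|exists (c * l); exact: is_cderivZ].
have cts : cts_on (fun t => cmod (g (cexp 0 t)) ^+ 2) 0 (2 * pi).
  (* As [Re (- i g) = Im g], continuity of real parts, applied to [g] and [- i g], gives that of
     [|g|^2]. *)
  have c1 := circle_cts ltr01 (dgi 1); have ci := circle_cts ltr01 (dgi (Complex 0 (-1))).
  rewrite (_ : (fun t => _) = (fun t => cRe (1 * g (toC 1 * cexp 0 t)) *
    cRe (1 * g (toC 1 * cexp 0 t)) + cRe (Complex 0 (-1) * g (toC 1 * cexp 0 t)) *
    cRe (Complex 0 (-1) * g (toC 1 * cexp 0 t)))); last first.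
    by apply/funext => t; rewrite cmod_sqr !toC1 !mul1r !cReImE/=; ring.
  by move=> t ht; apply: cvgD; apply: cvgM; (exact: c1 || exact: ci).
split => //.
have [g0|g0] := eqVneq (g 0) 0.
  by rewrite g0 cmod0 expr0n mulr0; apply: Rintegral_ge0 => t _; rewrite sqr_ge0.
have p0 : 0 < cmod (g 0) by rewrite cmod_gt0.
set c := ccj (g 0 ^+ 2).
have dch z : cmod z < r0 -> exists l, is_cderiv (fun w => c * g w ^+ 2) z l.
  by move=> /dg[l /is_cderiv_sqr dl]; eexists; exact: is_cderivZ dl.
have := @mean_value _ (fun w => c * g w ^+ 2) r0 1 ltr01 r0_gt1 _ _.
rewrite ccjM cRe_toC => E.
have : circle_mean (fun w => c * g w ^+ 2) 1 <=
    segint (fun t => cmod (g 0) ^+ 2 * cmod (g (cexp 0 t)) ^+ 2) 0 (2 * pi).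
  apply: segint_le.
  - apply: (circle_cts (g := fun w => c * g w ^+ 2)) => // z z1; apply: dch.
    by rewrite z1.
  - exact: cts_onZ.
  - move=> t _; rewrite (le_trans (ler_norm _))// (le_trans (abs_cRe _))//.
    by rewrite cmodM cmod_ccj !cmodX toC1 mul1r.
rewrite E.
- rewrite segintZ// cmodX; set a := cmod (g 0) in p0 *.
  rewrite (_ : 2 * pi * (a ^+ 2) ^+ 2 = a ^+ 2 * (2 * pi * a ^+ 2)); last by ring.
  by rewrite ler_pM2l ?exprn_gt0.
- by move=> z /andP[_ /dch].
- move=> e e0; have [l dl] : exists l, is_cderiv (fun w => c * g w ^+ 2) 0 l.
    by apply: dch; rewrite cmod0; lra.
  have [d d0 H] := is_cderiv_cont dl e0; exists d => // w wd.
  by rewrite -ccjM; apply: H; rewrite subr0.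
Qed.

(* Compose with the Cayley transform [u |-> u / (2 - u)] of the half-plane
   [Re u < 1]. *)
Lemma schwarz_half_plane g l :
  (forall z, cmod z < 1 -> exists l', is_derive z 1 g l') ->
  is_derive (0 : C) 1 g l -> g 0 = 0 -> (forall z, cmod z < 1 -> cRe (g z) <= 1) ->
  cmod l <= 2.
Proof.
move=> dg dl g0 g1.
have n0 z : cmod z < 1 -> 2 - g z != 0.
  move=> /g1 H; apply/eqP => /(congr1 (@cRe R)).
  by rewrite cRe0 -toC_nat !cReImE; lra.
(* This is [g / (2 - g)] written with a single occurrence of [g]; its derivative at 0 is half that
   of [g], whence the constant 2. *)
pose f z := 2 * (2 - g z)^-1 - 1.
have df z l' : cmod z < 1 -> is_derive z 1 g l' ->
    is_derive z 1 f (2 * (l' / (2 - g z) ^+ 2)).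
  move=> z1 d; have nz := n0 z z1.
  have d2 : is_derive z 1 (fun w => (2 - g w)^-1) (l' / (2 - g z) ^+ 2).
    have [dk vk] : is_derive z 1 (cst 2 - g) (0 - l') by exact: is_deriveB.
    change (is_derive z 1 (fun w => ((cst 2 - g) w)^-1) (l' / (2 - g z) ^+ 2)).
    split; first exact: derivableV.
    by rewrite deriveV// vk /GRing.scale/= sub0r mulrNN mulrC.
  by rewrite /f; apply: is_derive_eq; rewrite subr0.
suff : cmod (2 * (l / (2 - g 0) ^+ 2)) <= 1.
  rewrite g0 subr0 (_ : 2 * (l / 2 ^+ 2) = l / 2); last by field.
  rewrite cmodM cmodV -toC_nat cmod_toC ger0_norm// ler_pdivrMr// mul1r//.
apply: (@schwarz f).
- move=> z z1; have [l' d] := dg z z1; eexists; apply: is_derive_cderiv.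
  exact: df z1 d.
- by apply: is_derive_cderiv; apply: df => //; rewrite cmod0.
- by rewrite /f g0 subr0 divff ?subrr// pnatr_eq0.
- move=> z z1; have nz := n0 z z1; have H := g1 z z1.
  rewrite /f (_ : _ - 1 = g z / (2 - g z)); last by field.
  rewrite cmodM cmodV ler_pdivrMr ?cmod_gt0// mul1r.
  rewrite -(@ler_pXn2r _ 2) ?nnegrE ?cmod_ge0// !cmod_sqr.
  rewrite -toC_nat !cReImE.
  by move: (cRe (g z)) (cIm (g z)) H => x y; nra.
Qed.

End Schwarz.

(** * The frame adapted to the domain *)

Section HahnBanach.
Variables (R : realType) (n : nat).
Local Notation C := (Cplx R).
Local Notation Cn := 'rV[C]_n.
Implicit Types (q : Cn -> R) (x y v : Cn) (t : R).

(** Sublinear over the reals only: the gauge of a convex set need not be invariant under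
    multiplication by complex units. Equality in the second clause follows by scaling back. *)
Definition sublinear q := (forall x y, q (x + y) <= q x + q y) /\
  (forall t x, 0 <= t -> q (toC t *: x) <= t * q x).

Lemma sublinear0 q : sublinear q -> q 0 = 0.
Proof.
move=> [qD qZ]; apply/eqP; rewrite eq_le; apply/andP; split.
  by have := qZ 0 0 (lexx _); rewrite mul0r scaler0.
by have := qD 0 0; rewrite addr0; lra.
Qed.

Lemma sublinearZ q t x : sublinear q -> 0 <= t -> q (toC t *: x) = t * q x.
Proof.
move=> sq t0; have [_ qZ] := sq; apply/eqP; rewrite eq_le qZ//=.
have [->|tn0] := eqVneq t 0; first by rewrite toC0 scale0r sublinear0// mul0r.
have tp : 0 < t by rewrite lt0r tn0.
have := qZ t^-1 (toC t *: x); rewrite invr_ge0 => /(_ t0).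
by rewrite scalerA -toCM mulVf// toC1 scale1r mulrC ler_pdivlMr// mulrC.
Qed.

(** Equivalent to [q (- v) = - q v] for sublinear [q], the other inequality being subadditivity: [q]
    is linear on the real line through [v]. *)
Definition lineal q v := q v + q (- v) <= 0.

Lemma lineal_add q v x : sublinear q -> lineal q v -> q (x + v) = q x + q v.
Proof.
move=> [qD qZ] lv; apply/eqP; rewrite eq_le qD/=.
have := qD (x + v) (- v); rewrite addrK; move: lv; rewrite /lineal; lra.
Qed.

Lemma linealD q v w : sublinear q -> lineal q v -> lineal q w -> lineal q (v + w).
Proof.
move=> [qD qZ]; rewrite /lineal => lv lw; have := qD v w.
by have := qD (- v) (- w); rewrite opprD; lra.
Qed.

Lemma linealN q v : lineal q v -> lineal q (- v).
Proof. by rewrite /lineal opprK addrC. Qed.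

Lemma linealZ q t v : sublinear q -> lineal q v -> lineal q (toC t *: v).
Proof.
move=> sq; wlog t0 : t v / 0 <= t => [H lv|].
  have [/H|t0] := leP 0 t; first exact.
  have := H (- t) (- v); rewrite toCN scalerN scaleNr opprK; apply; first lra.
  exact: linealN.
rewrite /lineal => lv; rewrite -scalerN !sublinearZ// -mulrDr.
by rewrite mulr_ge0_le0.
Qed.

(* [straighten q v] is the sublinear function below [q] which is linear along
   the real line spanned by [v]; doing this successively for the vectors of a
   real basis makes [q] linear. *)
Definition straighten q v x := inf [set q (x + toC t *: v) - t * q v | t in [set t | 0 <= t]].

Lemma straighten_lb q v x t : sublinear q -> 0 <= t ->
  straighten q v x <= q (x + toC t *: v) - t * q v.
Proof.
move=> sq t0; apply: ge_inf; last by exists t.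
exists (- q (- x)) => _ [s /= s0 <-]; have [qD _] := sq.
have := qD (x + toC s *: v) (- x); rewrite addrAC subrr add0r sublinearZ//; lra.
Qed.

Lemma straighten_ge q v x m :
  (forall t, 0 <= t -> m <= q (x + toC t *: v) - t * q v) -> m <= straighten q v x.
Proof.
move=> h; apply: lb_le_inf; first by exists (q (x + toC 0 *: v) - 0 * q v); exists 0 => /=.
by move=> _ [t /= t0 <-]; exact: h.
Qed.

Lemma straighten_le q v x : sublinear q -> straighten q v x <= q x.
Proof.
by move=> sq; have := straighten_lb v x sq (lexx 0);
  rewrite toC0 scale0r addr0 mul0r subr0.
Qed.

Lemma straightenN q v : sublinear q -> straighten q v (- v) <= - q v.
Proof.
move=> sq; have := straighten_lb v (- v) sq ler01.
by rewrite toC1 scale1r addNr sublinear0// sub0r mul1r.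
Qed.

Lemma sublinear_straighten q v : sublinear q -> sublinear (straighten q v).
Proof.
move=> sq; have [qD qZ] := sq; split=> [x y|t x t0].
  rewrite -lerBlDr; apply: straighten_ge => t t0.
  rewrite lerBlDl -lerBlDr; apply: straighten_ge => s s0.
  rewrite lerBlDr; apply: (le_trans (straighten_lb v (x + y) sq (addr_ge0 t0 s0))).
  rewrite toCD scalerDl addrACA [leRHS]addrACA -opprD -mulrDl (addrC s) lerD2r.
  by rewrite [leRHS]addrC; exact: qD.
have [->|tn0] := eqVneq t 0.
  by rewrite toC0 scale0r mul0r (le_trans (straighten_le _ _ sq))// sublinear0.
have tp : 0 < t by rewrite lt0r tn0.
rewrite mulrC -ler_pdivrMr//; apply: straighten_ge => s s0.
rewrite ler_pdivrMr//.
apply: (le_trans (straighten_lb v (toC t *: x) sq (mulr_ge0 s0 t0))).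
rewrite mulrC toCM -scalerA -scalerDr (sublinearZ _ sq)//; lra.
Qed.

(** A step along [v] is not spoiled by later ones: below [straighten q v], a function has values at
    [v] and [- v] at most [q v] and [- q v], and their sum is at most 0. *)
Lemma straighten_seq (s : seq Cn) q : sublinear q -> exists2 q', sublinear q' &
  (forall x, q' x <= q x) /\ (forall v, v \in s -> lineal q' v).
Proof.
elim: s q => [|v s IH] q sq; first by exists q.
have [q' sq' [q'le ls]] := IH _ (sublinear_straighten v sq).
exists q' => //; split=> [x|w].
  by rewrite (le_trans (q'le _))// straighten_le.
rewrite inE => /predU1P[->|/ls//].
have := q'le v; have := q'le (- v); have := straightenN v sq.
have := straighten_le v v sq; rewrite /lineal; lra.
Qed.

(** Straightening along [p] before everything else forces [l (- p) <= - q p], so the resulting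
    linear form attains [q] at [p]. The vectors [e_i] and [i e_i] then exhaust a real basis. *)
Lemma hahn_banach q p : sublinear q -> exists c : 'cV[C]_n,
  (forall x, cRe ((x *m c) 0 0) <= q x) /\ q p <= cRe ((p *m c) 0 0).
Proof.
move=> sq; pose s := [seq delta_mx 0 i : Cn | i <- enum 'I_n] ++
  [seq (Complex 0 1 : C) *: delta_mx 0 i : Cn | i <- enum 'I_n].
have [l sl [lq ls]] := straighten_seq s (sublinear_straighten p sq).
have le1 i : lineal l (delta_mx 0 i).
  by apply: ls; rewrite mem_cat; apply/orP; left; apply: map_f; rewrite mem_enum.
have lei i : lineal l ((Complex 0 1 : C) *: delta_mx 0 i).
  apply: ls; rewrite mem_cat; apply/orP; right.
  by apply: (map_f (fun i => (Complex 0 1 : C) *: delta_mx 0 i : Cn)); rewrite mem_enum.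
have lin x : lineal l x.
  rewrite (row_sum_delta x); apply: (big_ind (lineal l)).
  - by rewrite /lineal oppr0 (sublinear0 sl) addr0.
  - by move=> a b; exact: linealD.
  - move=> i _; rewrite (_ : x 0 i = toC (cRe (x 0 i)) + toC (cIm (x 0 i)) * Complex 0 1).
      rewrite scalerDl -scalerA; apply: linealD => //; exact: linealZ.
    by apply: cplx_eqP; rewrite !cReImE/=; ring.
have lD x y : l (x + y) = l x + l y by exact: lineal_add.
have lN x : l (- x) = - l x.
  by apply/eqP; rewrite -addr_eq0 -lD addNr (sublinear0 sl).
have lZ t x : l (toC t *: x) = t * l x.
  have [t0|t0] := leP 0 t; first exact: sublinearZ.
  rewrite -[in LHS](opprK t) toCN scaleNr lN sublinearZ//; last lra.
  by rewrite mulNr opprK.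
(* A real linear form [l] is the real part of the complex linear form [l x - i l (i x)]. *)
pose L x : C := Complex (l x) (- l ((Complex 0 1 : C) *: x)).
have LD x y : L (x + y) = L x + L y.
  by apply: cplx_eqP; rewrite !cReImE/= ?scalerDr lD// opprD.
have L0 : L 0 = 0.
  by apply: (addrI (L 0)); rewrite -LD !addr0.
have LZ (a : C) x : L (a *: x) = a * L x.
  have lC (b : C) y : l (b *: y) = cRe b * l y + cIm b * l ((Complex 0 1 : C) *: y).
    rewrite -!lZ -lD scalerA -scalerDl; congr (l (_ *: _)).
    by apply: cplx_eqP; rewrite !cReImE/=; ring.
  apply: cplx_eqP; rewrite !cReImE/= ?scalerA lC ?cReImE//=; last by ring.
  by ring.
pose c : 'cV[C]_n := \col_i L (delta_mx 0 i).
have cE x : (x *m c) 0 0 = L x.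
  rewrite [in RHS](row_sum_delta x) (big_morph L LD L0) mxE.
  by apply: eq_bigr => i _; rewrite LZ mxE.
exists c; split=> [x|]; rewrite cE.
  by rewrite (le_trans (lq x))// straighten_le.
rewrite -[cRe _]/(l p).
have := lq (- p); have := straightenN p sq; rewrite lN; lra.
Qed.

End HahnBanach.

(** * Greedy construction of the frame *)

Section Frame.
Variables (R : realType) (n : nat).
Local Notation C := (Cplx R).
Local Notation Cn := 'rV[C]_n.
Implicit Types (q : Cn -> R) (x y v : Cn) (t : R).

Lemma unit_polar (z : C) : cmod z = 1 -> exists2 t, - pi <= t <= pi & z = cexp 0 t.
Proof.
move=> z1; have := cmod_sqr z; rewrite z1 expr1n => e1.
have zr : -1 <= cRe z <= 1 by have := abs_cRe z; rewrite z1 ler_norml.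
have := acos_ge0 zr; have := acos_lepi zr => ap a0.
have sE : sin (acos (cRe z)) = `|cIm z|.
  by rewrite sin_acos// -sqrtr_sqr; congr Num.sqrt; rewrite e1 addrC addKr.
have pp := @pi_ge0 R.
have [i0|i0] := leP 0 (cIm z).
  exists (acos (cRe z)); first by rewrite ap andbT; lra.
  apply: cplx_eqP; rewrite /= expR0 mul1r ?acosK// ?sE ?ger0_norm//.
exists (- acos (cRe z)); first by rewrite lerN2 ap/=; lra.
apply: cplx_eqP; rewrite /= expR0 mul1r ?cosN ?sinN ?acosK// ?sE ?ltr0_norm ?opprK//.
Qed.

Lemma polar (z : C) : exists2 t, - pi <= t <= pi & z = toC (cmod z) * cexp 0 t.
Proof.
have [->|z0] := eqVneq z 0.
  by exists 0; [rewrite oppr_le0 pi_ge0|rewrite cmod0 mul0r].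
have p : cmod z != 0 by rewrite cmod_eq0.
have [|t ht e] := @unit_polar (z / toC (cmod z)).
  by rewrite cmodM cmodV cmod_toC ger0_norm ?cmod_ge0// divff.
exists t => //; rewrite -e mulrC divfK//.
by apply/eqP => /(congr1 (@cRe R)); rewrite cRe0 cRe_toC; exact/eqP.
Qed.

Definition l1norm x := \sum_i cmod (x 0 i).

(** The linear bound on [q] makes it Lipschitz along the complex line of [v], so it has a maximum on
    the compact circle of rotations of [v]; homogeneity extends the estimate to all [w]. *)
Lemma sublinear_circle_max q v M : sublinear q ->
  (forall x, q x <= M * l1norm x) ->
  exists z : C, cmod z = 1 /\ forall w, q (w *: v) <= cmod w * q (z *: v).
Proof.
move=> sq qM; have [qD _] := sq.
pose K := `|M| * l1norm v.
have l0 : 0 <= l1norm v by rewrite sumr_ge0// => i _; exact: cmod_ge0.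
have K0 : 0 <= K by rewrite mulr_ge0.
have lip (a b : C) : q (a *: v) - q (b *: v) <= K * cmod (a - b).
  have := qD ((a - b) *: v) (b *: v); rewrite -scalerDl subrK.
  have := qM ((a - b) *: v).
  have -> : l1norm ((a - b) *: v) = cmod (a - b) * l1norm v.
    by rewrite /l1norm mulr_sumr; apply: eq_bigr => i _; rewrite mxE cmodM.
  have : M * (cmod (a - b) * l1norm v) <= K * cmod (a - b).
    rewrite /K [X in _ <= X]mulrAC -mulrA; apply: ler_wpM2r => //.
      by rewrite mulr_ge0 ?cmod_ge0.
    exact: ler_norm.
  lra.
have ct : continuous (fun t => q (cexp 0 t *: v)).
  move=> t0; apply/cvgrPdist_le => e e0.
  have K1 : 0 < K + 1 by lra.
  have d0 : 0 < e / (K + 1) / 2 by rewrite divr_gt0// divr_gt0.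
  near=> t.
  have h1 : `|cos t0 - cos t| <= e / (K + 1) / 2.
    by near: t; move/cvgrPdist_le: (@continuous_cos R t0); apply.
  have h2 : `|sin t0 - sin t| <= e / (K + 1) / 2.
    by near: t; move/cvgrPdist_le: (@continuous_sin R t0); apply.
  have h : cmod (cexp 0 t0 - cexp 0 t) <= e / (K + 1).
    rewrite (le_trans (cmod_le_ReIm _))// !cReImE /= expR0 !mul1r; lra.
  have : K * cmod (cexp 0 t0 - cexp 0 t) <= e.
    have : (K + 1) * cmod (cexp 0 t0 - cexp 0 t) <= e by rewrite mulrC -ler_pdivlMr.
    have := cmod_ge0 (cexp 0 t0 - cexp 0 t); lra.
  have := lip (cexp 0 t0) (cexp 0 t); have := lip (cexp 0 t) (cexp 0 t0).
  rewrite (cmodB (cexp 0 t)) ler_norml; lra.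
have pp : - (pi : R) <= pi by have := @pi_ge0 R; lra.
have [t1 _ h] := EVT_max pp (continuous_subspaceT ct).
exists (cexp 0 t1); split; first by rewrite cmod_cexp expR0.
move=> w; have [t ht e] := polar w.
rewrite [in X in X <= _]e -scalerA (sublinearZ _ sq) ?cmod_ge0//.
by rewrite ler_wpM2l ?cmod_ge0// h// in_itv.
Unshelve. all: by end_near. Qed.

Lemma common_kernel k (c : 'I_k -> 'cV[C]_n) : (k < n)%N ->
  exists2 v : Cn, v != 0 & forall j, (v *m c j) 0 0 = 0.
Proof.
move=> kn; pose A : 'M[C]_(n, k) := \matrix_(i, j) c j i 0.
have : kermx A != 0.
  rewrite -mxrank_eq0 mxrank_ker subn_eq0 -ltnNge.
  exact: leq_ltn_trans (rank_leq_col A) kn.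
move=> /rowV0Pn[v vA v0]; exists v => // j.
have /sub_kermxP/matrixP/(_ 0 j) := vA; rewrite !mxE => E; rewrite -[RHS]E.
by apply: eq_bigr => i _; rewrite !mxE.
Qed.

(** At each stage the kernel vector is rotated to the maximum of [q] on its circle and scaled, so
    that [q (w p) <= |w|] holds with equality at [w = 1]. This equality is what makes the real
    supporting form at [p] take the complex value 1 there. *)
Lemma adapted_frame q M : sublinear q -> (forall x, q x <= M * l1norm x) ->
  (forall v, v != 0 -> exists w : C, 0 < q (w *: v)) ->
  exists P L : 'M[C]_n, [/\ \det P * \det L = 1,
    forall i w, q (w *: row i P) <= cmod w &
    forall j x, cRe ((x *m L) 0 j) <= q x].
Proof.
move=> sq qM qpos.
have step k : (k <= n)%N -> exists (p : nat -> Cn) (c : nat -> 'cV[C]_n),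
    forall i, (i < k)%N -> [/\ forall w, q (w *: p i) <= cmod w,
      forall x, cRe ((x *m c i) 0 0) <= q x, (p i *m c i) 0 0 = 1 &
      forall j, (j < i)%N -> (p i *m c j) 0 0 = 0].
  elim: k => [|k IH] kn; first by exists (fun=> 0), (fun=> 0).
  have [p [c pc]] := IH (ltnW kn).
  have [v v0 vc] := @common_kernel k (fun j => c j) kn.
  have [z [z1 hz]] := @sublinear_circle_max q v M sq qM.
  have [w0 w0p] := qpos v v0.
  have m0 : 0 < q (z *: v).
    have := lt_le_trans w0p (hz w0); have := cmod_ge0 w0.
    by rewrite le_eqVlt => /predU1P[<-|w0_gt0]; rewrite ?mul0r ?ltxx// pmulr_rgt0.
  set m := q (z *: v) in m0 hz.
  pose p' := toC m^-1 *: (z *: v).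
  have qp' w : q (w *: p') <= cmod w.
    rewrite /p' scalerA mulrC -scalerA (sublinearZ _ sq) ?invr_ge0 ?(ltW m0)//.
    rewrite scalerA mulrC ler_pdivrMr// (le_trans (hz _))// cmodM z1 mulr1//.
  have qp1 : q p' = 1 by rewrite /p' (sublinearZ _ sq) ?invr_ge0 ?(ltW m0)// mulVf// gt_eqF.
  have [c' [hc' pc']] := hahn_banach p' sq.
  (* Testing the form at [conj a * p'] gives [|a|^2 <= |a|], so [|a| <= 1]; since
     [Re a >= q p' = 1], only [a = 1] is left. *)
  have p'c' : (p' *m c') 0 0 = 1.
    set a := (p' *m c') 0 0 in pc' *.
    have a1 : cmod a <= 1.
      have := hc' (ccj a *: p'); rewrite -scalemxAl mxE -/a ccjM cRe_toC => h.
      have := le_trans h (qp' _); rewrite cmod_ccj.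
      have := cmod_ge0 a; rewrite le_eqVlt => /predU1P[<-//|a0].
      by rewrite expr2 -[X in _ <= X]mulr1 ler_pM2l.
    have r1 : cRe a = 1.
      apply/eqP; rewrite eq_le -{2}qp1 pc' andbT.
      by rewrite (le_trans (ler_norm _))// (le_trans (abs_cRe _)).
    apply: cplx_eqP => //; apply/eqP; rewrite -sqrf_eq0.
    have := cmod_sqr a; rewrite r1 => e.
    have : cmod a ^+ 2 <= 1 by rewrite expr_le1// cmod_ge0.
    have := sqr_ge0 (cIm a); rewrite eq_le; lra.
  exists (fun i => if i == k then p' else p i), (fun i => if i == k then c' else c i).
  move=> i; rewrite ltnS leq_eqVlt => /predU1P[->|ik].
    rewrite eqxx; split => // j jk; rewrite (ltn_eqF jk) /p' -!scalemxAl !mxE.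
    by have := vc (Ordinal jk); rewrite mxE => ->; rewrite !mulr0.
  rewrite (ltn_eqF ik); have [h1 h2 h3 h4] := pc i ik; split => // j ji.
  by rewrite (ltn_eqF (ltn_trans ji ik)) h4.
have [p [c pc]] := step n (leqnn n).
pose P : 'M[C]_n := \matrix_(i, j) p i 0 j.
pose L : 'M[C]_n := \matrix_(i, j) c j i 0.
have rP i : row i P = p i by apply/rowP => j; rewrite !mxE.
have xL x j : (x *m L) 0 j = (x *m c j) 0 0.
  by rewrite !mxE; apply: eq_bigr => k _; rewrite !mxE.
have PL i j : (P *m L) i j = (p i *m c j) 0 0.
  by rewrite -xL -rP -row_mul [RHS]mxE.
exists P, L; split => [|i w|j x].
(* The product is upper triangular, while [is_trig_mx] means lower triangular; hence the
   transpose. *)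
- rewrite -det_mulmx -det_tr det_trig.
    by rewrite big1// => i _; rewrite mxE PL; have [] := pc i (ltn_ord i).
  apply/is_trig_mxP => i j ij; rewrite mxE PL.
  by have [_ _ _ ->] := pc j (ltn_ord j).
- by rewrite rP; have [] := pc i (ltn_ord i).
- by rewrite xL; have [] := pc j (ltn_ord j).
Qed.

End Frame.

(** * The Minkowski gauge *)

Section Gauge.
Variables (R : realType) (n : nat).
Local Notation C := (Cplx R).
Local Notation Cn := 'rV[C]_n.
Implicit Types (D : set Cn) (x y z : Cn) (t s : R).

Lemma near_rV z (P : Cn -> Prop) : (\forall w \near z, P w) <->
  exists2 dl : R, 0 < dl & forall w : Cn, (forall i, cmod (w 0 i - z 0 i) <= dl) -> P w.
Proof.
split.
  move=> /nbhs_ballP[e /= /cplx_gt0[d d0 ->]] h.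
  exists (d / 2); first by rewrite divr_gt0.
  move=> w wz; apply: h; split; first by rewrite lt_toC.
  move=> i j; rewrite (ord1 i) /ball/= cnormE lt_toC cmodB.
  by rewrite (le_lt_trans (wz j))//; lra.
move=> [dl dl0 h]; apply/nbhs_ballP; exists (toC dl); first by rewrite /= lt_toC.
move=> w [_ wz]; apply: h => i.
by have := wz 0 i; rewrite /ball/= cnormE lt_toC cmodB => /ltW.
Qed.

Lemma convex_setR D x y t : convex_set D -> D x -> D y -> 0 <= t <= 1 ->
  D (toC t *: x + toC (1 - t) *: y).
Proof.
move=> cD Dx Dy t01.
have tC : (0 : C) <= toC t <= 1 by rewrite -toC0 -toC1 !le_toC.
have := cD x y (Itv01 (andP tC).1 (andP tC).2).
rewrite !inE => /(_ Dx Dy) h; rewrite toCB toC1.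
exact: h.
Qed.

Definition gauge_set D z x := [set t : R | 0 < t /\ D (z + toC t^-1 *: x)].
Definition gauge D z x := inf (gauge_set D z x).

Variables (D : set Cn) (z : Cn).
Hypotheses (oD : open D) (cD : convex_set D) (Dz : D z).

Lemma gauge_le t x : 0 < t -> D (z + toC t^-1 *: x) -> gauge D z x <= t.
Proof.
move=> t0 Dt; apply: ge_inf; last by [].
by exists 0 => s [/ltW].
Qed.

Lemma gauge_bound : exists M, forall x, gauge D z x <= M * l1norm x.
Proof.
have := oD; rewrite openE => /(_ _ Dz) /near_rV[dl dl0 h].
exists dl^-1 => x.
have H t : 0 < t -> l1norm x <= dl * t -> gauge D z x <= t.
  move=> t0 xt; apply: gauge_le => //; apply: h => i.
  rewrite !mxE addrAC subrr add0r cmodM cmod_toC ger0_norm ?invr_ge0 ?(ltW t0)//.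
  rewrite mulrC ler_pdivrMr// (le_trans _ xt)//.
  by rewrite /l1norm (bigD1 i)//= lerDl sumr_ge0// => j _; exact: cmod_ge0.
have l0 : 0 <= l1norm x by rewrite sumr_ge0// => i _; exact: cmod_ge0.
apply/ler_addgt0Pr => e e0; apply: H.
  by rewrite ltr_wpDl// mulr_ge0// invr_ge0 ltW.
by rewrite mulrDr mulrA mulfV ?gt_eqF// mul1r lerDl mulr_ge0// ltW.
Qed.

Lemma gauge_set_nonempty x : gauge_set D z x !=set0.
Proof.
have := oD; rewrite openE => /(_ _ Dz) /near_rV[dl dl0 h].
have l0 : 0 <= l1norm x by rewrite sumr_ge0// => i _; exact: cmod_ge0.
have t0 : 0 < dl^-1 * l1norm x + 1 by rewrite ltr_wpDl// mulr_ge0// invr_ge0 ltW.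
exists (dl^-1 * l1norm x + 1); split => //; apply: h => i.
rewrite !mxE addrAC subrr add0r cmodM cmod_toC ger0_norm ?invr_ge0 ?(ltW t0)//.
rewrite mulrC ler_pdivrMr// mulrDr mulr1 mulrA mulfV ?gt_eqF// mul1r.
rewrite (@le_trans _ _ (l1norm x)) ?lerDl ?(ltW dl0)//.
by rewrite /l1norm (bigD1 i)//= lerDl sumr_ge0// => j _; exact: cmod_ge0.
Qed.

Lemma gauge_ge x m : (forall t, 0 < t -> D (z + toC t^-1 *: x) -> m <= t) ->
  m <= gauge D z x.
Proof.
by move=> h; apply: lb_le_inf; [exact: gauge_set_nonempty|move=> t []; exact: h].
Qed.

Lemma gauge_sublinear : sublinear (gauge D z).
Proof.
split=> [x y|t x].
  rewrite -lerBlDr; apply: gauge_ge => t t0 Dt.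
  rewrite lerBlDl -lerBlDr; apply: gauge_ge => s s0 Ds.
  rewrite lerBlDr; have st0 : 0 < s + t by rewrite addr_gt0.
  have tsn : s + t != 0 by rewrite gt_eqF.
  apply: gauge_le => //.
  have := convex_setR (t := s / (s + t)) cD Ds Dt.
  rewrite divr_ge0 ?(ltW s0) ?(ltW st0)//= ler_pdivrMr// mul1r lerDl (ltW t0).
  move=> /(_ isT); rewrite [X in D X -> _](_ : _ = z + toC (s + t)^-1 *: (x + y)).
    by [].
  have -> : 1 - s / (s + t) = t / (s + t) by field.
  rewrite !scalerDr !scalerA -!toCM addrACA -scalerDl -toCD.
  have -> : s / (s + t) + t / (s + t) = 1 by field.
  have -> : s / (s + t) / s = (s + t)^-1 by field; rewrite tsn gt_eqF.
  have -> : t / (s + t) / t = (s + t)^-1 by field; rewrite tsn gt_eqF.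
  by rewrite toC1 scale1r [X in _ + X = _]addrC -scalerDr.
rewrite le_eqVlt => /predU1P[<-|t0].
  rewrite toC0 scale0r mul0r; apply/ler_addgt0Pr => e e0.
  by rewrite add0r; apply: gauge_le => //; rewrite scaler0 addr0.
rewrite mulrC -ler_pdivrMr//; apply: gauge_ge => s s0 Ds.
rewrite ler_pdivrMr//; apply: gauge_le; first by rewrite mulr_gt0.
rewrite scalerA -toCM (_ : (s * t)^-1 * t = s^-1)//.
by field; rewrite !gt_eqF.
Qed.

Lemma gauge_lt1 x : gauge D z x < 1 -> D (z + x).
Proof.
move=> /(inf_lt (gauge_set_nonempty x))[t [t0 Dt] t1].
have := convex_setR (t := t) cD Dt Dz; rewrite (ltW t0) (ltW t1) => /(_ isT).
congr D; rewrite scalerDr scalerA -toCM mulfV ?gt_eqF// toC1 scale1r addrAC.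
by rewrite -scalerDl -toCD (_ : t + (1 - t) = 1) ?toC1 ?scale1r//; ring.
Qed.

(** Were the gauge nonpositive on a whole complex line of directions, [gauge_lt1] would place the
    translate of that line through [z] in [D]. The inner body is described by a strict inequality
    and the outer one by a weak one, because a gauge below 1 implies membership whereas membership
    only gives a gauge at most 1. *)
Lemma domain_frame : no_complex_line D -> exists P L : 'M[C]_n,
  [/\ \det P * \det L = 1,
    forall x, l1norm x < 1 -> D (z + x *m P) &
    forall w j, D w -> cRe (((w - z) *m L) 0 j) <= 1].
Proof.
move=> nl; have [M gM] := gauge_bound.
have sg := gauge_sublinear.
have [v v0|P [L [PL gP gL]]] := adapted_frame sg gM.
  apply: contrapT => h; apply: nl; exists z, v; split => // t.
  apply: gauge_lt1; apply: (le_lt_trans _ ltr01); rewrite leNgt; apply/negP => g0.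
  by apply: h; exists t.
exists P, L; split => // [x x1|w j Dw].
  apply: gauge_lt1; apply: le_lt_trans x1.
  rewrite mulmx_sum_row.
  apply: (@le_trans _ _ (\sum_i gauge D z (x 0 i *: row i P))).
    elim/big_ind2 : _ => // [|a b c d ha hc]; first by rewrite sublinear0.
    by rewrite (le_trans (sg.1 _ _))// lerD.
  by apply: ler_sum => i _; exact: gP.
rewrite (le_trans (gL _ _))//; apply: gauge_le => //.
by rewrite invr1 toC1 scale1r addrC subrK.
Qed.

End Gauge.

(** * Change of variables *)

Section JacobianConstant.
Local Open Scope ereal_scope.
Context d (T : measurableType d) (R : realType).
Variable mu : {measure set T -> \bar R}.

(** The change of variables formula with constant Jacobian [k], stated on integrals of nonnegative
    functions so that it composes by mere substitution. *)
Definition scales_measure (Phi : T -> T) (k : R) := [/\ (0 <= k)%R,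
  measurable_fun setT Phi & forall g : T -> \bar R, measurable_fun setT g ->
    (forall x, 0 <= g x) -> \int[mu]_x g x = k%:E * \int[mu]_x g (Phi x)].

Lemma scales_measure_id : scales_measure id 1%R.
Proof. by split => // g _ _; rewrite mul1e. Qed.

Lemma scales_measure_comp Phi Psi k l : scales_measure Phi k ->
  scales_measure Psi l -> scales_measure (Phi \o Psi) (k * l)%R.
Proof.
move=> [k0 mP hP] [l0 mQ hQ]; split; first exact: mulr_ge0.
  exact: measurableT_comp.
move=> g mg g0; rewrite hP// EFinM -muleA; congr (_ * _).
by rewrite (hQ (fun x => g (Phi x)))//; exact: measurableT_comp.
Qed.

End JacobianConstant.

Section ProductJacobian.
Local Open Scope ereal_scope.
Context d1 d2 (T1 : measurableType d1) (T2 : measurableType d2) (R : realType).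
Variables (mu : {sigma_finite_measure set T1 -> \bar R})
          (nu : {sigma_finite_measure set T2 -> \bar R}).

Lemma integral_prod_measure (g : T1 * T2 -> \bar R) :
  measurable_fun setT g -> (forall x, 0 <= g x) ->
  \int[prod_measure mu nu]_z g z = \int[mu]_x \int[nu]_y g (x, y).
Proof. by move=> mg g0; rewrite -[LHS]/(\int[mu \x nu]_z g z) fubini_tonelli1. Qed.

Lemma integral_prod_measure_swap (g : T1 * T2 -> \bar R) :
  measurable_fun setT g -> (forall x, 0 <= g x) ->
  \int[prod_measure mu nu]_z g z = \int[nu]_y \int[mu]_x g (x, y).
Proof. by move=> mg g0; rewrite -[LHS]/(\int[mu \x nu]_z g z) fubini_tonelli2. Qed.

(** The map of the first coordinate may depend on the second, as long as its Jacobian does not; this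
    covers shears as well as dilations. *)
Lemma scales_measure_fst (phi : T2 -> T1 -> T1) k :
  (forall y, scales_measure mu (phi y) k) ->
  measurable_fun setT (fun z : T1 * T2 => phi z.2 z.1) ->
  scales_measure (prod_measure mu nu) (fun z => (phi z.2 z.1, z.2)) k.
Proof.
move=> hphi mphi; have k0 : (0 <= k)%R by case: (hphi point).
have mPhi : measurable_fun setT (fun z : T1 * T2 => (phi z.2 z.1, z.2)).
  by apply/measurable_fun_pairP; split => //; exact: measurable_snd.
split => // g mg g0.
have mgP : measurable_fun setT (fun z : T1 * T2 => g (phi z.2 z.1, z.2)).
  exact: measurableT_comp mg mPhi.
rewrite !integral_prod_measure_swap// -ge0_integralZl//=.
- apply: eq_integral => y _; have [_ _ /(_ (fun x => g (x, y)))] := hphi y.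
  by apply => //; exact: measurableT_comp mg (pair2_measurable y).
- exact: (measurable_fun_fubini_tonelli_G _ mgP).
- by move=> y _; exact: integral_ge0.
Qed.

Lemma scales_measure_snd (psi : T1 -> T2 -> T2) k :
  (forall x, scales_measure nu (psi x) k) ->
  measurable_fun setT (fun z : T1 * T2 => psi z.1 z.2) ->
  scales_measure (prod_measure mu nu) (fun z => (z.1, psi z.1 z.2)) k.
Proof.
move=> hphi mphi; have k0 : (0 <= k)%R by case: (hphi point).
have mPhi : measurable_fun setT (fun z : T1 * T2 => (z.1, psi z.1 z.2)).
  by apply/measurable_fun_pairP; split => //; exact: measurable_fst.
split => // g mg g0.
have mgP : measurable_fun setT (fun z : T1 * T2 => g (z.1, psi z.1 z.2)).
  exact: measurableT_comp mg mPhi.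
rewrite !integral_prod_measure// -ge0_integralZl//=.
- apply: eq_integral => x _; have [_ _ /(_ (fun y => g (x, y)))] := hphi x.
  by apply => //; exact: measurableT_comp mg (pair1_measurable x).
- exact: (measurable_fun_fubini_tonelli_F _ mgP).
- by move=> x _; exact: integral_ge0.
Qed.

End ProductJacobian.

Section ConsMeasure.
Local Open Scope ereal_scope.
Context d (T : measurableType d) (R : realType) (n : nat).
Variables (mu : {sigma_finite_measure set T -> \bar R})
          (nu : {sigma_finite_measure set (n.-tuple T) -> \bar R}).

Lemma integral_cons_measure (g : n.+1.-tuple T -> \bar R) :
  measurable_fun setT g -> (forall x, 0 <= g x) ->
  \int[cons_measure mu nu]_t g t = \int[prod_measure mu nu]_z g (tcons z).
Proof.
move=> mg g0.
rewrite -[LHS]/(\int[pushforward (prod_measure mu nu) (@tcons _ T n)]_t g t).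
by rewrite ge0_integral_pushforward//; exact: measurable_tcons.
Qed.

Lemma scales_measure_cons Phi Psi k : scales_measure (prod_measure mu nu) Phi k ->
  measurable_fun setT Psi -> (forall z, Psi (tcons z) = tcons (Phi z)) ->
  scales_measure (cons_measure mu nu) Psi k.
Proof.
move=> [k0 mPhi hPhi] mPsi PP; split => // g mg g0.
rewrite !integral_cons_measure//; last exact: measurableT_comp mg mPsi.
rewrite hPhi//; last exact: measurableT_comp mg (@measurable_tcons _ T n).
by congr (_ * _); apply: eq_integral => z _; rewrite PP.
Qed.

End ConsMeasure.

Section PlaneJacobian.
Local Open Scope ereal_scope.
Variable R : realType.
Local Notation mu := (@lebesgue_measure R).

(** Uniqueness of Lebesgue measure: [|a|] times the image measure gives half-open intervals their
    length. For [a < 0] the preimage of such an interval is closed at the other end. *)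
Lemma scales_lebesgue_affine (a b : R) : a != 0%R ->
  scales_measure mu (fun x => (a * x + b)%R : measurableTypeR R) `|a|%R.
Proof.
move=> a0; pose Phi : measurableTypeR R -> measurableTypeR R := fun x => (a * x + b)%R.
have mPhi : measurable_fun setT Phi.
  by apply: measurable_funD => //; apply: measurable_funM.
split => // g mg g0.
pose M0 := measure_function_pushforward__canonical__measure_function_Measure mu mPhi.
pose k : {nonneg R} := NngNum (normr_ge0 a).
pose M : {measure set (measurableTypeR R) -> \bar R} := mscale k M0.
have muM A : measurable A -> mu A = M A.
  apply: lebesgue_measure_unique => X [[u v] _ <-].
  rewrite -[RHS]/(`|a|%:E * mu (Phi @^-1` [set` `]u, v]])).
  have muI (i : interval R) : Phi @^-1` [set` `]u, v]] = [set` i] ->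
      mu (Phi @^-1` [set` `]u, v]]) = mu [set` i] by move=> ->.
  have [a_gt0|a_lt0|a_eq0] := ltgtP a 0%R; last by rewrite a_eq0 eqxx in a0.
    rewrite (muI `[(v - b) / a, (u - b) / a[%R).
      rewrite ltr0_norm// !lebesgue_measure_itv/= !lte_fin.
      rewrite ltr_nM2r ?invr_lt0// ltrD2r.
      case: ifPn => [uv|_]; last by rewrite mule0.
      by rewrite -!EFinB -EFinM; congr EFin; field.
    apply/seteqP; split => x /=; rewrite !in_itv/= /Phi => /andP[h1 h2];
      move: h1 h2; rewrite ?ltr_ndivlMr ?ler_ndivrMr// [(x * a)%R]mulrC; lra.
  rewrite (muI `](u - b) / a, (v - b) / a]%R).
    rewrite gtr0_norm// !lebesgue_measure_itv/= !lte_fin.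
    rewrite ltr_pM2r ?invr_gt0// ltrD2r.
    case: ifPn => [uv|_]; last by rewrite mule0.
    by rewrite -!EFinB -EFinM; congr EFin; field.
  apply/seteqP; split => x /=; rewrite !in_itv/= /Phi => /andP[h1 h2];
    move: h1 h2; rewrite ?ltr_pdivrMr ?ler_pdivlMr// [(x * a)%R]mulrC; lra.
transitivity (\int[M]_x g x).
  by apply: eq_measure_integral => A mA _; exact: muM.
rewrite ge0_integral_mscale//=; congr (_ * _).
by rewrite ge0_integral_pushforward.
Qed.

Local Notation R2 := (measurableTypeR R * measurableTypeR R)%type.

Definition to_cplx (p : R2) : Cplx R := Complex p.1 p.2.
Definition of_cplx (c : Cplx R) : R2 := (cRe c, cIm c).

Lemma to_cplxK : cancel to_cplx of_cplx. Proof. by case. Qed.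
Lemma of_cplxK : cancel of_cplx to_cplx. Proof. by case. Qed.

Lemma scales_plane_fst (a b c : R) : a != 0%R ->
  scales_measure (@lebesgue2 R) (fun p : R2 => (a * p.1 + (b * p.2 + c), p.2)%R : R2) `|a|%R.
Proof.
move=> a0.
apply: (@scales_measure_fst _ _ (measurableTypeR R) (measurableTypeR R) R mu mu
  (fun y x => (a * x + (b * y + c))%R)).
  by move=> y; exact: scales_lebesgue_affine.
apply: measurable_funD; first by apply: measurable_funM => //; exact: measurable_fst.
by apply: measurable_funD => //; apply: measurable_funM => //; exact: measurable_snd.
Qed.

Lemma scales_plane_snd (a b c : R) : a != 0%R ->
  scales_measure (@lebesgue2 R) (fun p : R2 => (p.1, a * p.2 + (b * p.1 + c))%R : R2) `|a|%R.
Proof.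
move=> a0.
apply: (@scales_measure_snd _ _ (measurableTypeR R) (measurableTypeR R) R mu mu
  (fun x y => (a * y + (b * x + c))%R)).
  by move=> y; exact: scales_lebesgue_affine.
apply: measurable_funD; first by apply: measurable_funM => //; exact: measurable_snd.
by apply: measurable_funD => //; apply: measurable_funM => //; exact: measurable_fst.
Qed.

(* A real 2 x 2 matrix with nonzero corner is a product of shears and dilations
   of one coordinate; if [Re a = 0], write [a = (1 + i) q] with [Re q <> 0]. *)
Lemma scales_cplx_affine (a b : Cplx R) : a != 0%R ->
  scales_measure (@lebesgue2 R) (fun p : R2 => of_cplx (a * to_cplx p + b)%R)
    (cmod a ^+ 2)%R.
Proof.
wlog r0 : a b / cRe a != 0%R => [H a0|_].
  have [ra|/H] := eqVneq (cRe a) 0%R; last exact.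
  pose w : Cplx R := Complex (1%R : R) 1%R.
  have w0 : w != 0%R by apply/eqP => /(congr1 (@cRe R)) /eqP; rewrite /= oner_eq0.
  have [q qa] : exists q, (q * w)%R = a by exists (a / w)%R; rewrite divfK.
  have q0 : q != 0%R by apply: contraNneq a0 => q0; rewrite -qa q0 mul0r.
  have rq : cRe q != 0%R.
    apply/eqP => r0; move: ra; rewrite -qa cReM r0 mul0r mulr1 sub0r => /eqP.
    rewrite oppr_eq0 => /eqP i0.
    by move/eqP: q0; apply; exact: cplx_eqP.
  have := scales_measure_comp (H w b (oner_neq0 _) w0) (H q 0%R rq q0).
  rewrite -exprMn -cmodM [(w * _)%R]mulrC qa.
  congr scales_measure; apply/funext => p /=.
  by rewrite of_cplxK addr0 mulrA [(w * _)%R]mulrC qa.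
set al := cRe a; set be := cIm a; set u := cRe b; set v := cIm b.
(* The Schur complement of the corner [al] in the real matrix of multiplication by [a], equal to
   [|a|^2 / al]. *)
have g0 : (al + be ^+ 2 / al)%R != 0%R.
  rewrite (_ : _ + _ = (al ^+ 2 + be ^+ 2) / al)%R; last by field.
  by rewrite mulf_neq0 ?invr_eq0// gt_eqF// ltr_pwDl ?sqr_ge0// exprn_even_gt0.
have := scales_measure_comp (scales_plane_snd (be / al) 0 (oner_neq0 _))
  (scales_measure_comp (scales_plane_snd 0 (v - be / al * u) g0)
  (scales_measure_comp (scales_plane_fst 0 u r0)
     (scales_plane_fst (- (be / al)) 0 (oner_neq0 _)))).
rewrite !normr1 !mul1r mulr1 -normrM.
have -> : ((al + be ^+ 2 / al) * al)%R = (cmod a ^+ 2)%R.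
  by rewrite cmod_sqr -/al -/be; field.
rewrite ger0_norm ?sqr_ge0//; congr scales_measure; apply/funext => -[x y] /=.
by rewrite /of_cplx !cReImE/= -/al -/be -/u -/v; congr pair; field.
Qed.

End PlaneJacobian.

Section ComplexMeasurable.
Context d (T : measurableType d) (R : realType).
Implicit Types f g : T -> Cplx R.

Definition cmeasurable f := measurable_fun [set: T] (@cRe R \o f) /\
  measurable_fun [set: T] (@cIm R \o f).

Lemma cmeasurable_cst (c : Cplx R) : cmeasurable (fun=> c).
Proof. by split; exact: measurable_cst. Qed.

Lemma cmeasurableD f g : cmeasurable f -> cmeasurable g ->
  cmeasurable (fun x => f x + g x).
Proof.
move=> [fr fi] [gr gi]; split.
  rewrite (_ : _ \o _ = (@cRe R \o f) \+ (@cRe R \o g)); first exact: measurable_funD.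
  by apply/funext => x /=; rewrite cReD.
rewrite (_ : _ \o _ = (@cIm R \o f) \+ (@cIm R \o g)); first exact: measurable_funD.
by apply/funext => x /=; rewrite cImD.
Qed.

Lemma cmeasurableM f g : cmeasurable f -> cmeasurable g ->
  cmeasurable (fun x => f x * g x).
Proof.
move=> [fr fi] [gr gi]; split.
  rewrite (_ : _ \o _ = (@cRe R \o f) \* (@cRe R \o g) \- (@cIm R \o f) \* (@cIm R \o g)).
    by apply: measurable_funB; exact: measurable_funM.
  by apply/funext => x /=; rewrite cReM.
rewrite (_ : _ \o _ = (@cRe R \o f) \* (@cIm R \o g) \+ (@cIm R \o f) \* (@cRe R \o g)).
  by apply: measurable_funD; exact: measurable_funM.
by apply/funext => x /=; rewrite cImM.
Qed.

Lemma cmeasurable_sum (I : Type) (s : seq I) (f : I -> T -> Cplx R) :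
  (forall i, cmeasurable (f i)) -> cmeasurable (fun x => \sum_(i <- s) f i x).
Proof.
move=> mf; elim: s => [|i s IH].
  by under eq_fun do rewrite big_nil; exact: cmeasurable_cst.
by under eq_fun do rewrite big_cons; exact: cmeasurableD.
Qed.

Lemma cmeasurable_of_cplx f : cmeasurable f ->
  measurable_fun [set: T] (fun x => of_cplx (f x)).
Proof. by move=> [fr fi]; apply/measurable_fun_pairP; split. Qed.

Lemma cmeasurable_to_cplx (p : T -> measurableTypeR R * measurableTypeR R) :
  measurable_fun [set: T] p -> cmeasurable (fun x => to_cplx (p x)).
Proof. by move=> /measurable_fun_pairP[? ?]; split. Qed.

Lemma measurable_cmod f : cmeasurable f -> measurable_fun [set: T] (fun x => cmod (f x)).
Proof.
move=> [fr fi].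
rewrite (_ : (fun x => _) = Num.sqrt \o
    ((@cRe R \o f) \* (@cRe R \o f) \+ (@cIm R \o f) \* (@cIm R \o f))).
  apply: measurableT_comp; last by apply: measurable_funD; exact: measurable_funM.
  by apply: continuous_measurable_fun; exact: sqrt_continuous.
by apply/funext => x /=; rewrite cmodE !expr2.
Qed.

End ComplexMeasurable.

Section LinearJacobian.
Variable R : realType.
Local Notation C := (Cplx R).
Local Notation R2 := (measurableTypeR R * measurableTypeR R)%type.

Definition to_coords n (v : 'rV[C]_n) : n.-tuple R2 :=
  [tuple of_cplx (v 0 i) | i < n].

Lemma to_coordsK n : cancel (@to_coords n) (@of_coords R n).
Proof. by move=> v; apply/rowP => i; rewrite mxE tnth_mktuple; exact: of_cplxK. Qed.

Lemma of_coordsK n : cancel (@of_coords R n) (@to_coords n).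
Proof.
move=> t; apply: eq_from_tnth => i; rewrite tnth_mktuple mxE.
exact: (@to_cplxK R (tnth t i)).
Qed.

Lemma of_coords_tcons n (z : R2 * n.-tuple R2) :
  of_coords (tcons z) = row_mx (to_cplx z.1)%:M (of_coords z.2) :> 'rV[C]_(1 + n).
Proof.
apply/rowP => i; rewrite [LHS]mxE; case: (splitP i) => j ij.
  have -> : i = lshift n j by exact/val_inj.
  by rewrite row_mxEl mxE (ord1 j) eqxx mulr1n.
have -> : i = rshift 1 j by apply/val_inj.
rewrite row_mxEr mxE (_ : rshift 1 j = lift ord0 j) ?tnthS; first by [].
exact/val_inj.
Qed.

Lemma to_coords_row_mx n (x : C) (w : 'rV[C]_n) :
  to_coords (row_mx x%:M w : 'rV[C]_(1 + n)) = tcons (of_cplx x, to_coords w).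
Proof.
apply: (can_inj (@of_coordsK _)).
by rewrite to_coordsK of_coords_tcons /= of_cplxK to_coordsK.
Qed.

Lemma measurable_to_coords d (T : measurableType d) n (F : T -> 'rV[C]_n) :
  (forall i, cmeasurable (fun x => F x 0 i)) ->
  measurable_fun [set: T] (fun x => to_coords (F x)).
Proof.
move=> mF; apply/measurable_fun_tnthP => i.
rewrite (_ : _ \o _ = fun x => of_cplx (F x 0 i)); first exact: cmeasurable_of_cplx.
by apply/funext => x /=; rewrite tnth_mktuple.
Qed.

Lemma cmeasurable_of_coords d (T : measurableType d) n (F : T -> n.-tuple R2) i :
  measurable_fun [set: T] F -> cmeasurable (fun x => of_coords (F x) 0 i).
Proof.
move=> mF; under eq_fun do rewrite mxE.
apply: (@cmeasurable_to_cplx _ _ _ (fun x => tnth (F x) i)).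
by apply: (measurableT_comp (measurable_tnth i) mF).
Qed.

Definition affine_coords n (A : 'M[C]_n) (b : 'rV[C]_n) (t : n.-tuple R2) :=
  to_coords (of_coords t *m A + b).

Lemma measurable_affine_coords n (A : 'M[C]_n) b :
  measurable_fun setT (affine_coords A b).
Proof.
apply: measurable_to_coords => i; under eq_fun do rewrite !mxE.
apply: cmeasurableD; last exact: cmeasurable_cst.
apply: cmeasurable_sum => k; apply: cmeasurableM; last exact: cmeasurable_cst.
exact: cmeasurable_of_coords.
Qed.

Lemma scales_translation n (b : 'rV[C]_n) :
  scales_measure (lebesgue2n n) (affine_coords 1%:M b) 1.
Proof.
elim: n b => [|n IH] b.
  rewrite (_ : affine_coords _ _ = id); first exact: scales_measure_id.
  by apply/funext => t; rewrite [t]tuple0 [LHS]tuple0.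
pose b1 : C := (b : 'rV_(1 + n)) 0 (lshift n 0).
pose b2 : 'rV[C]_n := rsubmx (b : 'rV_(1 + n)).
have bE : b = row_mx b1%:M b2 :> 'rV_(1 + n).
  transitivity (row_mx (lsubmx (b : 'rV_(1 + n))) b2); first by rewrite hsubmxK.
  congr row_mx; apply/rowP => i.
  by rewrite (ord1 i) !mxE eqxx mulr1n.
have h1 := @scales_measure_fst _ _ _ _ _ (@lebesgue2 R) (lebesgue2n n)
  (fun _ p => of_cplx (1 * to_cplx p + b1)) _ (fun=> scales_cplx_affine b1 (oner_neq0 _)).
have h2 := @scales_measure_snd _ _ _ _ _ (@lebesgue2 R) (lebesgue2n n)
  (fun _ t => affine_coords 1%:M b2 t) _ (fun=> IH b2).
have := scales_measure_comp (h1 _) (h2 _).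
rewrite cmod1 expr1n mulr1 => h.
apply: (scales_measure_cons (h _ _)).
- apply: cmeasurable_of_cplx; apply: cmeasurableD; last exact: cmeasurable_cst.
  apply: cmeasurableM; first exact: cmeasurable_cst.
  by apply: cmeasurable_to_cplx; exact: measurable_fst.
- exact: measurableT_comp (measurable_affine_coords _ _) measurable_snd.
- exact: measurable_affine_coords.
- move=> z; rewrite /affine_coords !mulmx1 of_coords_tcons bE (@add_row_mx _ 1 1 n) -raddfD.
  by rewrite to_coords_row_mx /= mul1r mulmx1.
Qed.

Lemma affine_coords_comp n (A B : 'M[C]_n) b :
  affine_coords (A *m B) b = affine_coords B b \o affine_coords A 0.
Proof. by apply/funext => t; rewrite /affine_coords /= to_coordsK addr0 mulmxA. Qed.

(** Matrices act on rows from the right, so the map is [(x, w) |-> (x, w + x b)]: a translation of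
    the tail for each fixed head. *)
Lemma scales_tail_shear n (b : 'rV[C]_n) :
  scales_measure (lebesgue2n n.+1) (affine_coords (block_mx 1%:M b 0 1%:M : 'M[C]_(1 + n)) 0) 1.
Proof.
have h := @scales_measure_snd _ _ _ _ _ (@lebesgue2 R) (lebesgue2n n)
  (fun p t => affine_coords 1%:M (to_cplx p *: b) t) _
  (fun p => scales_translation (to_cplx p *: b)).
apply: (scales_measure_cons (h _)).
- apply: measurable_to_coords => i; under eq_fun do rewrite mulmx1 mxE [X in _ + X]mxE.
  apply: cmeasurableD; first by apply: cmeasurable_of_coords; exact: measurable_snd.
  apply: cmeasurableM; last exact: cmeasurable_cst.
  by apply: cmeasurable_to_cplx; exact: measurable_fst.
- exact: measurable_affine_coords.
- move=> z; rewrite /affine_coords of_coords_tcons addr0 mul_row_block.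
  by rewrite !mulmx1 mulmx0 addr0 mul_scalar_mx to_coords_row_mx to_cplxK addrC.
Qed.

Lemma scales_head_shear n (c : 'cV[C]_n) :
  scales_measure (lebesgue2n n.+1) (affine_coords (block_mx 1%:M 0 c 1%:M : 'M[C]_(1 + n)) 0) 1.
Proof.
have := @scales_measure_fst _ _ _ _ _ (@lebesgue2 R) (lebesgue2n n)
  (fun t p => of_cplx (1 * to_cplx p + (of_coords t *m c) 0 0)) _
  (fun t => scales_cplx_affine ((of_coords t *m c) 0 0) (oner_neq0 _)).
rewrite cmod1 expr1n => h; apply: (scales_measure_cons (h _)).
- apply: cmeasurable_of_cplx; apply: cmeasurableD.
    apply: cmeasurableM; first exact: cmeasurable_cst.
    by apply: cmeasurable_to_cplx; exact: measurable_fst.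
  under eq_fun do rewrite mxE; apply: cmeasurable_sum => i.
  apply: cmeasurableM; last exact: cmeasurable_cst.
  by apply: cmeasurable_of_coords; exact: measurable_snd.
- exact: measurable_affine_coords.
- move=> z; rewrite /affine_coords of_coords_tcons addr0 mul_row_block.
  rewrite !mulmx1 mulmx0 add0r mul1r [of_coords z.2 *m c]mx11_scalar -raddfD.
  by rewrite to_coords_row_mx of_coordsK /= [_%:M _ _]mxE eqxx mulr1n.
Qed.

(* Block LDU decomposition; a shear first makes the pivot nonzero if needed. *)
Lemma scales_linear n (A : 'M[C]_n) : \det A != 0 ->
  scales_measure (lebesgue2n n) (affine_coords A 0) (cmod (\det A) ^+ 2).
Proof.
elim: n A => [|n IH] A dA.
  rewrite det_mx00 cmod1 expr1n (_ : affine_coords _ _ = id).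
    exact: scales_measure_id.
  by apply/funext => t; rewrite [t]tuple0 [LHS]tuple0.
have diag (a : C) (S : 'M[C]_n) : a != 0 -> \det S != 0 ->
    scales_measure (lebesgue2n n.+1)
      (affine_coords (block_mx a%:M 0 0 S : 'M[C]_(1 + n)) 0)
      (cmod a ^+ 2 * cmod (\det S) ^+ 2).
  move=> a0 dS.
  have h1 := @scales_measure_fst _ _ _ _ _ (@lebesgue2 R) (lebesgue2n n)
    (fun _ p => of_cplx (a * to_cplx p + 0)) _ (fun=> scales_cplx_affine 0 a0).
  have h2 := @scales_measure_snd _ _ _ _ _ (@lebesgue2 R) (lebesgue2n n)
    (fun _ t => affine_coords S 0 t) _ (fun=> IH S dS).
  have h := scales_measure_comp (h1 _) (h2 _).
  apply: (scales_measure_cons (h _ _)).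
  - apply: cmeasurable_of_cplx; apply: cmeasurableD; last exact: cmeasurable_cst.
    apply: cmeasurableM; first exact: cmeasurable_cst.
    by apply: cmeasurable_to_cplx; exact: measurable_fst.
  - exact: measurableT_comp (measurable_affine_coords _ _) measurable_snd.
  - exact: measurable_affine_coords.
  - move=> z; rewrite /affine_coords of_coords_tcons addr0 mul_row_block.
    rewrite !mulmx0 addr0 add0r -scalar_mxM to_coords_row_mx /=.
    by rewrite !addr0 mulrC.
have pivot (B : 'M[C]_(1 + n)) : B 0 0 != 0 -> \det B != 0 ->
    scales_measure (lebesgue2n n.+1) (affine_coords B 0) (cmod (\det B) ^+ 2).
  set a := B 0 0 => a0 dB.
  pose b := ursubmx B; pose c := dlsubmx B.
  pose S := drsubmx B - c *m (a^-1 *: b).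
  have ulB : ulsubmx B = a%:M.
    apply/matrixP => i j; rewrite (ord1 i) (ord1 j) !mxE eqxx mulr1n /a.
    by congr (B _ _); apply/val_inj.
  have BE : B = block_mx 1%:M 0 (a^-1 *: c) 1%:M *m
      (block_mx a%:M 0 0 S *m block_mx 1%:M (a^-1 *: b) 0 1%:M).
    rewrite !mulmx_block !mul1mx !mul0mx !mulmx0 !mulmx1 !addr0 !add0r.
    rewrite !mul_scalar_mx mul_mx_scalar !scalerA mulfV// !scale1r.
    by rewrite /S -scalemxAl -scalemxAr addrC subrK -ulB submxK.
  have dBE : \det B = a * \det S.
    rewrite BE !det_mulmx !det_lblock det_ublock !det1 !mul1r mulr1.
    by rewrite (det_scalar1).
  have dS : \det S != 0 by move: dB; rewrite dBE mulf_eq0 negb_or => /andP[].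
  have := scales_measure_comp (scales_measure_comp (scales_tail_shear (a^-1 *: b))
    (diag a S a0 dS)) (scales_head_shear (a^-1 *: c)).
  rewrite mul1r mulr1 -exprMn -cmodM -dBE.
  by rewrite [in X in _ -> scales_measure _ X _]BE !affine_coords_comp.
have [a0|a0] := eqVneq ((A : 'M[C]_(1 + n)) 0 0) 0; last exact: pivot.
have [i ci] : exists i : 'I_n, dlsubmx (A : 'M[C]_(1 + n)) i 0 != 0.
  apply: contrapT => h; move/eqP: dA; apply.
  rewrite -[A](@submxK _ 1 n 1 n) (_ : dlsubmx _ = 0) ?(@det_ublock _ 1 n).
    rewrite det_mx11 (_ : ulsubmx _ _ _ = 0) ?mul0r// !mxE -[RHS]a0.
    by congr (A _ _); apply/val_inj.
  apply/matrixP => i j; rewrite (ord1 j) [RHS]mxE; apply/eqP.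
  by apply: contrapT => ci; apply: h; exists i; exact/negP.
(* Multiplication by [U 1] on the left adds to the first row the row whose leading entry is nonzero;
   [U (-1)] undoes it. *)
pose U (s : C) : 'M[C]_(1 + n) := block_mx 1%:M (s *: delta_mx 0 i) 0 1%:M.
have UU : U (-1) *m U 1 = 1%:M.
  rewrite /U mulmx_block !mul1mx !mulmx1 !mul0mx !mulmx0 !addr0 !add0r.
  by rewrite scaleN1r scale1r subrr -scalar_mx_block.
have dU s : \det (U s) = 1 by rewrite /U det_ublock !det1 mulr1.
have AE : A = U (-1) *m (U 1 *m A) by rewrite mulmxA UU mul1mx.
have dE : \det (U 1 *m A) = \det A by rewrite det_mulmx dU mul1r.
have -> : affine_coords A 0 = affine_coords (U 1 *m A) 0 \o affine_coords (U (-1)) 0.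
  by rewrite {1}AE affine_coords_comp.
rewrite -dE -[cmod _ ^+ 2]mulr1.
apply: scales_measure_comp; last exact: scales_tail_shear.
apply: pivot; last by rewrite dE.
have -> : (U 1 *m A) 0 0 = dlsubmx (A : 'M[C]_(1 + n)) i 0.
  rewrite -[in LHS](@submxK _ 1 n 1 n A) /U (@mulmx_block _ 1 n 1 n 1 n).
  set B := block_mx _ _ _ _.
  have -> : B 0 0 = B (lshift n 0) (lshift n 0) by congr (B _ _); exact/val_inj.
  rewrite /B block_mxEul mul1mx scale1r mxE -rowE [row _ _ _ _]mxE.
  rewrite (_ : ulsubmx _ 0 0 = 0) ?add0r// !mxE -[RHS]a0.
  by congr (A _ _); apply/val_inj.
exact: ci.
Qed.

End LinearJacobian.

(** * Measurability of open sets in real coordinates *)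

Section OpenMeasurable.
Variables (R : realType) (n : nat).
Local Notation C := (Cplx R).
Local Notation R2 := (measurableTypeR R * measurableTypeR R)%type.
Local Notation Tn := (n.-tuple R2).

(* An open set is the union of the countably many boxes of mesh [1 / (k + 1)]
   that it contains. *)
Definition grid_box (j : nat * {ffun 'I_n -> int * int}) : set Tn :=
  [set t | forall i, [set p : R2 |
    (((j.2 i).1)%:~R <= j.1.+1%:R * p.1 < ((j.2 i).1)%:~R + 1) /\
    (((j.2 i).2)%:~R <= j.1.+1%:R * p.2 < ((j.2 i).2)%:~R + 1)] (tnth t i)].

Lemma measurable_grid_box j : measurable (grid_box j).
Proof.
rewrite (_ : grid_box j = \bigcap_(i in [set: 'I_n]) ((@tnth n R2)^~ i @^-1`
    (`[(((j.2 i).1)%:~R) / j.1.+1%:R, (((j.2 i).1)%:~R + 1) / j.1.+1%:R[%classic `*`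
     `[(((j.2 i).2)%:~R) / j.1.+1%:R, (((j.2 i).2)%:~R + 1) / j.1.+1%:R[%classic))).
  apply: fin_bigcap_measurable => // i _.
  rewrite -[X in measurable X]setTI; apply: measurable_tnth => //.
  exact: measurableX.
have k0 : (0 : R) < j.1.+1%:R by rewrite ltr0n.
apply/seteqP; split => t /= h i.
  move=> _; have [h1 h2] := h i; split => /=; rewrite in_itv/=.
    by rewrite ler_pdivrMr// ltr_pdivlMr// ![_ * j.1.+1%:R]mulrC.
  by rewrite ler_pdivrMr// ltr_pdivlMr// ![_ * j.1.+1%:R]mulrC.
have [] := h i Logic.I; rewrite /= !in_itv/=.
by rewrite !ler_pdivrMr// !ltr_pdivlMr// ![_ * j.1.+1%:R]mulrC.
Qed.

Lemma open_coords_measurable (D : set 'rV[C]_n) : open D ->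
  measurable (@of_coords R n @^-1` D).
Proof.
move=> oD.
pose F j := if pselect (grid_box j `<=` @of_coords R n @^-1` D) then grid_box j
  else set0.
rewrite (_ : _ @^-1` _ = \bigcup_j F j).
  apply: countable_bigcupT_measurable => // j; rewrite /F.
  by case: pselect => ?; [exact: measurable_grid_box|exact: measurable0].
apply/seteqP; split => t /=; last first.
  by move=> [j _]; rewrite /F; case: pselect => // h /h.
move=> Dt; have := oD; rewrite openE => /(_ _ Dt) /near_rV[dl dl0 h].
(* Real and imaginary parts may each vary by [1 / (k + 1)] in a box, and the modulus by their sum;
   hence the factor 2. *)
have [k hk] : exists k : nat, 2 / dl <= k.+1%:R.
  exists (Num.truncn (2 / dl)); have := truncnS_gt (2 / dl).
  exact: ltW.
have k0 : (0 : R) < k.+1%:R by rewrite ltr0n.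
pose f : {ffun 'I_n -> int * int} := [ffun i =>
  (Num.floor (k.+1%:R * (tnth t i).1 : R), Num.floor (k.+1%:R * (tnth t i).2 : R))].
have tb : grid_box (k, f) t.
  by move=> i /=; rewrite ffunE /= !floor_le /= -[1]/(1%:~R) -!intrD !floorD1_gt.
exists (k, f) => //; rewrite /F; case: pselect => // nh; exfalso; apply: nh.
move=> w wb /=; apply: h => i; rewrite !mxE.
apply: (le_trans (cmod_le_ReIm _)); rewrite !cReImE /=.
have [/andP[a1 a2] /andP[a3 a4]] := tb i; have [/andP[b1 b2] /andP[b3 b4]] := wb i.
have kd : 2 <= k.+1%:R * dl by rewrite -ler_pdivrMr.
rewrite -(ler_pM2l k0) (le_trans _ kd)// mulrDr.
have e (x : R) : k.+1%:R * `|x| = `|k.+1%:R * x| by rewrite normrM gtr0_norm.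
rewrite !e !mulrBr.
have h1 : `|k.+1%:R * (tnth w i).1 - k.+1%:R * (tnth t i).1| <= 1 :> R.
  by rewrite ler_norml; apply/andP; split; lra.
have h2 : `|k.+1%:R * (tnth w i).2 - k.+1%:R * (tnth t i).2| <= 1 :> R.
  by rewrite ler_norml; apply/andP; split; lra.
lra.
Qed.

Lemma measurable_cmod_sqr_coords (D : set 'rV[C]_n) (f : 'rV[C]_n -> C) :
  open D -> (forall z, D z -> {for z, continuous f}) ->
  measurable_fun (@of_coords R n @^-1` D) (fun t => (cmod (f (of_coords t)) ^+ 2)%:E).
Proof.
move=> oD cf; apply/measurable_EFinP.
move=> mD; apply: (measurability _ (RGenOInfty.measurableE R)) => //.
move=> /= _ [_ [a ->] <-].
rewrite (_ : _ `&` _ = @of_coords R n @^-1` (D `&` [set z | a < cmod (f z) ^+ 2])).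
  apply: open_coords_measurable; rewrite openE => z [Dz az].
  have := oD; rewrite openE => /(_ _ Dz) nD.
  have c0 := cmod_ge0 (f z).
  have [e e0 he] : exists2 e, 0 < e & forall w, cmod (f w - f z) <= e -> a < cmod (f w) ^+ 2.
    have [a0|a0] := ltP a 0; first by exists 1 => // w _; rewrite (lt_le_trans a0)// sqr_ge0.
    have sa : Num.sqrt a < cmod (f z).
      by rewrite -(@ltr_pXn2r _ 2)// ?nnegrE ?sqrtr_ge0// sqr_sqrtr.
    exists ((cmod (f z) - Num.sqrt a) / 2); first by rewrite divr_gt0// subr_gt0.
    move=> w hw; rewrite -[a]sqr_sqrtr// ltr_pXn2r ?nnegrE ?sqrtr_ge0 ?cmod_ge0//.
    have := cmodD (f w) (f z - f w); rewrite addrC subrK cmodB; lra.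
  have nz : nbhs (f z) [set u | cmod (u - f z) <= e] by apply/near_cmod; exists e.
  have nf : \forall w \near z, cmod (f w - f z) <= e := cf z Dz _ nz.
  have : \forall w \near z, D w /\ cmod (f w - f z) <= e by exact: filterI nD nf.
  by apply: filterS => w [Dw hw]; split => //; exact: he.
apply/seteqP; split => t /=; rewrite in_itv/= andbT => -[]//.
Qed.

End OpenMeasurable.

(** * Volume of the cross-polytope *)

Section LayerCake.
Local Open Scope ereal_scope.
Context d (T : measurableType d) (R : realType).
Local Notation leb := (@lebesgue_measure R).

Lemma integral_exp_tail (x : R) : \int[leb]_s (expR (- s) * (x < s)%R%:R)%:E = (expR (- x))%:E.
Proof.
transitivity (\int[leb]_(s in `]x, +oo[) (expR (- s))%:E).
  rewrite [RHS]integral_mkcond; apply: eq_integral => s _.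
  rewrite patchE; case: ifPn; rewrite ?inE/= ?notin_setE/= in_itv/= andbT => xs.
    by rewrite xs mulr1.
  by rewrite (negbTE (introN idP xs)) mulr0.
rewrite integral_itv_obnd_cbnd; last first.
  by apply/measurable_EFinP; apply: measurable_funTS; apply: measurableT_comp => //.
rewrite (@ge0_continuous_FTC2y _ _ (fun s => - expR (- s))%R x 0%R).
- by rewrite -EFinB sub0r opprK.
- by move=> s _; exact: expR_ge0.
- apply: continuous_subspaceT => s; apply: continuous_comp; last exact: continuous_expR.
  exact: opp_continuous.
- rewrite -oppr0; apply: cvgN; exact: cvgr_expR.
- by move=> s _.
- apply: cvg_at_right_filter; apply: cvgN; apply: continuous_comp; last exact: continuous_expR.
  exact: opp_continuous.
- move=> s _; rewrite derive1E.
  have -> : 'D_1 (fun s : R => - expR (- s))%R s = (- (expR (- s) * -1))%R.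
    by apply: derive_val.
  by rewrite mulrN1 opprK.
Qed.

Lemma measurable_ltb d' (T' : measurableType d') (f g : T' -> R) :
  measurable_fun setT f -> measurable_fun setT g ->
  measurable_fun setT (fun x => (f x < g x)%R%:R : R).
Proof.
move=> mf mg.
rewrite (_ : (fun x => _) = \1_[set x | (f x < g x)%R]).
  apply: measurable_indic; rewrite -[X in measurable X]setTI.
  by have /(_ measurableT [set true]) := measurable_fun_ltr mf mg; exact.
by apply/funext => x; rewrite indicE; congr ((nat_of_bool _)%:R); apply/idP/idP; rewrite inE.
Qed.

Variable mu : {sigma_finite_measure set T -> \bar R}.

(** Write [e^(- N)] as the integral of [e^(- s)] over [s > N] and exchange the integrals by
    Tonelli. *)
Lemma layer_cake (w N : T -> R) : measurable_fun setT w -> measurable_fun setT N ->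
  (forall x, 0 <= w x)%R ->
  \int[mu]_x (w x * expR (- N x))%:E =
  \int[leb]_s ((expR (- s))%:E * \int[mu]_x (w x * (N x < s)%R%:R)%:E).
Proof.
move=> mw mN w0.
pose F (z : measurableTypeR R * T) : \bar R :=
  (expR (- z.1) * (w z.2 * (N z.2 < z.1)%R%:R))%:E.
have F0 z : 0 <= F z by rewrite lee_fin mulr_ge0 ?expR_ge0// mulr_ge0.
have mF : measurable_fun setT F.
  apply/measurable_EFinP; apply: measurable_funM.
    by apply: measurableT_comp => //; apply: measurableT_comp => //; exact: measurable_fst.
  apply: measurable_funM; first by apply: measurableT_comp => //; exact: measurable_snd.
  apply: (@measurable_ltb _ _ (fun z : measurableTypeR R * T => N z.2) (fun z => z.1)).
    by apply: measurableT_comp => //; exact: measurable_snd.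
  exact: measurable_fst.
transitivity (\int[mu]_x \int[leb]_s F (s, x)).
  apply: eq_integral => x _; rewrite /F/= EFinM -integral_exp_tail.
  rewrite -ge0_integralZl//.
  - by apply: eq_integral => s _; rewrite -EFinM; congr EFin; rewrite mulrCA.
  - apply/measurable_EFinP; apply: measurable_funM.
      by apply: measurableT_comp.
    by apply: measurable_ltb => //; exact: measurable_cst.
  - by rewrite lee_fin.
rewrite -(@fubini_tonelli _ _ _ _ _ leb mu F mF F0).
apply: eq_integral => s _; rewrite -ge0_integralZl//.
- apply/measurable_EFinP; apply: measurable_funM => //.
  by apply: measurable_ltb => //; exact: measurable_cst.
- by move=> x _; rewrite lee_fin mulr_ge0.
Qed.

End LayerCake.

Section Gamma.
Local Open Scope ereal_scope.
Variable R : realType.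
Local Notation leb := (@lebesgue_measure R).

Lemma integral_power_itv k (s : R) :
  \int[leb]_u (k.+1%:R * (u ^+ k * (0 < u)%R%:R) * (u < s)%R%:R)%:E =
  (s ^+ k.+1 * (0 < s)%R%:R)%:E.
Proof.
transitivity (\int[leb]_(u in `]0%R, s[) (k.+1%:R * u ^+ k)%:E).
  rewrite [RHS]integral_mkcond; apply: eq_integral => u _.
  rewrite patchE; case: ifPn; rewrite ?inE/= ?notin_setE/= in_itv/=.
    by move=> /andP[-> ->]; rewrite !mulr1.
  by move=> /negP; rewrite negb_and => /orP[] /negbTE ->; rewrite ?mulr0 ?mul0r ?mulr0.
have [s0|s0] := ltP 0%R s; last first.
  by rewrite set_itv_ge ?integral_set0 ?mulr0// bnd_simp -leNgt.
rewrite mulr1.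
have mf (D : set R) : measurable_fun D (fun u => (k.+1%:R * u ^+ k)%:E).
  apply/measurable_EFinP/measurable_funTS; apply: measurable_funM => //.
rewrite integral_itv_bndo_bndc; last exact: mf.
rewrite integral_itv_obnd_cbnd; last exact: mf.
rewrite (@continuous_FTC2 _ _ (fun u => u ^+ k.+1)%R)//.
- by rewrite expr0n/= sube0.
- apply: continuous_subspaceT => u; apply: cvgM; [exact: cvg_cst|exact: exprn_continuous].
- split.
  + by move=> u _; exact: exprn_derivable.
  + by apply: cvg_at_right_filter; exact: exprn_continuous.
  + by apply: cvg_at_left_filter; exact: exprn_continuous.
- by move=> u _; rewrite derive1E exp_derive /GRing.scale/= mulr1.
Qed.

Lemma measurable_pos_power k :
  measurable_fun setT (fun u : R => u ^+ k * (0 < u)%R%:R)%R.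
Proof.
apply: measurable_funM; first exact: measurable_funX.
by apply: (@measurable_ltb _ _ _ (fun=> 0%R) id).
Qed.

Lemma pos_power_ge0 k (u : R) : (0 <= u ^+ k * (0 < u)%R%:R)%R.
Proof.
by case: ltP => [u0|_]; rewrite ?mulr0// mulr1 exprn_ge0// ltW.
Qed.

(** The layer cake formula for the weight [(k + 1) u^k] on [u > 0] and [N u = u] replaces
    integration by parts: the inner integral is [s^(k + 1)]. *)
Lemma integral_gamma k :
  \int[leb]_s (expR (- s) * (s ^+ k * (0 < s)%R%:R))%:E = (k`!%:R)%:E.
Proof.
elim: k => [|k IH].
  rewrite fact0 -[in RHS]expR0 -[in RHS]oppr0 -integral_exp_tail.
  by apply: eq_integral => s _; rewrite expr0 mul1r.
have := @layer_cake _ _ R leb (fun u => k.+1%:R * (u ^+ k * (0 < u)%R%:R))%R id.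
rewrite /= => H.
transitivity (\int[leb]_s ((expR (- s))%:E * \int[leb]_u
    (k.+1%:R * (u ^+ k * (0 < u)%R%:R) * (u < s)%R%:R)%:E)).
  by apply: eq_integral => s _; rewrite integral_power_itv -EFinM.
rewrite -H//.
- rewrite factS natrM EFinM -IH -ge0_integralZl//.
  + by apply: eq_integral => s _; rewrite -EFinM; congr EFin; ring.
  + apply/measurable_EFinP; apply: measurable_funM; last exact: measurable_pos_power.
    by apply: measurableT_comp.
  + by move=> s _; rewrite lee_fin mulr_ge0 ?expR_ge0// pos_power_ge0.
- by apply: measurable_funM => //; exact: measurable_pos_power.
- by move=> u; rewrite mulr_ge0// pos_power_ge0.
Qed.

(* Evaluating the integral of [exp (- N)] in a second way yields the volume [V]
   of the unit ball of [N]. *)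
Lemma integral_exp_homogeneous d (T : measurableType d)
    (mu : {sigma_finite_measure set T -> \bar R}) (N : T -> R) k (V : \bar R) :
  measurable_fun setT N -> (forall x, 0 <= N x)%R -> 0 <= V ->
  (forall s, (0 < s)%R -> mu [set x | (N x < s)%R] = (s ^+ k)%:E * V) ->
  \int[mu]_x (expR (- N x))%:E = (k`!%:R)%:E * V.
Proof.
move=> mN N0 V0 hV.
have := @layer_cake _ _ R mu (fun=> 1%R) N (measurable_cst _) mN (fun=> ler01).
under eq_integral do rewrite mul1r.
move=> ->; rewrite -integral_gamma -ge0_integralZr//; first last.
- by move=> s _; rewrite lee_fin mulr_ge0 ?expR_ge0// pos_power_ge0.
- apply/measurable_EFinP; apply: measurable_funM; last exact: measurable_pos_power.
  by apply: measurableT_comp.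
apply: eq_integral => s _; rewrite [in RHS]EFinM -muleA; congr (_ * _).
have -> : \int[mu]_x (1 * (N x < s)%R%:R)%:E = mu [set x | (N x < s)%R].
  rewrite -[RHS]mul1e -(@integral_cst _ _ _ mu) //; last first.
    rewrite -[X in measurable X]setTI.
    by have /(_ measurableT [set true]) := measurable_fun_ltr mN (measurable_cst s); exact.
  rewrite [RHS]integral_mkcond; apply: eq_integral => x _.
  rewrite patchE mul1r; case: ifPn; rewrite ?inE/= ?notin_setE/=.
    by move=> ->.
  by move=> /negP/negbTE ->.
have [s0|s0] := ltP 0%R s; first by rewrite mulr1 hV.
rewrite mulr0 mul0e (_ : mkset _ = set0) ?measure0//.
by apply/seteqP; split => // x /=; rewrite ltNge (le_trans s0).
Qed.

End Gamma.

Section PowerIntegral.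
Local Open Scope ereal_scope.
Context d (T : measurableType d) (R : realType).
Variable mu : {sigma_finite_measure set T -> \bar R}.

Lemma integral_power_measure_prod (h : T -> R) (c : R) n :
  measurable_fun setT h -> (forall x, 0 <= h x)%R ->
  \int[mu]_x (h x)%:E = c%:E ->
  \int[power_measure mu n]_t (\prod_(i < n) h (tnth t i))%:E = (c ^+ n)%:E.
Proof.
move=> mh h0 hc.
have mp m : measurable_fun setT (fun t : m.-tuple T => \prod_(i < m) h (tnth t i))%R.
  apply: measurable_prod => i _; apply: measurableT_comp => //; exact: measurable_tnth.
have p0 m (t : m.-tuple T) : (0 <= \prod_(i < m) h (tnth t i))%R.
  by apply: prodr_ge0 => i _.
elim: n => [|n IH].
  rewrite /= integral_dirac//; first by rewrite diracT mul1e big_ord0.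
  by apply/measurable_EFinP; exact: mp.
rewrite /= integral_cons_measure;
  [|by apply/measurable_EFinP; exact: mp|by move=> t; rewrite lee_fin p0].
rewrite integral_prod_measure; last 2 first.
- apply: (@measurableT_comp _ _ _ _ _ _ (fun t : n.+1.-tuple T =>
    (\prod_(i < n.+1) h (tnth t i))%:E)); last exact: measurable_tcons.
  by apply/measurable_EFinP; exact: mp.
- by move=> z; rewrite lee_fin p0.
transitivity (\int[mu]_x ((h x)%:E * (c ^+ n)%:E)).
  apply: eq_integral => x _; rewrite -IH -ge0_integralZl//.
  - apply: eq_integral => t _; rewrite big_ord_recl -EFinM; congr EFin; congr (_ * _)%R.
    by apply: eq_bigr => i _; rewrite tnthS.
  - by apply/measurable_EFinP; exact: mp.
  - by move=> t _; rewrite lee_fin p0.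
  - by rewrite lee_fin.
rewrite ge0_integralZr//.
- by rewrite hc -EFinM exprS.
- exact/measurable_EFinP.
- by move=> x _; rewrite lee_fin.
- by rewrite lee_fin exprn_ge0// -lee_fin -hc; apply: integral_ge0 => x _; rewrite lee_fin.
Qed.

End PowerIntegral.

(** * Volumes of the disc and of the cross-polytope *)

Section Volumes.
Local Open Scope ereal_scope.
Variable R : realType.
Local Notation C := (Cplx R).
Local Notation R2 := (measurableTypeR R * measurableTypeR R)%type.

Lemma scales_measure_preimage d (T : measurableType d)
    (mu : {measure set T -> \bar R}) Phi k B :
  scales_measure mu Phi k -> measurable B -> mu B = k%:E * mu (Phi @^-1` B).
Proof.
move=> [k0 mPhi hPhi] mB.
have mB' : measurable (Phi @^-1` B) by rewrite -[X in measurable X]setTI; exact: mPhi.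
rewrite -[in LHS](setIT B) -integral_indic//.
rewrite -[in RHS](setIT (Phi @^-1` B)) -integral_indic//.
rewrite (hPhi (fun x => (\1_B x)%:E)).
- by congr (_ * _); apply: eq_integral => x _; rewrite !indicE.
- by apply/measurable_EFinP; exact: measurable_indic.
- by move=> x; rewrite lee_fin.
Qed.

Lemma measurable_cmod_plane : measurable_fun setT (fun p : R2 => cmod (to_cplx p)).
Proof. by apply: measurable_cmod; exact: cmeasurable_to_cplx. Qed.

Lemma measurable_ltc d (T : measurableType d) (N : T -> R) (s : R) :
  measurable_fun setT N -> measurable [set x | (N x < s)%R].
Proof.
move=> mN; rewrite -[X in measurable X]setTI.
by have /(_ measurableT [set true]) := measurable_fun_ltr mN (measurable_cst s); exact.
Qed.

Lemma disc_homogeneous (s : R) : (0 < s)%R ->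
  lebesgue2 [set p : R2 | (cmod (to_cplx p) < s)%R] =
  (s ^+ 2)%:E * lebesgue2 [set p : R2 | (cmod (to_cplx p) < 1)%R].
Proof.
move=> s0.
have n0 : toC s != 0%R by rewrite -cmod_gt0 cmod_toC normr_gt0 gt_eqF.
rewrite (scales_measure_preimage (scales_cplx_affine 0 n0)); last first.
  exact: measurable_ltc measurable_cmod_plane.
rewrite cmod_toC gtr0_norm//; congr (_ * lebesgue2 _).
have E p : (cmod (to_cplx (of_cplx (toC s * to_cplx p + 0))) < s)%R =
    (cmod (to_cplx p) < 1)%R.
  rewrite addr0 of_cplxK cmodM cmod_toC gtr0_norm//.
  by rewrite -[X in (_ < X)%R]mulr1 ltr_pM2l.
apply/seteqP; split => p h; first by rewrite /mkset/= -E; exact: h.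
by have : (cmod (to_cplx p) < 1)%R := h; rewrite -E; exact.
Qed.

(** For [N = |p|^2] the sublevel sets scale with exponent 1, so the area equals the integral of
    [e^(- |p|^2)], a product of two Gaussian integrals. *)
Lemma disc_area : lebesgue2 [set p : R2 | (cmod (to_cplx p) < 1)%R] = pi%:E.
Proof.
set A := lebesgue2 _.
have := @integral_exp_homogeneous R _ R2 (@lebesgue2 R)
  (fun p => cmod (to_cplx p) ^+ 2)%R 1 A _ (fun=> sqr_ge0 _) (measure_ge0 _ _) _.
rewrite (_ : (1`!)%N = 1%N)// mul1e => <-.
- rewrite integral_prod_measure.
  + transitivity (\int[@lebesgue_measure R]_x ((gauss_fun x)%:E * (Num.sqrt pi)%:E)).
      apply: eq_integral => x _; rewrite -integralT_gauss -ge0_integralZl//.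
      * apply: eq_integral => y _; rewrite cmod_sqr /= opprD expRD EFinM//.
      * by apply/measurable_EFinP; exact: measurable_gauss_fun.
      * by move=> y _; rewrite lee_fin gauss_fun_ge0.
      * by rewrite lee_fin gauss_fun_ge0.
    rewrite ge0_integralZr//.
    * by rewrite integralT_gauss -EFinM -expr2 sqr_sqrtr// pi_ge0.
    * by apply/measurable_EFinP; exact: measurable_gauss_fun.
    * by move=> y _; rewrite lee_fin gauss_fun_ge0.
  + apply/measurable_EFinP; apply: measurableT_comp => //.
    apply: measurableT_comp => //.
    by apply: measurable_funX; exact: measurable_cmod_plane.
  + by move=> p; rewrite lee_fin expR_ge0.
- by apply: measurable_funX; exact: measurable_cmod_plane.
- move=> s s0; rewrite expr1 -[s in RHS]sqr_sqrtr ?ltW// -disc_homogeneous ?sqrtr_gt0//.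
  have E p : (cmod (to_cplx p) ^+ 2 < s)%R = (cmod (to_cplx p) < Num.sqrt s)%R.
    rewrite -[in LHS](sqr_sqrtr (ltW s0)) ltr_pXn2r// ?nnegrE ?cmod_ge0 ?sqrtr_ge0//.
  by congr (lebesgue2 _); apply/seteqP; split => p /=; rewrite E.
Qed.

Lemma integral_exp_cmod :
  \int[@lebesgue2 R]_p (expR (- cmod (to_cplx p)))%:E = (2 * pi)%:E.
Proof.
rewrite (@integral_exp_homogeneous R _ R2 (@lebesgue2 R)
  (fun p => cmod (to_cplx p))%R 2 pi%:E).
- by rewrite -EFinM.
- exact: measurable_cmod_plane.
- by move=> p; exact: cmod_ge0.
- by rewrite lee_fin pi_ge0.
- by move=> s s0; rewrite disc_homogeneous// disc_area.
Qed.

Variable n : nat.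
Local Notation Tn := (n.-tuple R2).

Definition cross_body (s : R) : set Tn := [set t | (l1norm (of_coords t) < s)%R].

Lemma measurable_l1norm : measurable_fun setT (fun t : Tn => l1norm (of_coords t)).
Proof.
apply: measurable_sum => i; apply: measurable_cmod.
exact: cmeasurable_of_coords.
Qed.

Lemma measurable_cross_body s : measurable (cross_body s).
Proof. exact: measurable_ltc measurable_l1norm. Qed.

(** The integral of [e^(- |x_1| - ... - |x_n|)] is the [n]-th power of the planar integral [2 pi],
    and by homogeneity of degree [2 n] it is also [(2 n)!] times the volume. *)
Lemma cross_body_volume :
  lebesgue2n n (cross_body 1) = ((2 * pi) ^+ n / (2 * n)`!%:R)%:E.
Proof.
set V := lebesgue2n n _.
have V0 : 0 <= V by exact: measure_ge0.
have := @integral_exp_homogeneous R _ _ (lebesgue2n n)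
  (fun t => l1norm (of_coords t)) (2 * n)%N V measurable_l1norm _ V0 _.
rewrite (_ : \int[_]_x _ = ((2 * pi) ^+ n)%:E); last first.
  rewrite -(@integral_power_measure_prod _ _ R (@lebesgue2 R)
    (fun p => expR (- cmod (to_cplx p))) (2 * pi) n _ _ integral_exp_cmod)//.
  - apply: eq_integral => t _; congr EFin; rewrite /l1norm -sumrN expR_sum.
    by apply: eq_bigr => i _; rewrite mxE.
  - apply: measurableT_comp => //; apply: measurableT_comp => //.
    exact: measurable_cmod_plane.
have f0 : (0 < (2 * n)`!%:R :> R)%R by rewrite ltr0n fact_gt0.
move=> H.
have {}H : ((2 * pi) ^+ n)%:E = ((2 * n)`!%:R)%:E * V.
  apply: H => [t|s s0]; first by rewrite sumr_ge0// => i _; exact: cmod_ge0.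
  have sE : \det ((toC s)%:M : 'M[C]_n) = (toC s ^+ n)%R by rewrite det_scalar.
  have n0 : \det ((toC s)%:M : 'M[C]_n) != 0%R.
    by rewrite sE expf_neq0// -cmod_gt0 cmod_toC normr_gt0 gt_eqF.
  rewrite -/(cross_body s).
  rewrite (scales_measure_preimage (scales_linear n0) (measurable_cross_body s)).
  rewrite sE cmodX cmod_toC gtr0_norm// -exprM mulnC; congr (_ * lebesgue2n n _).
  have E t : (l1norm (of_coords (affine_coords (toC s)%:M 0 t)) < s)%R =
      (l1norm (of_coords t) < 1)%R.
    rewrite /affine_coords to_coordsK addr0 mul_mx_scalar.
    rewrite (_ : l1norm _ = s * l1norm (of_coords t))%R.
      by rewrite -[X in (_ < X)%R]mulr1 ltr_pM2l.
    rewrite /l1norm mulr_sumr; apply: eq_bigr => i _.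
    by rewrite mxE cmodM cmod_toC gtr0_norm.
  apply/seteqP; split => t h; first by rewrite /cross_body /mkset -E; exact: h.
  by have : (l1norm (of_coords t) < 1)%R := h; rewrite -E; exact.
(* The volume is a priori an extended real; finiteness comes from the identity itself. *)
move: H V0; case: V => [v| |] //.
  rewrite -EFinM => -[H] _; congr EFin; rewrite H.
  by rewrite mulrAC divff ?mul1r// gt_eqF.
by rewrite gt0_muley// lte_fin.
Qed.

End Volumes.

(** * Bounds for the Bergman kernel *)

Section BergmanUpper.
Variables (R : realType) (n : nat).
Local Notation C := (Cplx R).
Local Notation Cn := 'rV[C]_n.
Local Notation R2 := (measurableTypeR R * measurableTypeR R)%type.
Local Notation Tn := (n.-tuple R2).

Lemma is_derive_line (W : normedModType C) (f : Cn -> W) (a v : Cn) (l : C) :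
  differentiable f (a + l *: v) ->
  is_derive l 1 (fun l => f (a + l *: v)) ('D_v f (a + l *: v)).
Proof.
move=> df.
have E : (fun h : C => h^-1 *: (((fun l => f (a + l *: v)) \o shift l) (h *: 1) -
      f (a + l *: v))) =
    (fun h => h^-1 *: ((f \o shift (a + l *: v)) (h *: v) - f (a + l *: v))).
  apply/funext => h /=; congr (_ *: (f _ - _)).
  have -> : h *: (1 : C) = h by rewrite /GRing.scale/= mulr1.
  by rewrite scalerDl addrCA.
have dv : derivable f (a + l *: v) v by exact: diff_derivable.
by split; [rewrite /derivable E|rewrite /derive E].
Qed.

Lemma l1normZ (c : C) (x : Cn) : l1norm (c *: x) = cmod c * l1norm x.
Proof. by rewrite /l1norm mulr_sumr; apply: eq_bigr => i _; rewrite mxE cmodM. Qed.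

Lemma l1norm_ge0 (x : Cn) : 0 <= l1norm x.
Proof. by rewrite sumr_ge0// => i _; exact: cmod_ge0. Qed.

Lemma cross_body_sub_mean (f : Cn -> C) (z x : Cn) (P : 'M[C]_n) :
  l1norm x < 1 -> (forall y, l1norm y < 1 -> differentiable f (z + y *m P)) ->
  ((2 * pi * cmod (f z) ^+ 2)%:E <= \int[@lebesgue_measure R]_(t in `[0%R, (2 * pi)%R])
    (cmod (f (z + (cexp 0 t *: x) *m P)) ^+ 2)%:E)%E.
Proof.
move=> x1 df; have l0 := l1norm_ge0 x.
pose g (l : C) := f (z + l *: (x *m P)).
(* Chosen so that [r0 > 1] and [r0 * l1norm x < 1]: the disc of multiples of [x] on which [f] is
   holomorphic strictly contains the closed unit disc. *)
pose r0 := 2 / (1 + l1norm x).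
have l1 : 0 < 1 + l1norm x by lra.
have r01 : 1 < r0 by rewrite ltr_pdivlMr//; lra.
have dg l : cmod l < r0 -> exists l', is_cderiv g l l'.
  move=> lr; eexists; apply: is_derive_cderiv; apply: is_derive_line.
  rewrite scalemxAl; apply: df; rewrite l1normZ.
  have [->|lx0] := eqVneq (l1norm x) 0; first by rewrite mulr0.
  apply: (@lt_trans _ _ (r0 * l1norm x)); first by rewrite ltr_pM2r// lt0r lx0.
  by rewrite /r0 mulrAC ltr_pdivrMr//; lra.
have [ct le] := sub_mean_value r01 dg.
have fn : (\int[@lebesgue_measure R]_(t in `[0%R, (2 * pi)%R])
    (cmod (g (cexp 0 t)) ^+ 2)%:E)%E \is a fin_num.
  exact: integrable_fin_num (cts_on_integrable ct).
apply: (@le_trans _ _ (segint (fun t => cmod (g (cexp 0 t)) ^+ 2) 0 (2 * pi))%:E).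
  by rewrite lee_fin; move: le; rewrite {1}/g scale0r addr0.
rewrite /segint /Rintegral fineK// le_eqVlt; apply/orP; left; apply/eqP.
by apply: eq_integral => t _; rewrite /g scalemxAl.
Qed.

(* Average over the rotations [x |-> e^(i s) x], which preserve both the
   cross-polytope and the measure. *)
Lemma integral_cross_body_ge (G : Tn -> \bar R) (c : R) : 0 <= c ->
  measurable_fun setT G -> (forall t, 0 <= G t)%E ->
  (forall t, cross_body 1 t -> ((2 * pi * c)%:E <=
     \int[@lebesgue_measure R]_(s in `[0%R, (2 * pi)%R])
       G (affine_coords (cexp 0 s)%:M 0 t))%E) ->
  (c%:E * lebesgue2n n (cross_body 1) <= \int[lebesgue2n n]_t G t)%E.
Proof.
move=> c0 mG G0 hG.
have p0 : (0 : R) < 2 * pi by rewrite mulr_gt0// pi_gt0.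
pose K (z : measurableTypeR R * Tn) : \bar R :=
  (G (affine_coords (cexp 0 z.1)%:M 0 z.2) * (\1_`[0%R, (2 * pi)%R] z.1)%:E)%E.
have K0 z : (0 <= K z)%E by rewrite mule_ge0// lee_fin.
have mrot : measurable_fun setT (fun z : measurableTypeR R * Tn =>
    affine_coords (cexp 0 z.1)%:M 0 z.2).
  rewrite /affine_coords; apply: measurable_to_coords => i.
  under eq_fun do rewrite addr0 mul_mx_scalar mxE.
  apply: cmeasurableM.
    split; rewrite /comp /=.
      apply: measurable_funM => //; apply: measurableT_comp; last exact: measurable_fst.
      by apply: continuous_measurable_fun; exact: continuous_cos.
    apply: measurable_funM => //; apply: measurableT_comp; last exact: measurable_fst.
    by apply: continuous_measurable_fun; exact: continuous_sin.
  by apply: cmeasurable_of_coords; exact: measurable_snd.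
have mK : measurable_fun setT K.
  apply: emeasurable_funM; first exact: measurableT_comp mG mrot.
  apply/measurable_EFinP; apply: measurableT_comp; last exact: measurable_fst.
  by apply: measurable_indic; exact: measurable_itv.
have rot s : (\int[lebesgue2n n]_t G t)%E =
    (\int[lebesgue2n n]_t G (affine_coords (cexp 0 s)%:M 0 t))%E.
  have d1 : cmod (\det ((cexp 0 s)%:M : 'M[C]_n)) = 1.
    by rewrite det_scalar cmodX cmod_cexp expR0 expr1n.
  have d0 : \det ((cexp 0 s)%:M : 'M[C]_n) != 0 by rewrite -cmod_gt0 d1.
  by have [_ _ /(_ G mG G0) ->] := scales_linear d0; rewrite d1 expr1n mul1e.
have E1 : (\int[@lebesgue_measure R]_s \int[lebesgue2n n]_t K (s, t) =
    (2 * pi)%:E * \int[lebesgue2n n]_t G t)%E.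
  transitivity (\int[@lebesgue_measure R]_(s in `[0%R, (2 * pi)%R])
      (cst (\int[lebesgue2n n]_t G t) s))%E; last first.
    rewrite integral_cst//= muleC; congr (_ * _)%E.
    have := @lebesgue_measure_itv R `[0%R, (2 * pi)%R] => /= ->.
    by rewrite lte_fin p0 sube0.
  rewrite [RHS]integral_mkcond; apply: eq_integral => s _.
  rewrite patchE /K /=; case: ifPn => sI.
    by rewrite indicE sI (rot s); apply: eq_integral => t _; rewrite mule1.
  rewrite indicE (negbTE sI).
  by rewrite (eq_integral (cst 0%E)) ?integral0// => t _; rewrite mule0.
have p0E : (0 < (2 * pi : R)%:E)%E by rewrite lte_fin.
rewrite -(@lee_pmul2l _ (2 * pi)%:E)// -E1.
rewrite (@fubini_tonelli _ _ _ _ _ (@lebesgue_measure R) (lebesgue2n n) K mK K0).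
rewrite muleA -EFinM -integral_cst; last exact: measurable_cross_body.
rewrite integral_mkcond; apply: ge0_le_integral => //.
- move=> t _; rewrite patchE; case: ifP => // _.
  by rewrite /= lee_fin mulr_ge0// ltW.
- apply/(measurable_restrictT _ (measurable_cross_body 1)).
  exact: measurable_cst.
- exact: (measurable_fun_fubini_tonelli_G _ mK).
- move=> t _; rewrite patchE; case: ifPn; last by move=> _; exact: integral_ge0.
  rewrite inE => /hG h; apply: (le_trans h).
  rewrite integral_mkcond le_eqVlt; apply/orP; left; apply/eqP.
  apply: eq_integral => s _; rewrite patchE /K/= indicE.
  by case: ifPn => _; rewrite ?mule1 ?mule0.
Qed.

Lemma bergman_diag_le (D : set Cn) (z : Cn) (P : 'M[C]_n) : open D ->
  \det P != 0 -> (forall x, l1norm x < 1 -> D (z + x *m P)) ->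
  (bergman_diag D z <=
   ((2 * n)`!%:R / ((2 * pi) ^+ n * cmod (\det P) ^+ 2))%:E)%E.
Proof.
move=> oD dP hP; apply: ge_ereal_sup => _ [f [[hf _] fle] <-].
have mD : measurable (@of_coords R n @^-1` D) by exact: open_coords_measurable.
pose h := (fun t => (cmod (f (of_coords t)) ^+ 2)%:E) \_ (@of_coords R n @^-1` D).
have mh : measurable_fun setT h.
  apply/(measurable_restrictT _ mD); apply: measurable_cmod_sqr_coords => // w Dw.
  by apply: differentiable_continuous; exact: hf.
have h0 t : (0 <= h t)%E.
  by rewrite /h patchE; case: ifP => // _; rewrite lee_fin sqr_ge0.
have nh : bergman_normsq D f = (\int[lebesgue2n n]_t h t)%E.
  by rewrite /bergman_normsq /integral_Cn integral_mkcond.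
pose Phi := @affine_coords R n P z.
have [k0 mPhi hPhi] : scales_measure (lebesgue2n n) Phi (cmod (\det P) ^+ 2).
  have := scales_measure_comp (scales_translation z) (scales_linear dP).
  by rewrite mul1r -affine_coords_comp mulmx1.
pose E := @cross_body R n 1.
have mE : measurable E by exact: measurable_cross_body.
pose G := (h \o Phi) \_ E.
have mG : measurable_fun setT G.
  apply/(measurable_restrictT _ mE); apply: measurable_funTS.
  exact: measurableT_comp mh mPhi.
have G0 t : (0 <= G t)%E by rewrite /G patchE; case: ifP => // _; exact: h0.
have GE t : E t -> G t = (cmod (f (z + of_coords t *m P)) ^+ 2)%:E.
  move=> Et.
  have o : of_coords (Phi t) = z + of_coords t *m P.
    by rewrite /Phi /affine_coords to_coordsK addrC.
  have DPhi : (@of_coords R n @^-1` D) (Phi t) by rewrite /preimage /mkset o; exact: hP.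
  by rewrite /G patchE (mem_set Et) /comp /h patchE (mem_set DPhi) o.
have c0 : 0 <= cmod (f z) ^+ 2 by rewrite sqr_ge0.
have := integral_cross_body_ge c0 mG G0.
have hE t : cross_body 1 t -> ((2 * pi * cmod (f z) ^+ 2)%:E <=
     \int[@lebesgue_measure R]_(s in `[0%R, (2 * pi)%R])
       G (affine_coords (cexp 0 s)%:M 0 t))%E.
  move=> Et; apply: (le_trans (cross_body_sub_mean Et _)).
    by move=> y y1; apply: hf; exact: hP.
  rewrite le_eqVlt; apply/orP; left; apply/eqP; apply: eq_integral => s _.
  have oE : of_coords (affine_coords (cexp 0 s)%:M 0 t) = cexp 0 s *: of_coords t.
    by rewrite to_coordsK addr0 mul_mx_scalar.
  have ET : E (affine_coords (cexp 0 s)%:M 0 t).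
    by rewrite /E /cross_body /mkset oE l1normZ cmod_cexp expR0 mul1r.
  by rewrite (GE _ ET) oE.
move=> /(_ hE) {hE}; rewrite cross_body_volume -EFinM => H.
have {}H : ((cmod (\det P) ^+ 2)%:E *
    (cmod (f z) ^+ 2 * ((2 * pi) ^+ n / (2 * n)`!%:R))%:E <= 1)%E.
  apply: le_trans fle; rewrite nh hPhi//; apply: lee_pmul.
  - by rewrite lee_fin.
  - rewrite lee_fin mulr_ge0// divr_ge0// exprn_ge0// mulr_ge0// pi_ge0//.
  - by [].
  apply: (le_trans H); apply: ge0_le_integral => //.
  - exact: measurableT_comp mh mPhi.
  - by move=> t _; rewrite /G patchE; case: ifP => //= _.
have f0 : 0 < (2 * n)`!%:R :> R by rewrite ltr0n fact_gt0.
have d0 : 0 < cmod (\det P) ^+ 2 by rewrite exprn_gt0// cmod_gt0.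
have p0 : 0 < (2 * pi : R) ^+ n by rewrite exprn_gt0// mulr_gt0// pi_gt0.
rewrite lee_fin ler_pdivlMr ?(mulr_gt0 p0 d0)//.
move: H; rewrite -EFinM lee_fin !mulrA ler_pdivrMr// mul1r.
by congr (_ <= _); ring.
Qed.

End BergmanUpper.

(** * A square integrable function on a half-plane *)

Section HalfPlaneIntegral.
Variable R : realType.
Local Notation leb := (@lebesgue_measure R).
Local Notation R2 := (measurableTypeR R * measurableTypeR R)%type.

Definition sqr_lorentz (v : R) : R := (1 + v ^+ 2)^-1 ^+ 2.

Lemma oneDsqr_pos (v : R) : 0 < 1 + v ^+ 2.
Proof. by have := sqr_ge0 v; lra. Qed.

Lemma continuous_lorentz : continuous (fun v : R => (1 + v ^+ 2)^-1).
Proof.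
move=> v; apply: cvgV; first by rewrite gt_eqF// oneDsqr_pos.
by apply: cvgD; [exact: cvg_cst|exact: exprn_continuous].
Qed.

Lemma continuous_sqr_lorentz : continuous sqr_lorentz.
Proof. by move=> v; apply: cvgM; exact: continuous_lorentz. Qed.

Lemma sqr_lorentz_ge0 v : 0 <= sqr_lorentz v.
Proof. exact: sqr_ge0. Qed.

Lemma measurable_sqr_lorentz : measurable_fun setT sqr_lorentz.
Proof. exact: continuous_measurable_fun continuous_sqr_lorentz. Qed.

Lemma integral_sqr_lorentz : (\int[leb]_v (sqr_lorentz v)%:E = (pi / 2)%:E)%E.
Proof.
rewrite ge0_symfun_integralT.
- rewrite (_ : [set x | _] = `[0, +oo[%classic); last first.
    by apply/seteqP; split => x/=; rewrite in_itv/= andbT.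
  pose F (v : R) := (v * (1 + v ^+ 2)^-1 + atan v) / 2.
  have dF (v : R) : is_derive v 1 F (sqr_lorentz v).
    have d1 : is_derive v 1 (fun w : R => (1 + w ^+ 2)^-1)
        (- (1 + v ^+ 2) ^- 2 * (2 * v)).
      have dk : is_derive v 1 (fun w : R => 1 + w ^+ 2) (2 * v).
        by apply: is_derive_eq; rewrite /GRing.scale/=; ring.
      split; first by apply: derivableV; [rewrite gt_eqF// oneDsqr_pos|case: dk].
      by rewrite deriveV ?gt_eqF ?oneDsqr_pos//; case: dk => // _ ->.
    rewrite /F; apply: is_derive_eq; rewrite /sqr_lorentz /GRing.scale/=.
    by field; rewrite gt_eqF// oneDsqr_pos.
  have cF : continuous F.
    by move=> v; apply/differentiable_continuous/derivable1_diffP; case: (dF v).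
  rewrite (@ge0_continuous_FTC2y _ _ F 0 (pi / 2 / 2)).
  + rewrite {1}/F mul0r atan0 addr0 mul0r sube0; congr EFin; by field.
  + by move=> v _; exact: sqr_lorentz_ge0.
  + exact: continuous_subspaceT continuous_sqr_lorentz.
  + apply: cvgM; last exact: cvg_cst.
    rewrite -[pi / 2]add0r; apply: cvgD; last exact: cvgy_atan.
    apply/cvgrPdist_le => e e0; near=> v.
    have v1 : 1 <= v by near: v; exact: nbhs_pinfty_ge.
    have ve : e^-1 <= v by near: v; apply: nbhs_pinfty_ge; exact: num_real.
    have v0 : 0 < v by lra.
    rewrite sub0r normrN ger0_norm ?divr_ge0 ?(ltW v0) ?(ltW (oneDsqr_pos _))//.
    rewrite ler_pdivrMr ?oneDsqr_pos//.
    have : 1 <= v * e by rewrite -ler_pdivrMr// mul1r.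
    move=> /(ler_wpM2l (ltW v0)); rewrite mulr1 => h.
    rewrite mulrDr mulr1 expr2 mulrA; lra.
  + by move=> v _; case: (dF v).
  + by apply: cvg_at_right_filter; exact: cF.
  + by move=> v _; rewrite derive1E; case: (dF v).
- exact: sqr_lorentz_ge0.
- exact: continuous_sqr_lorentz.
- by move=> v; rewrite /sqr_lorentz /= sqrrN.
Unshelve. all: by end_near. Qed.

Lemma integral_inv_cube : (\int[leb]_(u in `[1%R, +oo[) (u^-1 ^+ 3)%:E = (1 / 2)%:E)%E.
Proof.
pose F (u : R) := - (u^-1 ^+ 2 / 2).
have dF (u : R) : 0 < u -> is_derive u 1 F (u^-1 ^+ 3).
  move=> u0; have un : u != 0 by rewrite gt_eqF.
  have d1 : is_derive u 1 (fun w : R => w^-1) (- u ^- 2).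
    split; first by apply: (derivableV (f := id)).
    by rewrite (deriveV (f := id))// derive_id /GRing.scale/= mulr1.
  rewrite /F; apply: is_derive_eq; rewrite /GRing.scale/=.
  by field.
have cF (u : R) : 0 < u -> {for u, continuous F}.
  by move=> /dF[d _]; apply/differentiable_continuous/derivable1_diffP.
rewrite (@ge0_continuous_FTC2y _ _ F 1 0).
- by rewrite /F invr1 expr1n -EFinB sub0r opprK.
- by move=> u u1; rewrite exprn_ge0// invr_ge0; lra.
- apply: continuous_in_subspaceT => u; rewrite inE/= in_itv/= andbT => u1.
  have un : u != 0 by rewrite gt_eqF//; lra.
  by apply: cvgM; [|apply: cvgM]; apply: cvgV.
- rewrite -oppr0 -[X in - X](mul0r 2^-1); apply: cvgN.
  apply: cvgM; last exact: cvg_cst.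
  rewrite -[0](mul0r 0).
  have h : u^-1 @[u --> +oo] --> (0 : R).
    by apply/gtr0_cvgV0; [near=> u; near: u; exact: nbhs_pinfty_gt|exact: cvg_id].
  exact: (cvgM h h).
- by move=> u u1; case: (dF u _) => //; lra.
- by apply: cvg_at_right_filter; apply: cF.
- move=> u; rewrite in_itv/= andbT => u1; rewrite derive1E; case: (dF u _) => //; lra.
Unshelve. all: by end_near. Qed.

Lemma measurable_inv : measurable_fun setT (fun x : R => x^-1).
Proof.
rewrite -(setUv [set (0 : R)]); apply/measurable_funU => //.
  exact: measurableC.
split; first exact: measurable_fun_set1.
apply: open_continuous_measurable_fun.
  by apply: closed_openC; exact: closed_eq.
by move=> x /set_mem /= /eqP x0; exact: inv_continuous.
Qed.

(** The squared modulus of [(2 - u)^-2] on [Re u <= 1]. Up to a factor [(2 - u)^-2] is the Bergman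
    kernel of that half-plane with pole at 0, the extremal function for the value there. *)
Definition half_plane_density (p : R2) : R :=
  (cmod (2 - to_cplx p))^-1 ^+ 4 * \1_[set q : R2 | q.1 <= 1] p.

Lemma measurable_half_plane_density : measurable_fun setT half_plane_density.
Proof.
apply: measurable_funM.
  apply: measurable_funX; apply: (measurableT_comp measurable_inv).
  apply: measurable_cmod; under eq_fun do rewrite -mulN1r.
  apply: cmeasurableD; first exact: cmeasurable_cst.
  by apply: cmeasurableM; [exact: cmeasurable_cst|exact: cmeasurable_to_cplx].
apply: measurable_indic.
rewrite (_ : mkset _ = fst @^-1` `]-oo, 1%R]%classic).
  by rewrite -[X in measurable X]setTI; apply: measurable_fst => //; exact: measurable_itv.
by apply/seteqP; split => p /=; rewrite in_itv.
Qed.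

Lemma half_plane_density_ge0 p : 0 <= half_plane_density p.
Proof. by rewrite mulr_ge0// exprn_ge0// invr_ge0 cmod_ge0. Qed.

(** On the vertical line at [x], the substitution [y = (2 - x) v] leaves [(2 - x)^-3] times the
    integral [pi / 2] of [sqr_lorentz]; then [u = 2 - x] runs over [[1, +oo)], where [u^-3] has
    integral [1 / 2]. *)
Lemma integral_half_plane :
  (\int[@lebesgue2 R]_p (half_plane_density p)%:E = (pi / 4)%:E)%E.
Proof.
have mh : measurable_fun setT (fun p => (half_plane_density p)%:E).
  by apply/measurable_EFinP; exact: measurable_half_plane_density.
have h0 p : (0 <= (half_plane_density p)%:E)%E.
  by rewrite lee_fin half_plane_density_ge0.
rewrite integral_prod_measure//.
have hE (x y : R) : half_plane_density (x, y) =
    ((2 - x) ^+ 2 + y ^+ 2)^-1 ^+ 2 * (x <= 1)%R%:R.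
  rewrite /half_plane_density; congr (_ * _).
    rewrite (exprM _ 2 2) exprVn cmod_sqr -toC_nat !cReImE /= sub0r sqrrN //.
  by rewrite indicE; congr ((nat_of_bool _)%:R); apply/idP/idP; rewrite inE.
have inner (x : R) : (\int[leb]_y (half_plane_density (x, y))%:E =
    ((2 - x)^-1 ^+ 3 * (pi / 2) * (x <= 1)%R%:R)%:E)%E.
  have [x1|x1] := leP x 1; last first.
    by rewrite mulr0 (eq_integral (cst 0%E)) ?integral0// => y _;
      rewrite hE leNgt x1 mulr0.
  have u0 : 0 < 2 - x by lra.
  have un : 2 - x != 0 by rewrite gt_eqF.
  have [_ _ ->] := scales_lebesgue_affine 0 un.
  - rewrite mulr1 gtr0_norm// EFinM -integral_sqr_lorentz -ge0_integralZl//; last 2 first.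
    + apply: (measurableT_comp mh); apply/measurable_fun_pairP; split; rewrite /comp/=.
        exact: measurable_cst.
      by apply: measurable_funD => //; apply: measurable_funM.
    + by rewrite lee_fin ltW.
    rewrite -ge0_integralZl//; last 3 first.
    + by apply/measurable_EFinP; exact: measurable_sqr_lorentz.
    + by move=> v _; rewrite lee_fin sqr_lorentz_ge0.
    + by rewrite lee_fin exprn_ge0// invr_ge0 ltW.
    apply: eq_integral => v _; rewrite hE x1 mulr1 addr0 -!EFinM; congr EFin.
    rewrite /sqr_lorentz; field.
    rewrite un /=; apply/andP; split.
      by rewrite gt_eqF// oneDsqr_pos.
    by rewrite gt_eqF// ltr_pwDl ?sqr_ge0// exprn_gt0.
  - apply: (measurableT_comp mh); apply/measurable_fun_pairP; split; rewrite /comp/=.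
      exact: measurable_cst.
    exact: measurable_id.
  - by move=> y; exact: h0.
under eq_integral do rewrite inner.
have m1 : (-1 : R) != 0 by rewrite oppr_eq0 oner_eq0.
have mI : measurable_fun setT (fun x : R => (2 - x)^-1 ^+ 3 * (pi / 2) * (x <= 1)%R%:R).
  apply: measurable_funM.
    apply: measurable_funM => //; apply: measurable_funX.
    by apply: (measurableT_comp measurable_inv); apply: measurable_funB.
  rewrite (_ : (fun x => _) = \1_`]-oo, (1 : R)]); last first.
    apply/funext => x; rewrite indicE; congr ((nat_of_bool _)%:R).
    by apply/idP/idP; rewrite inE/= in_itv.
  by apply: measurable_indic; exact: measurable_itv.
have [_ _ ->] := scales_lebesgue_affine 2 m1; last 2 first.
- exact/measurable_EFinP.
- move=> x; rewrite lee_fin; have [x1|x1] := leP x 1; last by rewrite mulr0.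
  rewrite mulr1 mulr_ge0 ?divr_ge0 ?pi_ge0// exprn_ge0// invr_ge0; lra.
rewrite normrN1 mul1e.
transitivity (\int[leb]_(u in `[1%R, +oo[) ((u^-1 ^+ 3)%:E * (pi / 2)%:E))%E.
  rewrite [RHS]integral_mkcond; apply: eq_integral => u _.
  rewrite patchE (_ : 2 - (-1 * u + 2) = u); last by ring.
  case: ifPn; rewrite ?inE/= ?notin_setE/= in_itv/= andbT.
    by move=> u1; rewrite (_ : -1 * u + 2 <= 1) ?mulr1//; lra.
  move=> /negP; rewrite -ltNge => u1.
  rewrite (_ : (-1 * u + 2 <= 1) = false) ?mulr0//.
  by apply/negbTE; rewrite -ltNge; lra.
rewrite ge0_integralZr//.
- by rewrite integral_inv_cube -EFinM; congr EFin; field.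
- apply/measurable_EFinP; apply: measurable_funTS; apply: measurable_funX.
  exact: measurable_inv.
- by move=> u; rewrite /= in_itv/= andbT => u1; rewrite lee_fin exprn_ge0// invr_ge0; lra.
- by rewrite lee_fin divr_ge0 ?pi_ge0.
Qed.

End HalfPlaneIntegral.

Section BergmanLower.
Variables (R : realType) (n : nat).
Local Notation C := (Cplx R).
Local Notation Cn := 'rV[C]_n.
Local Notation R2 := (measurableTypeR R * measurableTypeR R)%type.
Local Notation Tn := (n.-tuple R2).

Lemma differentiable_linear_form m (L : 'M[C]_(n, m)) (z : Cn) j w :
  differentiable (fun w : Cn => ((w - z) *m L) 0 j : C) w.
Proof.
rewrite (_ : (fun w => _) = \sum_(i < n) (fun w : Cn => (w 0 i - z 0 i) * L i j)).
  apply: differentiable_sum => i; apply: differentiableM; last exact: differentiable_cst.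
  by apply: differentiableB; [exact: differentiable_coord|exact: differentiable_cst].
by apply/funext => u; rewrite fct_sumE mxE; apply: eq_bigr => i _; rewrite !mxE.
Qed.

Lemma differentiable_prod (I : Type) (s : seq I) (F : I -> Cn -> C) w :
  (forall i, differentiable (F i) w) ->
  differentiable (fun u => \prod_(i <- s) F i u) w.
Proof.
move=> dF; elim: s => [|i s IH].
  by under eq_fun do rewrite big_nil; exact: differentiable_cst.
by under eq_fun do rewrite big_cons; exact: differentiableM.
Qed.

Lemma two_sub_neq0 (a : C) : cRe a <= 1 -> 2 - a != 0.
Proof.
move=> a1; apply/eqP => /(congr1 (@cRe R)); rewrite -toC_nat !cReImE ?cRe0; lra.
Qed.

Lemma bergman_diag_ge (D : set Cn) (z : Cn) (L : 'M[C]_n) : open D ->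
  \det L != 0 -> (forall w j, D w -> cRe (((w - z) *m L) 0 j) <= 1) ->
  ((cmod (\det L) ^+ 2 / (4 * pi) ^+ n)%:E <= bergman_diag D z)%E.
Proof.
move=> oD dL hL; have p0 := @pi_gt0 R.
pose om (w : Cn) j : C := ((w - z) *m L) 0 j.
(* Normalizes the product: over the product of half-planes its squared norm is
   [(pi / 4)^n / |det L|^2]. At [z] each factor has squared modulus [1 / 16], which turns [4 / pi]
   into [1 / (4 pi)]. *)
pose k : R := cmod (\det L) * Num.sqrt ((4 / pi) ^+ n).
have k2 : k ^+ 2 = cmod (\det L) ^+ 2 * (4 / pi) ^+ n.
  by rewrite exprMn sqr_sqrtr// exprn_ge0// divr_ge0// ltW.
pose f (w : Cn) : C := toC k * \prod_(j <- index_enum 'I_n) ((2 - om w j)^-1 * (2 - om w j)^-1).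
have fE w : cmod (f w) ^+ 2 = k ^+ 2 * \prod_(j < n) (cmod (2 - om w j))^-1 ^+ 4.
  rewrite /f cmodM cmod_toC exprMn real_normK ?num_real//; congr (_ * _).
  rewrite -[LHS]cmodX -prodrXl.
  elim: (index_enum _) => [|j s IH]; first by rewrite !big_nil cmod1.
  by rewrite !big_cons cmodM IH cmodX cmodM cmodV -expr2 -exprM.
have hf : holomorphic_on D f.
  move=> w Dw; apply: differentiableM; first exact: differentiable_cst.
  apply: differentiable_prod => j.
  have d2 : differentiable (fun u => (2 - om u j)^-1 : C) w.
    apply: differentiableV; last by apply: two_sub_neq0; exact: hL.
    by apply: differentiableB; [exact: differentiable_cst|exact: differentiable_linear_form].
  exact: differentiableM.
have fz : cmod (f z) ^+ 2 = cmod (\det L) ^+ 2 / (4 * pi) ^+ n.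
  rewrite fE k2.
  rewrite (eq_bigr (fun=> (16^-1 : R))); last first.
    move=> j _; rewrite /om subrr mul0mx mxE subr0 -toC_nat cmod_toC ger0_norm//.
    by rewrite exprVn -natrX.
  rewrite prodr_const card_ord -mulrA -exprMn -exprVn; congr (_ * _ ^+ n).
  by have gen (p : R) : 0 < p -> 4 / p / 16 = (4 * p)^-1;
    [move=> pp; field; rewrite gt_eqF|exact: gen].
pose H (t : Tn) := \prod_(j < n) half_plane_density (tnth t j).
have H0 t : 0 <= H t by apply: prodr_ge0 => j _; exact: half_plane_density_ge0.
have mH : measurable_fun setT H.
  apply: measurable_prod => i _.
  apply: (measurableT_comp (@measurable_half_plane_density R)).
  exact: measurable_tnth.
have mHE : measurable_fun setT (fun t => (H t)%:E) by apply/measurable_EFinP.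
have H0E t : (0 <= (H t)%:E)%E by rewrite lee_fin.
have IH : (\int[lebesgue2n n]_t (H t)%:E = ((pi / 4) ^+ n)%:E)%E.
  apply: integral_power_measure_prod.
  - exact: measurable_half_plane_density.
  - exact: half_plane_density_ge0.
  - exact: integral_half_plane.
pose Psi := @affine_coords R n L (- (z *m L)).
have [_ mPsi hPsi] : scales_measure (lebesgue2n n) Psi (cmod (\det L) ^+ 2).
  have := scales_measure_comp (scales_translation (- (z *m L))) (scales_linear dL).
  by rewrite mul1r -affine_coords_comp mulmx1.
have PsiE t j : to_cplx (tnth (Psi t) j) = om (of_coords t) j.
  by rewrite tnth_mktuple of_cplxK -mulmxBl.
have fH t : D (of_coords t) -> cmod (f (of_coords t)) ^+ 2 = k ^+ 2 * H (Psi t).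
  move=> Dt; rewrite fE; congr (_ * _); apply: eq_bigr => j _.
  rewrite /half_plane_density PsiE indicE mem_set ?mulr1//=.
  by rewrite (_ : (tnth (Psi t) j).1 = cRe (to_cplx (tnth (Psi t) j)))// PsiE hL.
have mD := open_coords_measurable oD.
have norm1 : (bergman_normsq D f <= 1)%E.
  have -> : (1 = (k ^+ 2)%:E * \int[lebesgue2n n]_t (H (Psi t))%:E :> \bar R)%E.
    have := hPsi _ mHE H0E; rewrite IH k2 => E.
    rewrite mulrC EFinM -muleA -E -EFinM -exprMn.
    have gen (p : R) : 0 < p -> 4 / p * (p / 4) = 1.
      by move=> pp; field; rewrite gt_eqF.
    by rewrite gen// expr1n.
  rewrite /bergman_normsq /integral_Cn integral_mkcond -ge0_integralZl//.
  - apply: ge0_le_integral => //.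
    + by move=> t _; rewrite patchE; case: ifP => // _; rewrite lee_fin sqr_ge0.
    + apply/(measurable_restrictT _ mD); apply: measurable_cmod_sqr_coords => // w Dw.
      by apply: differentiable_continuous; exact: hf.
    + apply: measurable_funeM; exact: (measurableT_comp mHE mPsi).
    + move=> t _; rewrite patchE; case: ifPn => [|_].
        by rewrite inE => Dt; rewrite fH// EFinM.
      by rewrite mule_ge0// lee_fin ?sqr_ge0.
  - exact: (measurableT_comp mHE mPsi).
  - by rewrite lee_fin sqr_ge0.
rewrite -fz; apply: ereal_sup_ubound; exists f => //; split => //.
by split => //; apply: le_lt_trans norm1 _; rewrite ltry.
Qed.

End BergmanLower.

(** * Bounds for the volume elements *)

Section DetBound.
Variable R : realType.
Local Notation C := (Cplx R).

Lemma cmod_sum (I : Type) (r : seq I) (F : I -> C) :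
  cmod (\sum_(i <- r) F i) <= \sum_(i <- r) cmod (F i).
Proof.
elim: r => [|i r IH]; first by rewrite !big_nil cmod0.
by rewrite !big_cons (le_trans (cmodD _ _))// lerD2l.
Qed.

(** Expansion along the first row; deleting a row and a column does not increase the remaining row
    sums. *)
Lemma cmod_det_le n (A : 'M[C]_n) (s : R) :
  (forall i, \sum_j cmod (A i j) <= s) -> cmod (\det A) <= s ^+ n.
Proof.
elim: n A => [|n IH] A hA; first by rewrite det_mx00 cmod1 expr0.
rewrite (expand_det_row A ord0) (le_trans (cmod_sum _ _))//.
have s0 : 0 <= s.
  by rewrite (le_trans _ (hA ord0))// sumr_ge0// => j _; exact: cmod_ge0.
apply: (@le_trans _ _ (\sum_j cmod (A ord0 j) * s ^+ n)); last first.
  by rewrite -mulr_suml exprS ler_wpM2r// exprn_ge0.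
apply: ler_sum => j _; rewrite cmodM ler_wpM2l ?cmod_ge0//.
rewrite /cofactor cmodM cmodX cmodN cmod1 expr1n mul1r; apply: IH => i.
apply: le_trans (hA (lift ord0 i)).
rewrite (bigD1_ord j)//= ler_wpDl ?cmod_ge0//.
by apply: ler_sum => k _; rewrite !mxE.
Qed.

End DetBound.

Section JacobianEntries.
Variables (R : realType) (n : nat).
Local Notation C := (Cplx R).
Local Notation Cn := 'rV[C]_n.

Lemma is_derive_coord (F : C -> Cn) (l : C) (d : Cn) j :
  is_derive l 1 F d -> is_derive l 1 (fun l => F l 0 j : C) (d 0 j).
Proof.
move=> [dF vF].
have cvF : (fun h : C => h^-1 *: ((F \o shift l) (h *: 1) - F l)) @ 0^' --> d.
  by rewrite -vF; exact: dF.
have cvj : (fun h : C => h^-1 *: (((fun l => F l 0 j : C) \o shift l) (h *: 1)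
    - F l 0 j)) @ 0^' --> (d 0 j : C).
  rewrite (_ : (fun h => _) = (fun M : Cn => M 0 j : C) \o
      (fun h : C => h^-1 *: ((F \o shift l) (h *: 1) - F l))).
    exact: continuous_cvg (@coord_continuous _ _ _ 0 j d) cvF.
  by apply/funext => h /=; rewrite !mxE.
by split; [exact: (cvgP _ cvj)|exact: cvg_lim cvj].
Qed.

Lemma is_derive_jacobian (psi : Cn -> Cn) (a v : Cn) (l : C) j :
  differentiable psi (a + l *: v) ->
  is_derive l 1 (fun l => psi (a + l *: v) 0 j : C)
    ((v *m 'J psi (a + l *: v)) 0 j).
Proof.
move=> dpsi; rewrite -(deriveEjacobian v dpsi).
exact: is_derive_coord (is_derive_line dpsi).
Qed.

End JacobianEntries.

Section VolumeElements.
Variables (R : realType) (n : nat).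
Hypothesis n0 : (0 < n)%N.
Local Notation C := (Cplx R).
Local Notation Cn := 'rV[C]_n.
Implicit Types (D : set Cn) (z w : Cn) (P L : 'M[C]_n).

Lemma l1norm_delta k : l1norm (delta_mx 0 k : Cn) = 1.
Proof.
rewrite /l1norm (bigD1 k)//= mxE !eqxx cmod1 big1 ?addr0// => i ik.
by rewrite mxE eqxx (negbTE ik) cmod0.
Qed.

Lemma unit_ball_coord w i : unit_ball w -> cmod (w 0 i) <= 1.
Proof.
rewrite /unit_ball /mkset => wB; rewrite -(@expr_le1 _ 2) ?cmod_ge0// ltW//.
apply: le_lt_trans wB; rewrite (bigD1 i)//= lerDl.
by apply: sumr_ge0 => j _; rewrite sqr_ge0.
Qed.

(** Each row of [P] spans a unit disc in [D] centred at [z]. The Schwarz lemma for the coordinates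
    of [psi] on it bounds every entry of [P J] by 1, hence every row sum by [n]. *)
Lemma caratheodory_volume_le D z P : \det P != 0 ->
  (forall x, l1norm x < 1 -> D (z + x *m P)) ->
  (caratheodory_volume D z <= (n%:R ^+ (2 * n) / cmod (\det P) ^+ 2)%:E)%E.
Proof.
move=> dP hP; apply: ge_ereal_sup => _ [psi [[hpsi psiB] psi0] <-].
rewrite lee_fin; set J := 'J psi z.
have d0 : 0 < cmod (\det P) ^+ 2 by rewrite exprn_gt0// cmod_gt0.
rewrite ler_pdivlMr// -exprMn -cmodM mulrC -det_mulmx.
have line k (l : C) : cmod l < 1 -> D (z + l *: row k P).
  move=> l1; rewrite rowE scalemxAl; apply: hP.
  by rewrite l1normZ l1norm_delta mulr1.
have entry k j : cmod ((P *m J) k j) <= 1.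
  have e : (P *m J) k j = (row k P *m 'J psi (z + 0 *: row k P)) 0 j.
    by rewrite scale0r addr0 -row_mul [RHS]mxE.
  apply: (@schwarz _ (fun l => psi (z + l *: row k P) 0 j)).
  - move=> l l1; eexists; apply: is_derive_cderiv.
    by apply: is_derive_jacobian; apply: hpsi; exact: line.
  - rewrite e; apply: is_derive_cderiv; apply: is_derive_jacobian.
    by apply: hpsi; apply: line; rewrite cmod0.
  - by rewrite scale0r addr0 psi0 mxE.
  - by move=> l l1; apply: unit_ball_coord; apply: psiB; exact: line.
have /cmod_det_le h k : \sum_j cmod ((P *m J) k j) <= n%:R.
  rewrite -[X in _ <= X%:R](card_ord n) -sum1_card natr_sum.
  by apply: ler_sum => j _.
rewrite mulnC exprM ler_pXn2r ?nnegrE ?cmod_ge0 ?exprn_ge0//.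
Qed.

(** Coordinates in the unit ball have modulus below 1, so the ball shrunk by [1 / n] lies in the
    cross-polytope; the competitor is the affine map with matrix [P / n]. *)
Lemma kobayashi_volume_le D z P : \det P != 0 ->
  (forall x, l1norm x < 1 -> D (z + x *m P)) ->
  (kobayashi_volume D z <= (n%:R ^+ (2 * n) / cmod (\det P) ^+ 2)%:E)%E.
Proof.
move=> dP hP.
have nR : 0 < n%:R :> R by rewrite ltr0n.
pose s : C := toC n%:R^-1.
have sm : cmod s = n%:R^-1 by rewrite cmod_toC ger0_norm// invr_ge0 ltW.
pose psi (x : Cn) : Cn := z + x *m (s *: P).
have lin_diff (A : 'M[C]_n) (x : Cn) : differentiable (fun x : Cn => x *m A) x.
  rewrite (_ : (fun x => _) = \sum_(j < n)
      (fun x : Cn => ((x - 0) *m A) 0 j *: (delta_mx 0 j : Cn))).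
    apply: differentiable_sum => j; apply: differentiableZl.
    exact: differentiable_linear_form.
  apply/funext => u; rewrite fct_sumE subr0; exact: row_sum_delta.
have dpsi x : differentiable psi x.
  by apply: differentiableD; [exact: differentiable_cst|exact: lin_diff].
have Jpsi : 'J psi 0 = s *: P.
  apply/matrixP => k j.
  have h := @is_derive_jacobian _ _ psi 0 (delta_mx 0 k) 0 j (dpsi _).
  have h' : is_derive (0 : C) 1 (fun l => psi (0 + l *: delta_mx 0 k) 0 j : C)
      ((s *: P) k j).
    rewrite (_ : (fun l => _) = (fun l => z 0 j + (s *: P) k j * l)).
      have gen (c : C) : is_derive (0 : C) 1 (fun l : C => z 0 j + c * l) c.
        by apply: is_derive_eq; rewrite /GRing.scale/=; ring.
      exact: gen.
    apply/funext => l; rewrite /psi add0r -scalemxAl -rowE !mxE.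
    by congr (_ + _); rewrite mulrC.
  case: h' => _ <-; case: h => _.
  by rewrite scale0r addr0 -rowE mxE.
have mem : [set psi | holomorphic_maps unit_ball D psi /\ psi 0 = z] psi.
  split; last by rewrite /psi mul0mx addr0.
  split=> [x _|x xB]; first exact: dpsi.
  rewrite /psi -scalemxAr scalemxAl; apply: hP; rewrite l1normZ sm.
  rewrite ltr_pdivrMl// mulr1 /l1norm.
  have : \sum_i (cmod (x 0 i) : R) < \sum_(i < n) 1.
    apply: ltr_sum => [|i _]; first by apply/hasP; exists (Ordinal n0); rewrite ?mem_index_enum.
    rewrite -(@expr_lt1 _ 2) ?cmod_ge0//; apply: le_lt_trans xB.
    by rewrite (bigD1 i)//= lerDl; apply: sumr_ge0 => j _; rewrite sqr_ge0.
  by rewrite sumr_const card_ord.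
apply: (le_trans (ereal_inf_lbound _)); first by exists psi; [exact: mem|].
have p0 : 0 < cmod (\det P) by rewrite cmod_gt0.
rewrite /= Jpsi detZ cmodM cmodX sm exprMn inver gt_eqF; last first.
  by rewrite mulr_gt0 ?exprn_gt0// invr_gt0.
by rewrite lee_fin invfM -exprM -exprVn invrK mulnC.
Qed.

Lemma is_derive_linear_form (F : C -> Cn) (l : C) (d z : Cn) L j :
  is_derive l 1 F d ->
  is_derive l 1 (fun l => ((F l - z) *m L) 0 j : C) ((d *m L) 0 j).
Proof.
move=> dF; rewrite [X in is_derive _ _ _ X]mxE.
rewrite (_ : (fun l => _) = \sum_(i < n) (fun l => (F l 0 i - z 0 i) * L i j)).
  apply: is_derive_sum => i; have di := is_derive_coord i dF.
  by apply: is_derive_eq; rewrite /GRing.scale/=; ring.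
by apply/funext => u; rewrite fct_sumE mxE; apply: eq_bigr => i _; rewrite !mxE.
Qed.

(** With [A = J L], a direction [v] whose coordinates have modulus at most [n^(-1/2)] and phases
    opposite to column [j] of [A] satisfies [(v A)_j = n^(-1/2) sum_k |A_kj|]. The half-plane
    Schwarz lemma on the disc along [v] bounds this by 2, so column sums are at most [2 sqrt n]. *)
Lemma kobayashi_volume_ge D z L :
  (forall w j, D w -> cRe (((w - z) *m L) 0 j) <= 1) ->
  ((cmod (\det L) ^+ 2 / (4 * n%:R) ^+ n)%:E <= kobayashi_volume D z)%E.
Proof.
move=> hL; apply: le_ereal_inf_tmp => _ [psi [[hpsi psiD] psi0] <-].
set J := 'J psi 0.
have nR : 0 < n%:R :> R by rewrite ltr0n.
pose r : R := Num.sqrt n%:R.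
have r0 : 0 < r by rewrite sqrtr_gt0.
have r2 : r ^+ 2 = n%:R by rewrite sqr_sqrtr// ltW.
pose A := J *m L.
have col j : \sum_k cmod (A k j) <= 2 * r.
  (* Where [A k j = 0] the division by zero makes the coordinate 0, which is consistent with the
     formula. *)
  pose v : Cn := \row_k (toC r^-1 * (ccj (A k j) / toC (cmod (A k j)))).
  have vk k : cmod (v 0 k) <= r^-1.
    rewrite mxE !cmodM cmodV cmod_ccj !cmod_toC (ger0_norm (cmod_ge0 _)) ger0_norm.
      rewrite -[X in _ <= X]mulr1 ler_wpM2l ?invr_ge0 ?(ltW r0)//.
      have [->|a0] := eqVneq (cmod (A k j)) 0; first by rewrite mul0r.
      by rewrite divff.
    by rewrite invr_ge0 ltW.
  have vA : (v *m J *m L) 0 j = toC (r^-1 * \sum_k cmod (A k j)).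
    rewrite -mulmxA -/A mxE toCM (big_morph (@toC R) (@toCD R) (toC0 R)) mulr_sumr.
    apply: eq_bigr => k _; rewrite mxE -mulrA; congr (_ * _).
    have [a0|a0] := eqVneq (cmod (A k j)) 0.
      by rewrite a0 invr0 mulr0 mul0r.
    rewrite mulrAC ccjM expr2 toCM mulfK//.
    by apply: contra a0 => /eqP/(congr1 (@cRe R)); rewrite cRe_toC => /eqP.
  have ball (l : C) : cmod l < 1 -> unit_ball (0 + l *: v).
    move=> l1; rewrite /unit_ball /mkset add0r.
    apply: (@le_lt_trans _ _ (\sum_(k < n) cmod l ^+ 2 * (n%:R)^-1)).
      apply: ler_sum => k _; rewrite mxE cmodM exprMn ler_wpM2l ?sqr_ge0//.
      by rewrite -r2 -exprVn lerXn2r ?nnegrE ?cmod_ge0 ?invr_ge0 ?(ltW r0).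
    rewrite sumr_const card_ord -[X in X < _]mulr_natr divfK ?gt_eqF//.
    by rewrite expr_lt1 ?cmod_ge0.
  have b0 : cmod (0 : C) < 1 by rewrite cmod0.
  have dF (l : C) : cmod l < 1 -> is_derive l 1 (fun l => psi (0 + l *: v))
      (v *m 'J psi (0 + l *: v)).
    move=> l1; have dp := hpsi _ (ball l l1).
    by rewrite -(deriveEjacobian v dp); exact: is_derive_line.
  have E0 : 0 + (0 : C) *: v = 0 by rewrite scale0r addr0.
  have := @schwarz_half_plane R (fun l => ((psi (0 + l *: v) - z) *m L) 0 j)
    (toC (r^-1 * \sum_k cmod (A k j))).
  have -> : cmod (toC (r^-1 * \sum_k cmod (A k j))) = r^-1 * \sum_k cmod (A k j).
    rewrite cmod_toC ger0_norm// mulr_ge0 ?invr_ge0 ?(ltW r0)//.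
    by apply: sumr_ge0 => k _; exact: cmod_ge0.
  rewrite ler_pdivrMl// [r * 2]mulrC; apply.
  - by move=> l l1; eexists; apply: is_derive_linear_form; exact: dF.
  - have H := is_derive_linear_form z L j (dF 0 b0).
    by rewrite E0 vA in H; exact: H.
  - by rewrite E0 psi0 subrr mul0mx mxE.
  - by move=> l l1; apply: hL; apply: psiD; exact: ball.
have hdet : cmod (\det J) * cmod (\det L) <= (2 * r) ^+ n.
  rewrite -cmodM -det_mulmx -/A -det_tr; apply: cmod_det_le => j.
  by under eq_bigr do rewrite mxE; exact: col.
have k0 : 0 < (4 * n%:R : R) ^+ n by rewrite exprn_gt0// mulr_gt0.
rewrite inver; case: ifPn => [_|]; first by rewrite leey.
rewrite sqrf_eq0 cmod_eq0 -cmod_gt0 => J0.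
rewrite lee_fin ler_pdivrMr// mulrC ler_pdivlMr ?exprn_gt0// mulrC -exprMn.
have -> : (4 * n%:R : R) ^+ n = ((2 * r) ^+ n) ^+ 2.
  by rewrite -exprM mulnC exprM; congr (_ ^+ _); rewrite exprMn r2 -natrX.
rewrite ler_pXn2r ?nnegrE ?mulr_ge0 ?cmod_ge0 ?exprn_ge0 ?mulr_ge0 ?(ltW r0)//.
Qed.

(** Pushing [w] slightly away from [z] stays in the open set [D] and multiplies the form by [1 + e].
    Strictness is needed for the Cayley transforms to land in the open disc. *)
Lemma open_half_space_strict D z L w j : open D -> D w ->
  (forall w j, D w -> cRe (((w - z) *m L) 0 j) <= 1) ->
  cRe (((w - z) *m L) 0 j) < 1.
Proof.
move=> oD Dw hL; have := oD; rewrite openE => /(_ _ Dw) /near_rV[dl dl0 h].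
have l0 := l1norm_ge0 (w - z).
have l1 : 0 < 1 + l1norm (w - z) by lra.
pose e := dl / (1 + l1norm (w - z)).
have e0 : 0 < e by rewrite divr_gt0.
have : D (w + toC e *: (w - z)).
  apply: h => i; rewrite mxE addrAC subrr add0r mxE cmodM cmod_toC gtr0_norm//.
  rewrite /e mulrAC ler_pdivrMr// ler_pM2l// ler_wpDl//.
  by rewrite /l1norm (bigD1 i)//= lerDl sumr_ge0// => k _; exact: cmod_ge0.
move=> /(hL _ j); rewrite addrAC mulmxDl -scalemxAl mxE [X in _ + X]mxE.
rewrite cReD cReM cRe_toC cIm_toC mul0r subr0.
set x := cRe _ => hx; have : (1 + e) * x <= 1 by rewrite mulrDl mul1r.
by rewrite -ler_pdivlMl ?addr_gt0// => /le_lt_trans; apply; rewrite mulr1 invf_lt1; lra.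
Qed.

(** The competitor has coordinates [n^(-1/2) u / (2 - u)], with [u] the [j]-th form: Cayley
    transforms into the unit disc, scaled so that the polydisc fits into the ball. Its Jacobian
    matrix at [z] is [L / (2 sqrt n)]. *)
Lemma caratheodory_volume_ge D z L : open D -> D z ->
  (forall w j, D w -> cRe (((w - z) *m L) 0 j) <= 1) ->
  ((cmod (\det L) ^+ 2 / (4 * n%:R) ^+ n)%:E <= caratheodory_volume D z)%E.
Proof.
move=> oD Dz hL.
have nR : 0 < n%:R :> R by rewrite ltr0n.
pose r : R := Num.sqrt n%:R.
have r0 : 0 < r by rewrite sqrtr_gt0.
have r2 : r ^+ 2 = n%:R by rewrite sqr_sqrtr// ltW.
pose om w j : C := ((w - z) *m L) 0 j.
have om1 w j : D w -> 2 - om w j != 0.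
  by move=> Dw; apply: two_sub_neq0; exact: hL.
pose phi j w : C := toC r^-1 * om w j * (2 - om w j)^-1.
pose psi (w : Cn) : Cn := \sum_(j < n) phi j w *: delta_mx 0 j.
have psiE w j : psi w 0 j = phi j w.
  rewrite /psi summxE (bigD1 j)//= big1 => [|i ij].
    by rewrite mxE mxE !eqxx mulr1 addr0.
  by rewrite mxE mxE eqxx eq_sym (negbTE ij) mulr0.
have dom j w : differentiable (fun w => om w j) w by exact: differentiable_linear_form.
have hpsi : holomorphic_on D psi.
  move=> w Dw.
  rewrite (_ : psi = \sum_(j < n) (fun w => phi j w *: (delta_mx 0 j : Cn))); last first.
    by apply/funext => u; rewrite fct_sumE.
  apply: differentiable_sum => j; apply: differentiableZl.
  apply: differentiableM.
    by apply: differentiableM; [exact: differentiable_cst|exact: dom].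
  apply: differentiableV; last exact: om1.
  by apply: differentiableB; [exact: differentiable_cst|exact: dom].
have Jpsi : 'J psi z = (toC r^-1 / 2) *: L.
  apply/matrixP => k j.
  have dz : differentiable psi (z + 0 *: delta_mx 0 k).
    by rewrite scale0r addr0; exact: hpsi.
  have h := @is_derive_jacobian _ _ psi z (delta_mx 0 k) 0 j dz.
  have gen (s c : C) : is_derive (0 : C) 1 (fun l => s * (l * c) * (2 - l * c)^-1)
      (s * c / 2).
    have n2 : (2 : C) != 0 by rewrite pnatr_eq0.
    have k2 : 2 - 0 * c != 0 by rewrite mul0r subr0.
    have [dk vk] : is_derive (0 : C) 1 (fun l => 2 - l * c) (- c).
      by apply: is_derive_eq; rewrite /GRing.scale/=; ring.
    have dV : is_derive (0 : C) 1 (fun l => (2 - l * c)^-1) (c / 4).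
      split; first exact: derivableV.
      rewrite deriveV// vk /GRing.scale/= mul0r subr0; by field.
    apply: is_derive_eq; rewrite /GRing.scale/= !mul0r subr0; by field.
  have {}gen := gen (toC r^-1) (L k j).
  have E : (fun l : C => psi (z + l *: delta_mx 0 k) 0 j) =
      (fun l => toC r^-1 * (l * L k j) * (2 - l * L k j)^-1).
    apply/funext => l; rewrite psiE /phi.
    have -> // : om (z + l *: delta_mx 0 k) j = l * L k j.
    by rewrite /om addrAC subrr add0r -scalemxAl -rowE !mxE.
  rewrite E in h; case: gen => _ vg; case: h => _.
  rewrite vg scale0r addr0 -rowE mxE => <-.
  by rewrite [RHS]mxE mulrAC.
have mem : [set psi | holomorphic_maps D unit_ball psi /\ psi z = 0] psi.
  split; last first.
    by apply/rowP => j; rewrite psiE /phi /om subrr mul0mx !mxE mulr0 mul0r.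
  split => // w Dw; rewrite /unit_ball /mkset.
  have : \sum_(j < n) cmod (psi w 0 j) ^+ 2 < \sum_(j < n) (n%:R^-1 : R).
    apply: ltr_sum => [|j _]; first by apply/hasP; exists (Ordinal n0); rewrite ?mem_index_enum.
    have x1 : cRe (om w j) < 1 by exact: (open_half_space_strict j oD Dw hL).
    rewrite psiE /phi !cmodM cmodV cmod_toC gtr0_norm ?invr_gt0// !exprMn exprVn r2.
    rewrite -mulrA -[X in _ < X]mulr1 ltr_pM2l ?invr_gt0//.
    have d0 : 0 < cmod (2 - om w j) ^+ 2 by rewrite exprn_gt0// cmod_gt0 om1.
    rewrite exprVn ltr_pdivrMr// mul1r !cmod_sqr -toC_nat !cReImE.
    by move: (cRe _) (cIm _) x1 => x y; nra.
  by rewrite sumr_const card_ord -[X in _ < X]mulr_natr mulVf// gt_eqF.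
apply: (le_trans _ (ereal_sup_ubound _)); last by exists psi; [exact: mem|].
rewrite /= Jpsi detZ cmodM cmodX lee_fin [leRHS]exprMn -exprM mulnC exprM mulrC.
rewrite le_eqVlt; apply/orP; left; apply/eqP; congr (_ * _); rewrite -exprVn.
congr (_ ^+ _); rewrite cmodM cmodV -toC_nat !cmod_toC gtr0_norm ?invr_gt0//.
by rewrite ger0_norm// exprMn exprVn r2 exprVn -natrX -invfM mulrC.
Qed.

End VolumeElements.

(** * Comparison of the constants and conclusion *)

Lemma three_sqr_le_exp4 (R : realType) n : (2 <= n)%N ->
  3 * n%:R ^+ 2 + 1 <= 4 ^+ n :> R.
Proof.
elim: n => // n IH; rewrite leq_eqVlt => /orP[/eqP<-|n2].
  by rewrite expr2 (expr2 4) -!natrM natr1 ler_nat.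
have n1 : 1 <= n%:R :> R by rewrite ler1n (leq_trans _ (n2 : 2 <= n)%N).
by have := IH n2; rewrite (exprS 4) -natr1; nra.
Qed.

(** Real bounds on both sides exclude infinite values, and a positive lower bound on [k] excludes
    the convention for the inverse of 0. *)
Lemma ediv_bounds (R : realType) (v k : \bar R) (a b c d : R) :
  0 < a -> 0 < c -> (a%:E <= v <= b%:E)%E -> (c%:E <= k <= d%:E)%E ->
  ((a / d)%:E <= v / k <= (b / c)%:E)%E.
Proof.
move=> a0 c0; case: v => [v| |] /andP[]; rewrite ?lee_fin// => av vb.
case: k => [k| |] /andP[]; rewrite ?lee_fin// => ck kd.
have k0 : 0 < k by exact: lt_le_trans ck.
rewrite inver gt_eqF// -EFinM !lee_fin !ler_pM ?invr_ge0 ?lef_pV2 ?posrE//; lra.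
Qed.

Theorem theorem1p7 (R : realType) (n : nat) (hn : (2 <= n)%N)
    (D : set 'rV[Cplx R]_n) (hD : convex_domain D) (hnd : no_complex_line D)
    (z : 'rV[Cplx R]_n) (hz : D z) :
  let lower : R := pi ^+ n / ((2 * n)`!%:R * (2 * n)%:R ^+ n) in
  let upper : R := (4 * pi * (4 ^+ n - 1) / 3) ^+ n in
  (lower%:E <= caratheodory_volume D z / bergman_diag D z <= upper%:E)%E /\
  (lower%:E <= kobayashi_volume D z / bergman_diag D z <= upper%:E)%E.
Proof.
move=> lower upper; case: hD => -[_ oD _] cD.
have [P [L [PL1 hP hL]]] := domain_frame oD cD hz hnd.
have n0 : (0 < n)%N by exact: leq_trans hn.
have P0 : \det P != 0.
  by apply: contraTneq (oner_neq0 (Cplx R)) => E; rewrite -PL1 E mul0r eqxx.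
have L0 : \det L != 0.
  by apply: contraTneq (oner_neq0 (Cplx R)) => E; rewrite -PL1 E mulr0 eqxx.
have dl0 : 0 < cmod (\det L) by rewrite cmod_gt0.
have EP : cmod (\det P) = (cmod (\det L))^-1.
  apply: (mulIf (lt0r_neq0 dl0)); rewrite -cmodM PL1 mulVf ?gt_eqF//.
  exact: cmod1.
have := bergman_diag_le oD P0 hP; have := bergman_diag_ge oD L0 hL.
have := kobayashi_volume_le n0 P0 hP; have := kobayashi_volume_ge n0 hL.
have := caratheodory_volume_le P0 hP; have := caratheodory_volume_ge n0 oD hz hL.
rewrite EP; move: (cmod _) dl0 => d d0 {P0 L0 EP PL1 hP hL P L}.
move=> cge cle kge kle bge ble.
have a0 : 0 < d ^+ 2 / (4 * n%:R) ^+ n by rewrite divr_gt0 ?exprn_gt0 ?mulr_gt0 ?ltr0n.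
have c0 : 0 < d ^+ 2 / (4 * pi) ^+ n by rewrite divr_gt0 ?exprn_gt0 ?mulr_gt0 ?pi_gt0.
have hb := introT andP (conj bge ble).
(* The factor [d = |det L|] cancels in both quotients. The lower constant is obtained exactly, as
   [(2 pi)^n / ((4 n)^n (2 n)!)]; the upper one is [(4 pi n^2)^n] and is then enlarged. *)
suff [El Eu] : lower = d ^+ 2 / (4 * n%:R) ^+ n / ((2 * n)`!%:R / ((2 * pi) ^+ n * d^-1 ^+ 2))
    /\ n%:R ^+ (2 * n) / d^-1 ^+ 2 / (d ^+ 2 / (4 * pi) ^+ n) <= upper.
  rewrite El; split.
    have /andP[-> /le_trans] := ediv_bounds a0 c0 (introT andP (conj cge cle)) hb.
    by apply; rewrite lee_fin.
  have /andP[-> /le_trans] := ediv_bounds a0 c0 (introT andP (conj kge kle)) hb.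
  by apply; rewrite lee_fin.
have p0 := pi_gt0 R; rewrite /lower /upper {lower upper a0 c0 hb bge ble}.
move: pi p0 => p p0; have m0 : 0 < n%:R :> R by rewrite ltr0n.
split.
  have f0 : 0 < (2 * n)`!%:R :> R by rewrite ltr0n fact_gt0.
  have -> : (4 * n%:R : R) ^+ n = 2 ^+ n * (2 * n)%:R ^+ n.
    by rewrite -exprMn natrM; congr (_ ^+ _); ring.
  have : 0 < (2 * n)%:R ^+ n :> R by rewrite exprn_gt0// natrM mulr_gt0.
  have : 0 < 2 ^+ n :> R by rewrite exprn_gt0.
  rewrite exprMn; have : 0 < p ^+ n by rewrite exprn_gt0.
  move: (_ ^+ n) (_ ^+ n) (_ ^+ n) (_%:R) f0 => x y t s s0 x0 y0 t0.
  by field; rewrite ?gt_eqF.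
have -> : n%:R ^+ (2 * n) / d^-1 ^+ 2 / (d ^+ 2 / (4 * p) ^+ n) = (n%:R ^+ 2 * (4 * p)) ^+ n.
  rewrite exprM [RHS]exprMn; have q0 : 0 < (4 * p) ^+ n by rewrite exprn_gt0 ?mulr_gt0.
  by move: (_ ^+ n) (_ ^+ n) q0 => x y q0; field; rewrite ?gt_eqF.
rewrite lerXn2r ?nnegrE//; have := three_sqr_le_exp4 R hn; move: (4 ^+ n) => e; nra.
Qed.
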